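(* For $\beta\in\{1,2,4\}$, the $\beta$-sine process on $\mathbb R$ has $\rho_1\equiv1$ and $\rho_2(x,y)=1-T_2^{(\beta)}(x-y)$, where $T_2=T_2^{(\beta)}$ satisfies the following: $\sup_{v}|T_2(v)|<\infty$; there is a sequence $\{\alpha_N\}_{N\ge1}$ with $\log N\ll\alpha_N\ll N^{1/2-\varepsilon}$ (for some $\varepsilon>0$) such that, uniformly in $A\in[\alpha_N,N-\alpha_N]$, $\int_{\alpha_N}^AT_2(v)\log|2\sin\frac{\pi v}N|\,dv=o(1)$ as $N\to\infty$; $\int_{-\infty}^\infty T_2(v)\,dv=1$ with $1-\int_{-\alpha_N}^{\alpha_N}T_2(v)\,dv=o((\log N)^{-1})$; and $\int_{-\infty}^\infty T_2(v)\log|v|\,dv$ converges. Moreover, $$\lim_{N\to\infty}\mathbb E\,\mathcal W_N=\begin{cases}2-\gamma-\log2&\text{for }\beta=1,\\ 1-\gamma&\text{for }\beta=2,\\ \frac32-\log2-\gamma&\text{for }\beta=4,\end{cases}$$ where $\gamma$ is the Euler constant.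
   Context: For a random locally finite configuration $\{a_i\}\subset\mathbb R$ and $N\ge1$, $$\mathcal W_N=-\frac1N\sum_{i\ne j,\ a_i,a_j\in[0,N]}\log\left|2\sin\frac{\pi(a_i-a_j)}{N}\right|+\log N .$$ The $k$-point correlation function $\rho_k$ is characterized by $\mathbb E\sum_{i_1,\dots,i_k\text{ pairwise distinct}}F(a_{i_1},\dots,a_{i_k})=\int F\rho_k$. The notation $f_N\ll g_N$ means $f_N=o(g_N)$. The $\beta$-sine processes ($\beta=1,2,4$) are the stationary simple point processes on $\mathbb R$ arising as bulk local limits of eigenvalues of random matrix ensembles with orthogonal, unitary, symplectic symmetry, normalized to density 1. For $\beta=2$ the process is determinantal: $\rho_n(x_1,\dots,x_n)=\det(K^{(2)}(x_i,x_j))_{i,j=1}^n$ with $K^{(2)}(x,y)=\frac{\sin\pi(x-y)}{\pi(x-y)}$. For $\beta=1,4$ the correlation functions are quaternion determinants, $\rho_n(x_1,\dots,x_n)=\mathrm{qdet}(K^{(\beta)}(x_i,x_j))_{i,j=1}^n$, i.e. $\rho_n=\sum_{\sigma\in\mathbf S_n}\mathrm{sgn}(\sigma)\prod_{\text{cycles }(i_1\to i_2\to\dots\to i_l\to i_1)\text{ of }\sigma}\frac12\mathrm{Tr}\big(K^{(\beta)}(x_{i_1},x_{i_2})K^{(\beta)}(x_{i_2},x_{i_3})\cdots K^{(\beta)}(x_{i_l},x_{i_1})\big)$, with the $2\times2$ matrix kernels $$K^{(1)}(x,y)=\begin{pmatrix}\frac{\sin\pi(x-y)}{\pi(x-y)}&\frac{\partial}{\partial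 x}\frac{\sin\pi(x-y)}{\pi(x-y)}\\ \frac1\pi\int_0^{\pi(x-y)}\frac{\sin t}t\,dt-\frac12\mathrm{sgn}(x-y)&\frac{\sin\pi(x-y)}{\pi(x-y)}\end{pmatrix},$$ $$K^{(4)}(x,y)=\begin{pmatrix}\frac{\sin2\pi(x-y)}{2\pi(x-y)}&\frac{\partial}{\partial x}\frac{\sin2\pi(x-y)}{2\pi(x-y)}\\ \frac1{2\pi}\int_0^{2\pi(x-y)}\frac{\sin t}t\,dt&\frac{\sin2\pi(x-y)}{2\pi(x-y)}\end{pmatrix}$$ (indeterminacies at $x=y$ resolved by continuity). The corresponding second cluster functions are $$T_2^{(2)}(v)=\Big(\frac{\sin\pi v}{\pi v}\Big)^2,$$ $$T_2^{(1)}(v)=\Big(\frac{\sin\pi v}{\pi v}\Big)^2-\frac1\pi\Big(\frac{\partial}{\partial v}\frac{\sin\pi v}{\pi v}\Big)\Big(\int_0^{\pi v}\frac{\sin t}t\,dt-\frac\pi2\mathrm{sgn}(v)\Big),$$ $$T_2^{(4)}(v)=\Big(\frac{\sin2\pi v}{2\pi v}\Big)^2-\frac1{2\pi}\Big(\frac{\partial}{\partial v}\frac{\sin2\pi v}{2\pi v}\Big)\int_0^{2\pi v}\frac{\sin t}t\,dt .$$ *)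

(* Defs.v *)
From HB Require Import structures.
From mathcomp Require Export all_boot all_order all_algebra perm.
From mathcomp Require Export all_classical all_reals all_analysis measurable_realfun.
Export Order.TTheory GRing.Theory Num.Theory.
Export numFieldNormedType.Exports.

Set Implicit Arguments.
Unset Strict Implicit.
Unset Printing Implicit Defensive.

Local Open Scope classical_set_scope.
Local Open Scope ring_scope.

Variant dyson_index := beta1 | beta2 | beta4.

Section Kernels.
Context {R : realType}.
Implicit Types (b : dyson_index) (u v x y : R).

(* sin (pi v) / (pi v), continuously extended at 0 *)
Definition sinc v : R := if v == 0 then 1 else sin (pi * v) / (pi * v).

(* int_0^u sin t / t dt, an oriented integral since u may be negative;
   the value of the integrand at t = 0 is irrelevant. *)
Definition sine_integral u : R :=
  let f t := sin t / t in
  if 0 <= u then \int[lebesgue_measure]_(t in `[0, u]) f t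
  else - \int[lebesgue_measure]_(t in `[u, 0]) f t.

Definition mx2 (a b c d : R) : 'M[R]_2 :=
  \matrix_(i, j) nth 0 (nth [::] [:: [:: a; b]; [:: c; d]] i) j.

Definition K1 x y : 'M[R]_2 :=
  mx2 (sinc (x - y))
      (derive1 (fun z : R => sinc (z - y)) x)
      (pi^-1 * sine_integral (pi * (x - y)) - 2^-1 * Num.sg (x - y))
      (sinc (x - y)).

Definition K2 x y : R := sinc (x - y).

Definition K4 x y : 'M[R]_2 :=
  mx2 (sinc (2 * (x - y)))
      (derive1 (fun z : R => sinc (2 * (z - y))) x)
      ((2 * pi)^-1 * sine_integral (2 * pi * (x - y)))
      (sinc (2 * (x - y))).

(* Quaternion determinant of (K (x_i, x_j))_{i,j}.  The cycles of s are its
   orbits; each one is traversed once, as i, s i, s (s i), ..., starting from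
   its representative i (the trace does not depend on that choice). *)
Definition qdet n (K : R -> R -> 'M[R]_2) (x : 'I_n -> R) : R :=
  \sum_(s : 'S_n) (-1) ^+ (odd_perm s) *
    \prod_(i : 'I_n | froots s i)
      (2^-1 * \tr (\prod_(j <- fingraph.orbit s i) K (x j) (x (s j)))).

Definition sine_rho b n (x : n.-tuple R) : R :=
  match b with
  | beta1 => qdet K1 (tnth x)
  | beta2 => \det (\matrix_(i < n, j < n) K2 (tnth x i) (tnth x j))
  | beta4 => qdet K4 (tnth x)
  end.

Definition T2 b v : R :=
  match b with
  | beta1 => sinc v ^+ 2
      - pi^-1 * derive1 sinc v * (sine_integral (pi * v) - pi / 2 * Num.sg v)
  | beta2 => sinc v ^+ 2
  | beta4 => sinc (2 * v) ^+ 2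
      - (2 * pi)^-1 * derive1 (fun u : R => sinc (2 * u)) v
        * sine_integral (2 * pi * v)
  end.

(* The integral over the real line as the limit of the integrals over
   [a, b] when a -> -oo and b -> +oo independently.  A Lebesgue integral over
   the line would not do: T2 beta4 decays like cos (2 pi v) / v and is not
   absolutely integrable. *)
Definition improper_integral (f : R -> R) (l : R) : Prop :=
  (forall a b : R,
     lebesgue_measure.-integrable `[a, b]
       (EFin \o f : measurableTypeR R -> \bar R)) /\
  (\int[lebesgue_measure]_(v in `[p.1, p.2]) f v)
     @[p --> filter_prod (ninfty_nbhs R) (pinfty_nbhs R)] --> l.

Definition euler_gamma : R :=
  limn (fun n : nat => \sum_(1 <= k < n.+1) k%:R^-1 - ln n%:R : R).

Definition limit_mean_W b : R :=
  match b with
  | beta1 => 2 - euler_gamma - ln 2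
  | beta2 => 1 - euler_gamma
  | beta4 => 3 / 2 - ln 2 - euler_gamma
  end.

(* Integral of F with respect to Lebesgue measure on R^k, as an iterated
   integral (by Tonelli, for F measurable and nonnegative). *)
Fixpoint lebesgue_integral_tuple k : (k.-tuple R -> \bar R) -> \bar R :=
  match k with
  | 0 => fun F => F [tuple]
  | k'.+1 => fun F =>
      (\int[lebesgue_measure]_x
         lebesgue_integral_tuple (fun t : k'.-tuple R => F (cons_tuple x t)))%E
  end.

End Kernels.

Section PointProcess.
Context {R : realType} {d : measure_display} {Omega : measurableType d}.
Variables (P : probability Omega R) (L : Omega -> set R).

(* The process is simple, so that a configuration is a set of points. *)
Definition simple_point_process : Prop :=
  (forall w (a b : R), finite_set (L w `&` `[a, b])) /\
  (forall B : set (measurableTypeR R), measurable B ->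
     measurable_fun setT ((fun w => counting (L w `&` B)) : Omega -> \bar R)).

Definition stationary_process : Prop :=
  forall (t : R) (k : nat) (B : 'I_k -> set (measurableTypeR R))
         (m : 'I_k -> nat),
    (forall j, measurable (B j)) ->
    P [set w | forall j,
         counting (L w `&` [set x + t | x in B j]) = (m j)%:R%:E :> \bar R]
    = P [set w | forall j,
         counting (L w `&` B j) = (m j)%:R%:E :> \bar R].

(* As the points of L w are pairwise distinct, tuples of points with pairwise
   distinct indices are duplicate-free tuples of points. *)
Definition correlation_function (k : nat) (rho : k.-tuple R -> R) : Prop :=
  forall F : k.-tuple (measurableTypeR R) -> \bar R,
    measurable_fun setT F -> (forall x, (0 <= F x)%E) ->
    (\int[P]_w (\esum_(x in [set x : k.-tuple R |
                               uniq x /\ forall i, L w (tnth x i)]) F x)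
     = lebesgue_integral_tuple (fun x => F x * (rho x)%:E))%E.

Definition sine_process (b : dyson_index) : Prop :=
  [/\ simple_point_process,
      stationary_process &
      forall k, correlation_function (@sine_rho R b k)].

(* On the null event that 0 and N are both points, the conventional value
   ln 0 = 0 is used. *)
Definition W (N : nat) (w : Omega) : R :=
  - N%:R^-1 *
    (\sum_(p \in [set p : R * R | [/\ p.1 != p.2,
                    (L w `&` `[0, N%:R]) p.1 & (L w `&` `[0, N%:R]) p.2]])
       ln `|2 * sin (pi * (p.1 - p.2) / N%:R)|)
  + ln N%:R.

End PointProcess.

(* Main.v *)
Require Import Defs.
From mathcomp Require Import ring lra zify.

Set Implicit Arguments.
Unset Strict Implicit.
Unset Printing Implicit Defensive.

Local Open Scope classical_set_scope.
Local Open Scope ring_scope.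

(** All the integrals are limits of values of explicit primitives, and all the
    estimates compare a function with a primitive of a bound of its derivative.

    On (0, +oo), T2 is the derivative of an elementary function T2I of sinc and
    of its primitive, and |T2I v - 1/2| <= 7 / v.  The constants come from
    finite trigonometric sums.  On (0, pi/2], sin (N t) / t is replaced with
    sin (N t) / sin t, up to an error that stays bounded under integration, and
    the resulting trigonometric polynomials are integrated exactly: the Fejer
    kernel yields int sinc^2 = 1/2, its moment against ln (2 sin t) is a harmonic
    sum, which produces euler_gamma, and the kernels (1 - cos (2 k t)) cot t and
    sin (2 N t) / sin t yield the cosine integral and int sinc sincI / v, hence
    the logarithmic moments of T2.

    For the mean of W, write - ln |2 sin| as a nonnegative function minus ln 2,
    so that the pair sums can be computed from rho_2.  Since
    int_0^N (N - v) ln (2 sin (pi v / N)) dv = 0, only T2 contributes: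
    E W_N = ln N + 2 int_0^N (1 - v / N) ln (2 sin (pi v / N)) T2 v dv.
    Integrating by parts against 1/2 - T2I replaces the weight with
    ln (2 pi v / N), and the limit is ln (2 pi) + int T2 v ln |v| dv over the line.
    The pair sums are measurable because they are iterated integrals with
    respect to the kernel that counts the points in [0, N]. *)

(** * Derivatives *)

(** The obstacle is the slow decay of [T2 beta4], of order [cos (2 * pi * v) / v]: absolute values
    cannot be taken inside the integrals, and the cancellation has to be recorded in a primitive
    before anything is estimated. The elementary form of [T2I] comes from the identity [(sinc *
    sincI)' = dsinc * sincI + sinc ^+ 2], which trades the product [dsinc * sincI] in [T2] for
    [sinc ^+ 2]; against [ln] it also leaves [sinc * sincI / v]. This is why only three limits have
    to be computed by finite sums, those of [sinc2logI], [sincsincI] and [cosint - ln]. Majorants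
    always come with a primitive. A bounded primitive of the majorant gives integrability up to a
    logarithmic singularity, and two functions whose derivatives are comparable are compared by the
    mean value theorem, without changes of variables or Fubini. The term [ln N] in [W] disappears
    because [1 - 2 * T2I b N] is of order [1 / N]: the exact value 1 of the integral of [T2] is what
    makes the mean of [W] converge. *)

Definition der {R : realType} (f : R -> R) (x d : R) : Prop :=
  is_derive x (1 : R) f d.

Section Der.
Context {R : realType}.
Implicit Types (f g : R -> R) (x a b c d : R).

Lemma der_eq f x a b : der f x a -> a = b -> der f x b.
Proof. by move=> + <-. Qed.

Lemma der_near f g x a : (\near x, f x = g x) -> der f x a -> der g x a.
Proof. exact: near_eq_is_derive. Qed.

Lemma der_oo f g x a p q : p < x < q -> (forall y, p < y < q -> f y = g y) ->
  der f x a -> der g x a.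
Proof.
move=> /andP[px xq] fg; apply: der_near; near=> y; apply: fg.
apply/andP; split; near: y; [exact: lt_nbhsr|exact: lt_nbhsl].
Unshelve. all: by end_near. Qed.

Lemma der_cst c x : der (fun=> c) x 0.
Proof. exact: is_derive_cst. Qed.

Lemma der_id x : der (fun y => y) x 1.
Proof. exact: is_derive_id. Qed.

Lemma derD f g x a b : der f x a -> der g x b -> der (fun y => f y + g y) x (a + b).
Proof. exact: is_deriveD. Qed.

Lemma derN f x a : der f x a -> der (fun y => - f y) x (- a).
Proof. exact: is_deriveN. Qed.

Lemma derB f g x a b : der f x a -> der g x b -> der (fun y => f y - g y) x (a - b).
Proof. exact: is_deriveB. Qed.

Lemma derM f g x a b : der f x a -> der g x b ->
  der (fun y => f y * g y) x (a * g x + f x * b).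
Proof.
move=> fa gb; apply: (@der_eq _ _ (f x *: b + g x *: a)); first exact: is_deriveM.
by rewrite /GRing.scale/= addrC mulrC.
Qed.

Lemma derX f x a n : der f x a -> der (fun y => f y ^+ n.+1) x (n.+1%:R * f x ^+ n * a).
Proof.
move=> fa; elim: n => [|n ih].
  by rewrite expr0 !mul1r (_ : (fun y => f y ^+ 1) = f)//; apply/funext => y; rewrite expr1.
rewrite (_ : (fun y => f y ^+ n.+2) = (fun y => f y * f y ^+ n.+1)); last first.
  by apply/funext => y; rewrite exprS.
apply: der_eq; first exact: (derM fa ih).
by rewrite /= exprS; ring.
Qed.

Lemma der_comp f g x a b : der f x a -> der g (f x) b -> der (fun y => g (f y)) x (b * a).
Proof. by move=> fa gb; exact: is_derive1_comp. Qed.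

Lemma derV f x a : f x != 0 -> der f x a -> der (fun y => (f y)^-1) x (- (f x ^- 2) * a).
Proof. by move=> f0 fa; exact: is_deriveV. Qed.

Lemma der_sin f x a : der f x a -> der (fun y => sin (f y)) x (cos (f x) * a).
Proof. by move=> fa; apply: (der_comp fa); exact: is_derive_sin. Qed.

Lemma der_cos f x a : der f x a -> der (fun y => cos (f y)) x (- sin (f x) * a).
Proof. by move=> fa; apply: (der_comp fa); exact: is_derive_cos. Qed.

Lemma der_ln f x a : 0 < f x -> der f x a -> der (fun y => ln (f y)) x ((f x)^-1 * a).
Proof. by move=> f0 fa; apply: (der_comp fa); exact: is_derive1_ln. Qed.

Lemma der_sum (I : Type) (r : seq I) (P : pred I) (F : I -> R -> R) (dF : I -> R) x :
  (forall i, P i -> der (F i) x (dF i)) ->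
  der (fun y => \sum_(i <- r | P i) F i y) x (\sum_(i <- r | P i) dF i).
Proof.
move=> h; elim: r => [|i r ih].
  rewrite big_nil (_ : (fun _ => _) = fun=> 0); first exact: der_cst.
  by apply/funext => y; rewrite big_nil.
rewrite big_cons; case: ifPn => Pi.
  rewrite (_ : (fun _ => _) = fun y => F i y + \sum_(i <- r | P i) F i y).
    by apply: derD => //; exact: h.
  by apply/funext => y; rewrite big_cons Pi.
rewrite (_ : (fun _ => _) = fun y => \sum_(i <- r | P i) F i y)//.
by apply/funext => y; rewrite big_cons (negbTE Pi).
Qed.

Lemma der_continuous f x a : der f x a -> {for x, continuous f}.
Proof. by case=> fa _; apply: differentiable_continuous; exact/derivable1_diffP. Qed.

Lemma der_derive1 f x a : der f x a -> derive1 f x = a.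
Proof. by case=> _ fa; rewrite derive1E. Qed.

End Der.

Ltac der_step := cbv beta; match goal with
  | H : ?G |- ?G => exact H
  | |- der (fun _ => ?c) _ _ => exact (der_cst c _)
  | |- der (fun y => y) _ _ => exact (der_id _)
  | |- der (fun y => sin (@?f y)) _ _ => eapply (@der_sin _ f)
  | |- der (fun y => cos (@?f y)) _ _ => eapply (@der_cos _ f)
  | |- der (fun y => ln (@?f y)) _ _ => eapply (@der_ln _ f)
  | |- der (fun y => @?f y - @?g y) _ _ => eapply (@derB _ f g)
  | |- der (fun y => @?f y + @?g y) _ _ => eapply (@derD _ f g)
  | |- der (fun y => - (@?f y)) _ _ => eapply (@derN _ f)
  | |- der (fun y => @?f y * @?g y) _ _ => eapply (@derM _ f g)
  | |- der (fun y => @?f y ^+ _.+1) _ _ => eapply (@derX _ f)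
  | |- der (fun y => (@?f y)^-1) _ _ => eapply (@derV _ f)
  | |- der (fun y => ?g y) _ _ => solve [eauto 3]
  | |- der (fun y => ?g (@?f y)) _ _ =>
      eapply (@der_comp _ f g); [| solve [cbv beta; eauto 3]]
  end.
Ltac der_auto := eapply der_eq; [repeat der_step|]; cbv beta.

(** * Inequalities between functions from inequalities between their derivatives *)

Section Comparison.
Context {R : realType}.
Implicit Types (F f H h : R -> R) (a b x y l m K : R).

Lemma der_comparison F f H h x y : x <= y ->
  (forall z, x <= z <= y -> der F z (f z)) ->
  (forall z, x <= z <= y -> der H z (h z)) ->
  (forall z, x <= z <= y -> `|f z| <= h z) ->
  `|F y - F x| <= H y - H x.
Proof.
move=> xy dF dH fh.
have mono (e : R) : `|e| = 1 -> e * (F y - F x) <= H y - H x.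
  move=> e1; rewrite -subr_ge0.
  pose G z := H z - e * F z.
  have dG z : x <= z <= y -> der G z (h z - e * f z).
    move=> zxy; have hF := dF z zxy; have hH := dH z zxy.
    by apply: der_eq; [exact: (derB hH (derM (der_cst e z) hF))|rewrite mul0r add0r].
  have [||c cxy Gc] := @MVT_segment R G (fun z => h z - e * f z) x y xy.
  - by move=> z; rewrite in_itv/= => /andP[xz zy]; apply: dG; rewrite !ltW.
  - apply: continuous_in_subspaceT => z; rewrite inE/= in_itv/= => zxy.
    exact: der_continuous (dG z zxy).
  - have -> : H y - H x - e * (F y - F x) = G y - G x by rewrite /G; ring.
    rewrite Gc mulr_ge0 ?subr_ge0//.
    move: cxy; rewrite in_itv/= => cxy.
    by rewrite (le_trans _ (fh c cxy))// (le_trans (ler_norm _))// normrM e1 mul1r.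
rewrite ler_norml; apply/andP; split.
  by have := mono (-1); rewrite normrN1 => /(_ erefl); lra.
by have := mono 1; rewrite normr1 => /(_ erefl); lra.
Qed.

(** Both functions may be singular at [a]: the inequality on [[x, y]] passes to the limit as [x]
    decreases to [a]. *)
Lemma der_comparison_right F f H h a y l m : a < y ->
  (forall z, a < z <= y -> der F z (f z)) ->
  (forall z, a < z <= y -> der H z (h z)) ->
  (forall z, a < z <= y -> `|f z| <= h z) ->
  F x @[x --> a^'+] --> l -> H x @[x --> a^'+] --> m ->
  `|F y - l| <= H y - m.
Proof.
move=> ay dF dH fh Fl Hm.
have lN : `|F y - F x| @[x --> a^'+] --> `|F y - l|.
  by apply: cvg_norm; apply: cvgB => //; exact: cvg_cst.
have rN : H y - H x @[x --> a^'+] --> H y - m by apply: cvgB => //; exact: cvg_cst.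
apply: (ler_cvg_to lN rN); near=> x.
have ax : a < x by near: x; exact: nbhs_right_gt.
have xy : x <= y by near: x; exact: nbhs_right_le.
apply: (@der_comparison F f H h) => // z /andP[xz zy].
- by apply: dF; rewrite zy (lt_le_trans ax).
- by apply: dH; rewrite zy (lt_le_trans ax).
- by apply: fh; rewrite zy (lt_le_trans ax).
Unshelve. all: by end_near. Qed.

Lemma der_comparison_oo F f H h a b l m l' m' : a < b ->
  (forall z, a < z < b -> der F z (f z)) ->
  (forall z, a < z < b -> der H z (h z)) ->
  (forall z, a < z < b -> `|f z| <= h z) ->
  F x @[x --> a^'+] --> l -> H x @[x --> a^'+] --> m ->
  F x @[x --> b^'-] --> l' -> H x @[x --> b^'-] --> m' ->
  `|l' - l| <= m' - m.
Proof.
move=> ab dF dH fh Fl Hm Fl' Hm'.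
have lN : `|F x - l| @[x --> b^'-] --> `|l' - l|.
  by apply: cvg_norm; apply: cvgB => //; exact: cvg_cst.
have rN : H x - m @[x --> b^'-] --> m' - m by apply: cvgB => //; exact: cvg_cst.
apply: (ler_cvg_to lN rN); near=> y.
have yb : y < b by near: y; exact: nbhs_left_lt.
have ay : a < y by near: y; exact: nbhs_left_gt.
apply: (@der_comparison_right F f H h a) => // z /andP[xz zy].
- by apply: dF; rewrite xz (le_lt_trans zy).
- by apply: dH; rewrite xz (le_lt_trans zy).
- by apply: fh; rewrite xz (le_lt_trans zy).
Unshelve. all: by end_near. Qed.

Lemma der0_cst F a b x y : (forall z, a < z < b -> der F z 0) ->
  a < x < b -> a < y < b -> F x = F y.
Proof.
move=> dF; wlog xy : x y / x <= y => [th|].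
  by case/orP: (le_total x y) => xy ? ?; [exact: th|symmetry; exact: th].
move=> /andP[ax xb] /andP[ay yb].
have := @der_comparison F (fun=> 0) (fun=> 0) (fun=> 0) x y xy.
rewrite subrr => h; apply/esym/eqP; rewrite -subr_eq0 -normr_le0; apply: h => z /andP[xz zy].
- by apply: dF; rewrite (lt_le_trans ax xz) (le_lt_trans zy yb).
- exact: der_cst.
- by rewrite normr0.
Qed.

End Comparison.

(** * Integrals of dominated functions *)

Section DominatedFTC.
Context {R : realType}.
Implicit Types (F f H h : R -> R) (a b x y l m K : R).
Local Notation mu := (@lebesgue_measure R).

Lemma der_Rintegral f a b y : mu.-integrable `[a, b] (EFin \o f) ->
  a < y < b -> {for y, continuous f} ->
  der (fun x => \int[mu]_(t in `[a, x]) f t) y (f y).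
Proof.
move=> intf /andP[ay yb] cf.
have [d1 d2] := @continuous_FTC1_closed R f a y b yb intf ay cf.
rewrite /der -d2 derive1E; exact/derivableP.
Qed.

(** The margins [x1 < x] and [y < y1] make both ends interior points, where the indefinite integral
    of [f] is differentiable and can be compared with [H]. *)
Lemma continuous_Rintegral_segment f H h x y x1 y1 : x1 < x -> x <= y -> y < y1 ->
  (forall z, x1 <= z <= y1 -> {for z, continuous f}) ->
  (forall z, x1 <= z <= y1 -> der H z (h z)) ->
  (forall z, x1 <= z <= y1 -> `|f z| <= h z) ->
  mu.-integrable `[x, y] (EFin \o f) /\ `|\int[mu]_(t in `[x, y]) f t| <= H y - H x.
Proof.
move=> x1x xy yy1 cf dH fh.
have intf : mu.-integrable `[x1, y1] (EFin \o f).
  apply: continuous_compact_integrable; first exact: segment_compact.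
  by apply: continuous_in_subspaceT => z; rewrite inE/= in_itv/= => ?; exact: cf.
have intS : mu.-integrable `[x, y] (EFin \o f).
  apply: integrableS intf => //; apply: subset_itv; rewrite bnd_simp; exact: ltW.
split => //.
pose G z := \int[mu]_(t in `[x1, z]) f t.
have dG z : x1 < z < y1 -> der G z (f z).
  by move=> zxy; apply: (der_Rintegral intf) => //; apply: cf; case/andP: zxy => ? ?; rewrite !ltW.
have := @der_comparison R G f H h x y xy.
have -> : G y - G x = \int[mu]_(t in `[x, y]) f t.
  rewrite /G Rintegral_itvB ?bnd_simp; first last.
  - exact: xy.
  - exact: ltW.
  - apply: integrableS intf => //; apply: subset_itv; rewrite bnd_simp//; exact: ltW.
  rewrite Rintegral_itv_obnd_cbnd//.
  by apply: integrableS intS => //; apply: subset_itv; rewrite bnd_simp.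
have sub z : x <= z <= y -> x1 < z < y1.
  by move=> /andP[xz zy]; rewrite (lt_le_trans x1x xz) (le_lt_trans zy yy1).
have subw z : x <= z <= y -> x1 <= z <= y1 by move=> /sub /andP[? ?]; rewrite !ltW.
by apply => z /[dup] /sub ? /subw ?; [exact: dG|exact: dH|exact: fh].
Qed.

(* Only the monotone primitive H of the dominating function has to be bounded:
   f itself may have integrable singularities at both ends. *)
Lemma dominated_integrable f H h a b K : a < b ->
  (forall z, a < z < b -> {for z, continuous f}) ->
  (forall z, a < z < b -> der H z (h z)) ->
  (forall z, a < z < b -> `|f z| <= h z) ->
  (forall z, a < z < b -> `|H z| <= K) ->
  mu.-integrable `[a, b] (EFin \o f).
Proof.
move=> ab cf dH fh HK.
have K0 : 0 <= K.
  have /HK : a < (a + b) / 2 < b by lra.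
  exact: le_trans.
have mf : measurable_fun `]a, b[ f.
  apply: open_continuous_measurable_fun; first exact: interval_open.
  by move=> z; rewrite inE/= in_itv/= => ?; exact: cf.
have mfc : measurable_fun `[a, b] f by exact: (measurable_fun_itv_cc mf).
apply/integrableP; split; first exact/measurable_EFinP.
rewrite (_ : (\int[mu]_(x in `[a, b]) _ = \int[mu]_(x in `]a, b[) `|(f x)%:E|)%E); last first.
  rewrite -(@integral_itv_bndoo _ _ _ _ true false)//.
  by apply: measurableT_comp => //; exact/measurable_EFinP.
(* The segments [[a + e n, b - e n]] exhaust []a, b[]; the denominator [n.+3] gives
   [3 * e n <= b - a], which keeps them nondegenerate. *)
pose e n := (b - a) / (n.+3)%:R : R.
have e0 n : 0 < e n by rewrite divr_gt0// subr_gt0.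
have e3 n : 3 * e n <= b - a.
  rewrite /e mulrCA ler_piMr ?subr_ge0 ?(ltW ab)// ler_pdivrMr// mul1r ler_nat; lia.
have ele (n m : nat) : (n <= m)%N -> e m <= e n.
  move=> nm; rewrite /e ler_pM2l ?subr_gt0// lef_pV2 ?posrE// ler_nat; lia.
pose A n : set (measurableTypeR R) := `[a + e n, b - e n]%classic.
have AU : \bigcup_n A n = `]a, b[%classic.
  apply/seteqP; split => [z [n _]|z].
    rewrite /A/= !in_itv/= => /andP[az zb]; have := e0 n.
    by move=> ?; apply/andP; split; lra.
  rewrite /= in_itv/= => /andP[az zb].
  have [n nP] : exists n, e n <= Num.min (z - a) (b - z).
    have m0 : 0 < Num.min (z - a) (b - z) by rewrite lt_min !subr_gt0 az.
    exists (Num.truncn ((b - a) / Num.min (z - a) (b - z))).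
    rewrite /e ler_pdivrMr// mulrC -ler_pdivrMr// ltW//.
    apply: lt_le_trans (truncnS_gt _) _; rewrite ler_nat; exact: leq_trans (leqnSn _) (leqnSn _).
  exists n => //; rewrite /A/= in_itv/=; move: nP; rewrite le_min => /andP[? ?].
  by apply/andP; split; lra.
have mA n : measurable (A n) by exact: measurable_itv.
have ndA : nondecreasing_seq A.
  move=> n m nm; apply/subsetPset => z; rewrite /A/= !in_itv/= => /andP[? ?].
  have := ele _ _ nm => ?; apply/andP; split; lra.
have cv : (\int[mu]_(x in A n) `|(f x)%:E|)%E @[n --> \oo] -->
    (\int[mu]_(x in \bigcup_n A n) `|(f x)%:E|)%E.
  apply: ge0_nondecreasing_set_cvg_integral => // n.
  apply: measurableT_comp => //; apply/measurable_EFinP.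
  by apply: measurable_funS mf => //; rewrite -AU; exact: bigcup_sup.
rewrite AU in cv.
(* The segment of index [n.+1] provides the margins around the segment of index [n]; the integral is
   then at most an increment of [H], hence at most [2 * K]. *)
have bnd n : (\int[mu]_(x in A n) `|(f x)%:E| <= (2 * K)%:E)%E.
  have := e0 n.+1; have := e0 n; have := e3 n => e3n en en1.
  have ee : e n.+1 < e n.
    by rewrite /e ltr_pM2l ?subr_gt0// ltf_pV2 ?posrE// ltr_nat.
  have [x1x xy yy1] : [/\ a + e n.+1 < a + e n, a + e n <= b - e n & b - e n < b - e n.+1].
    by split; lra.
  have [|||i1 i2] := @continuous_Rintegral_segment (fun z => `|f z|) H h _ _ _ _ x1x xy yy1.
  - move=> z /andP[? ?]; have zab : a < z < b by apply/andP; split; lra.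
    by apply: continuous_comp; [exact: cf|exact: norm_continuous].
  - by move=> z /andP[? ?]; apply: dH; apply/andP; split; lra.
  - by move=> z /andP[? ?]; rewrite normr_id; apply: fh; apply/andP; split; lra.
  have fin := integrable_fin_num (mA n) i1.
  rewrite (_ : integral _ _ _ = (\int[mu]_(t in A n) `|f t|)%:E); last by rewrite -(fineK fin).
  rewrite lee_fin.
  have := HK (a + e n); have := HK (b - e n).
  have -> : a < b - e n < b by apply/andP; split; lra.
  have -> : a < a + e n < b by apply/andP; split; lra.
  move=> /(_ isT) + /(_ isT); rewrite !ler_norml => /andP[? ?] /andP[? ?].
  apply: le_trans (ler_norm _) (le_trans i2 _); lra.
apply: (@le_lt_trans _ _ (2 * K)%:E); last exact: ltry.
apply: (cvge_le _ cv); near=> n; exact: bnd.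
Unshelve. all: by end_near. Qed.

(** Inside the interval, [F] differs by a constant from the indefinite integral. Both have one-sided
    limits at the ends, and the constant can be read at either end. *)
Lemma FTC_integrable f F a b l m : a < b ->
  mu.-integrable `[a, b] (EFin \o f) ->
  (forall z, a < z < b -> {for z, continuous f}) ->
  (forall z, a < z < b -> der F z (f z)) ->
  F x @[x --> a^'+] --> l -> F x @[x --> b^'-] --> m ->
  \int[mu]_(t in `[a, b]) f t = m - l.
Proof.
move=> ab intf cf dF Fl Fm.
pose G x := \int[mu]_(t in `[a, x]) f t.
have /(continuous_within_itvP _ ab)[_ Ga Gb] :=
  parameterized_integral_continuous (ltW ab) intf.
have Ga0 : G x @[x --> a^'+] --> 0.
  by move: Ga; rewrite /parameterized_integral set_itv1 Rintegral_set1.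
pose c := (a + b) / 2.
have cab : a < c < b by rewrite /c; lra.
have FG x : a < x < b -> F x - G x = F c - G c.
  move=> xab; apply: (@der0_cst R (fun x => F x - G x) a b) => // z zab.
  by rewrite -(subrr (f z)); apply: derB; [exact: dF|exact/(der_Rintegral intf)/cf].
have la : F x - G x @[x --> a^'+] --> l - 0 by exact: cvgB.
have lb : F x - G x @[x --> b^'-] --> m - G b by exact: cvgB.
have ca : F x - G x @[x --> a^'+] --> F c - G c.
  apply: cvg_near_cst; near=> x; apply: FG; apply/andP; split; near: x.
    exact: nbhs_right_gt.
  exact: nbhs_right_lt.
have cb : F x - G x @[x --> b^'-] --> F c - G c.
  apply: cvg_near_cst; near=> x; apply: FG; apply/andP; split; near: x.
    exact: nbhs_left_gt.
  exact: nbhs_left_lt.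
have e1 : m - G b = F c - G c by exact: cvg_unique lb cb.
have e2 : l - 0 = F c - G c by exact: cvg_unique la ca.
by move: e1; rewrite -e2 subr0 -/(G b) => <-; rewrite opprB addrC subrK.
Unshelve. all: by end_near. Qed.

Lemma dominated_FTC f F H h a b l m K : a < b ->
  (forall z, a < z < b -> {for z, continuous f}) ->
  (forall z, a < z < b -> der H z (h z)) ->
  (forall z, a < z < b -> `|f z| <= h z) ->
  (forall z, a < z < b -> `|H z| <= K) ->
  (forall z, a < z < b -> der F z (f z)) ->
  F x @[x --> a^'+] --> l -> F x @[x --> b^'-] --> m ->
  mu.-integrable `[a, b] (EFin \o f) /\ \int[mu]_(t in `[a, b]) f t = m - l.
Proof.
move=> ab cf dH fh HK dF Fl Fm.
have intf := dominated_integrable ab cf dH fh HK.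
by split => //; exact: (FTC_integrable ab intf cf dF Fl Fm).
Qed.

Lemma integrable_primitive f a b : a < b ->
  mu.-integrable `[a, b] (EFin \o f) ->
  (forall z, a < z < b -> {for z, continuous f}) ->
  exists F, [/\ (forall z, a < z < b -> der F z (f z)),
    F x @[x --> a^'+] --> 0 &
    F x @[x --> b^'-] --> \int[mu]_(t in `[a, b]) f t].
Proof.
move=> ab intf cf; exists (fun x => \int[mu]_(t in `[a, x]) f t).
have /(continuous_within_itvP _ ab)[_ Ga Gb] :=
  parameterized_integral_continuous (ltW ab) intf.
split => //.
- by move=> z zab; apply: (der_Rintegral intf) => //; exact: cf.
- by move: Ga; rewrite /parameterized_integral set_itv1 Rintegral_set1.
Qed.

Lemma dominated_primitive f H h a b K : a < b ->
  (forall z, a < z < b -> {for z, continuous f}) ->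
  (forall z, a < z < b -> der H z (h z)) ->
  (forall z, a < z < b -> `|f z| <= h z) ->
  (forall z, a < z < b -> `|H z| <= K) ->
  exists F, exists l, [/\ (forall z, a < z < b -> der F z (f z)),
    F x @[x --> a^'+] --> 0 & F x @[x --> b^'-] --> l].
Proof.
move=> ab cf dH fh HK; have intf := dominated_integrable ab cf dH fh HK.
have [F [dF F0 Fl]] := integrable_primitive ab intf cf.
by exists F, (\int[mu]_(t in `[a, b]) f t).
Qed.

End DominatedFTC.
(** * Limits at a point from the right *)

Section RightLimits.
Context {R : realType}.
Implicit Types (F G : R -> R) (a b x l C : R).

Lemma der_cvg_right F a d : der F a d -> F x @[x --> a^'+] --> F a.
Proof. by move=> /der_continuous cF; exact: cvg_at_right_filter. Qed.

Lemma der_cvg_left F a d : der F a d -> F x @[x --> a^'-] --> F a.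
Proof. by move=> /der_continuous cF; exact: cvg_at_left_filter. Qed.

Lemma cvg_right_squeeze F G a b l : a < b ->
  (forall x, a < x < b -> `|F x - l| <= G x) ->
  G x @[x --> a^'+] --> 0 -> F x @[x --> a^'+] --> l.
Proof.
move=> ab FG G0; apply/cvgrPdist_le => e e0.
move/cvgr0Pnorm_le : G0 => /(_ e e0) G0; near=> x.
rewrite distrC; apply: le_trans (FG x _) _; last first.
  by apply: le_trans (ler_norm _) _; near: x.
apply/andP; split; near: x; [exact: nbhs_right_gt|exact: nbhs_right_lt].
Unshelve. all: by end_near. Qed.

Lemma cvg_right0_linear F C b l : 0 < b ->
  (forall x, 0 < x < b -> `|F x - l| <= C * x) -> F x @[x --> 0^'+] --> l.
Proof.
move=> b0 h; apply: (cvg_right_squeeze b0 h).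
have := der_cvg_right (derM (der_cst C 0) (der_id 0)).
by rewrite /= mulr0.
Qed.

Lemma cvg_right0_scale F l C : 0 < C -> F x @[x --> 0^'+] --> l ->
  F (C * x) @[x --> 0^'+] --> l.
Proof.
move=> C0 Fl; apply/cvgrPdist_le => e e0.
move/cvgrPdist_le : Fl => /(_ e e0) [d /= d0 hd].
exists (d / C); first by rewrite /= divr_gt0.
move=> x /= + x0; rewrite sub0r normrN gtr0_norm// => xd.
apply: hd; last by rewrite mulr_gt0.
by rewrite /= sub0r normrN gtr0_norm ?mulr_gt0// mulrC -ltr_pdivlMr.
Qed.

(** This is [ln y < y] at [y = (Num.sqrt x)^-1]. *)
Lemma norm_xlnx_le x : 0 < x < 1 -> `|x * ln x| <= 2 * Num.sqrt x.
Proof.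
move=> /andP[x0 x1].
have s0 : 0 < Num.sqrt x by rewrite sqrtr_gt0.
have xs : x = Num.sqrt x ^+ 2 by rewrite sqr_sqrtr// ltW.
have lx : ln x < 0 by rewrite ln_lt0// x0.
rewrite normrM gtr0_norm// ltr0_norm// -lnV//.
have : ln x^-1 <= 2 / Num.sqrt x.
  rewrite {1}xs -exprVn lnXn ?invr_gt0// mulr2n.
  have h : 0 < (Num.sqrt x)^-1 by rewrite invr_gt0.
  have := ln_sublinear h; lra.
move=> /(ler_wpM2l (ltW x0)) /le_trans; apply.
by rewrite {1}xs le_eqVlt; apply/orP; left; apply/eqP; field; rewrite gt_eqF.
Qed.

Lemma cvg_xlnx : x * ln x @[x --> (0 : R)^'+] --> (0 : R).
Proof.
apply: (@cvg_right_squeeze _ (fun x => 2 * Num.sqrt x) 0 1) => //.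
  by move=> x x01; rewrite subr0; exact: norm_xlnx_le.
have h : Num.sqrt x @[x --> (0 : R)^'+] --> (0 : R).
  by rewrite -[X in _ --> X]sqrtr0; apply: cvg_at_right_filter; exact: sqrt_continuous.
by rewrite -[X in _ --> X](mulr0 2); apply: cvgM h; exact: cvg_cst.
Qed.

End RightLimits.

(* [pi] unfolds to a doubled real, which [field] would look through. *)
Ltac hide_pi := match goal with |- context [@pi ?R] =>
  pose proof (@pi_gt0 R); generalize dependent (@pi R); intros end.
Ltac pi_field := hide_pi; field.

(** * Elementary trigonometric inequalities *)

Section TrigInequalities.
Context {R : realType}.
Implicit Types t x : R.

Lemma sin_le_id t : 0 <= t -> sin t <= t.
Proof.
move=> t0; have := @der_comparison R sin cos id (fun=> 1) 0 t t0.
rewrite sin0 !subr0 => h.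
apply: le_trans (ler_norm _) (h _ _ _) => z _; [exact: is_derive_sin|exact: der_id|exact: cos_max].
Qed.

Lemma norm_sin_le t : `|sin t| <= `|t|.
Proof.
wlog t0 : t / 0 <= t => [th|].
  case: (leP 0 t) => [|t0]; first exact: th.
  by rewrite -(normrN t) -(normrN (sin t)) -sinN; apply: th; lra.
rewrite (ger0_norm t0).
have := @der_comparison R sin cos id (fun=> 1) 0 t t0.
rewrite sin0 !subr0; apply => z _; [exact: is_derive_sin|exact: der_id|exact: cos_max].
Qed.

(** The difference [sin z - z * cos z] vanishes at 0 and has derivative [z * sin z]. *)
Lemma mul_cos_le_sin t : 0 <= t <= pi -> t * cos t <= sin t.
Proof.
move=> /andP[t0 tpi].
have := @der_comparison R (fun=> 0) (fun=> 0) (fun z => sin z - z * cos z)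
  (fun z => z * sin z) 0 t t0.
rewrite sin0 mul0r !subr0 normr0 subr_ge0; apply => z /andP[z0 zt].
- exact: der_cst.
- der_auto; ring.
- by rewrite mulr_ge0// sin_ge0_pi// z0 (le_trans zt).
Qed.

Lemma cos_ge_quadratic t : 1 - t ^+ 2 / 2 <= cos t.
Proof.
have -> : cos t = 1 - 2 * sin (t / 2) ^+ 2.
  by rewrite [in LHS](splitr t) cosD -!expr2 cos2sin2; ring.
have := norm_sin_le (t / 2).
rewrite -ler_sqr ?nnegrE// !real_normK ?num_real// expr_div_n; lra.
Qed.

(** Squaring [t * cos t <= sin t] gives [t ^+ 2 - sin t ^+ 2 <= t ^+ 2 * sin t ^+ 2], which is the
    upper bound. It is the price of replacing [sin t] with [t] in the Fejer kernel. *)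
Lemma csc2_sub_invsq t : 0 < t <= pi / 2 -> 0 <= sin t ^- 2 - t ^- 2 <= 1.
Proof.
move=> /andP[t0 tpi]; have := @pi_gt0 R => pi0.
have s0 : 0 < sin t by rewrite sin_gt0_pi// t0; lra.
have st := sin_le_id (ltW t0).
have tc : t * cos t <= sin t by apply: mul_cos_le_sin; apply/andP; split; lra.
have c0 : 0 <= cos t by apply: cos_ge0_pihalf; apply/andP; split; lra.
apply/andP; split.
  by rewrite subr_ge0 lef_pV2 ?posrE ?exprn_gt0// lerXn2r// nnegrE ltW.
have h : t ^+ 2 * cos t ^+ 2 <= sin t ^+ 2.
  by rewrite -exprMn lerXn2r// nnegrE ?mulr_ge0 // ltW.
have -> : sin t ^- 2 - t ^- 2 = (t ^+ 2 - sin t ^+ 2) / (sin t ^+ 2 * t ^+ 2).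
  by field; rewrite !gt_eqF.
rewrite ler_pdivrMr ?mulr_gt0 ?exprn_gt0// mul1r.
move: h; rewrite cos2sin2; lra.
Qed.

(** The square of [t^-1 + t / 2] is [t ^- 2 + 1 + t ^+ 2 / 4], which is at least [sin t ^- 2] by
    [csc2_sub_invsq]. *)
Lemma csc_sub_inv t : 0 < t <= pi / 2 -> 0 <= (sin t)^-1 - t^-1 <= t / 2.
Proof.
move=> /[dup] h /csc2_sub_invsq /andP[_ h1]; have := @pi_gt0 R => pi0.
case/andP: h => t0 tpi.
have s0 : 0 < sin t by rewrite sin_gt0_pi// t0; lra.
apply/andP; split.
  by rewrite subr_ge0 lef_pV2 ?posrE// sin_le_id// ltW.
have ti : 0 < t^-1 by rewrite invr_gt0.
have si : 0 < (sin t)^-1 by rewrite invr_gt0.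
rewrite lerBlDl -ler_sqr ?nnegrE; [|lra|lra].
have e : (t^-1 + t / 2) ^+ 2 = t ^- 2 + 1 + t ^+ 2 / 4 by field; rewrite gt_eqF.
have t2 : 0 <= t ^+ 2 by exact: sqr_ge0.
rewrite e exprVn; lra.
Qed.

Lemma cot_le t : 0 < t < pi -> cos t / sin t <= t^-1.
Proof.
move=> /andP[t0 tpi]; have s0 : 0 < sin t by rewrite sin_gt0_pi// t0.
rewrite ler_pdivrMr// mulrC ler_pdivlMr// mulrC mul_cos_le_sin//.
by rewrite !ltW.
Qed.

Lemma cot_sub_inv t : 0 < t <= pi / 2 -> - t <= cos t / sin t - t^-1 <= 0.
Proof.
move=> /[dup] h /csc_sub_inv /andP[h0 h1]; have := @pi_gt0 R => pi0.
case/andP: h => t0 tpi.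
have s0 : 0 < sin t by rewrite sin_gt0_pi// t0; lra.
have c0 : 0 <= cos t by apply: cos_ge0_pihalf; apply/andP; split; lra.
apply/andP; split; last first.
  by rewrite subr_le0 cot_le// t0; lra.
have : cos t * t^-1 <= cos t / sin t by rewrite ler_wpM2l//; lra.
have : (1 - t ^+ 2 / 2) * t^-1 <= cos t * t^-1.
  by rewrite ler_wpM2r ?cos_ge_quadratic// invr_ge0 ltW.
have -> : (1 - t ^+ 2 / 2) * t^-1 = t^-1 - t / 2 by field; rewrite gt_eqF.
lra.
Qed.

Lemma ln_sinc_ge t : 0 < t <= pi / 2 -> - t ^+ 2 <= ln (sin t / t) <= 0.
Proof.
move=> /[dup] h /csc_sub_inv /andP[h0 h1]; have := @pi_gt0 R => pi0.
case/andP: h => t0 tpi.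
have s0 : 0 < sin t by rewrite sin_gt0_pi// t0; lra.
apply/andP; split; last first.
  by rewrite ln_le0// ler_pdivrMr// mul1r sin_le_id// ltW.
have p : 0 < t / sin t by rewrite divr_gt0.
have : ln (1 + (t / sin t - 1)) <= t / sin t - 1 by apply: le_ln1Dx; lra.
have -> : 1 + (t / sin t - 1) = (sin t / t)^-1 by rewrite invf_div; ring.
rewrite lnV ?posrE ?divr_gt0// => h2.
have : t / sin t <= 1 + t ^+ 2 / 2.
  have : t / sin t <= t * (t^-1 + t / 2) by rewrite ler_pM2l//; lra.
  have -> : t * (t^-1 + t / 2) = 1 + t ^+ 2 / 2 by field; rewrite gt_eqF.
  by [].
have := sqr_ge0 t; lra.
Qed.

(* Jordan's inequality, symmetrised about [pi / 2]. *)
Lemma sin_pi_ge t : 0 < t < 1 -> t * (1 - t) <= sin (pi * t).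
Proof.
move=> /andP[t0 t1]; have := @pi_gt0 R => pi0; have p2 := @pi_ge2 R.
have half (u : R) : 0 < u <= 1 / 2 -> u <= sin (pi * u).
  move=> /andP[u0 u1].
  have z0 : 0 < pi * u by rewrite mulr_gt0.
  have zh : pi * u <= pi / 2 by rewrite ler_pM2l//; lra.
  have s0 : 0 < sin (pi * u) by rewrite sin_gt0_pi// z0; lra.
  have /andP[_] : 0 <= (sin (pi * u))^-1 - (pi * u)^-1 <= pi * u / 2.
    by apply: csc_sub_inv; rewrite z0.
  have := @pihalf_lt2 R => p4.
  rewrite lerBlDl => h.
  rewrite -lef_pV2 ?posrE//; apply: le_trans h _.
  have -> : (pi * u)^-1 + pi * u / 2 = u^-1 * (pi^-1 + pi * u ^+ 2 / 2).
    by pi_field; rewrite !gt_eqF.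
  rewrite ger_pMr ?invr_gt0//.
  have : pi^-1 <= 2^-1 :> R by rewrite lef_pV2 ?posrE.
  have : pi * u ^+ 2 <= 4 * (1 / 2) ^+ 2.
    by apply: ler_pM; rewrite ?sqr_ge0 ?ler_sqr ?nnegrE; lra.
  lra.
have [th|th] := leP t (1 / 2).
  by apply: le_trans (half t _); [rewrite ger_pMr//; lra|rewrite t0].
have -> : sin (pi * t) = sin (pi * (1 - t)).
  by rewrite mulrBr mulr1 sinB sinpi cospi; ring.
by apply: le_trans (half (1 - t) _); [rewrite ger_pMl; lra|apply/andP; split; lra].
Qed.

Lemma ln2sin_bounds t : 0 < t < 1 ->
  ln t + ln (1 - t) <= ln (2 * sin (pi * t)) <= ln 2.
Proof.
move=> /[dup] h /andP[t0 t1]; have := @pi_gt0 R => pi0.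
have s0 : 0 < sin (pi * t).
  by apply: lt_le_trans (sin_pi_ge h); rewrite mulr_gt0// subr_gt0.
apply/andP; split.
  rewrite -lnM ?posrE ?subr_gt0// ler_ln ?posrE ?mulr_gt0 ?subr_gt0//.
  by apply: le_trans (sin_pi_ge h) _; lra.
by rewrite ler_ln ?posrE ?mulr_gt0//; have := sin_le1 (pi * t); lra.
Qed.

End TrigInequalities.
(** * The functions [sinc] and [sine_integral] *)

Section SineIntegral.
Context {R : realType}.
Implicit Types (t u v x y : R).
Local Notation mu := (@lebesgue_measure R).

Lemma sinc0 : sinc 0 = 1 :> R.
Proof. by rewrite /sinc eqxx. Qed.

Lemma sincE v : v != 0 -> sinc v = sin (pi * v) / (pi * v).
Proof. by rewrite /sinc => /negbTE ->. Qed.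

Lemma sincN v : sinc (- v) = sinc v.
Proof. by rewrite /sinc oppr_eq0 !mulrN sinN invrN mulrNN. Qed.

Lemma der_sinc v : v != 0 -> der sinc v ((cos (pi * v) - sinc v) / v).
Proof.
move=> v0; have pi0 := @pi_gt0 R.
have h : der (fun y => sin (pi * y) / (pi * y)) v ((cos (pi * v) - sinc v) / v).
  der_auto; first by rewrite mulf_neq0// gt_eqF.
  by rewrite sincE//; pi_field; rewrite v0 gt_eqF.
have [vn|vp|/eqP] := ltgtP v 0; last by rewrite (negbTE v0).
- apply: (der_oo (p := v - 1) (q := 0) _ _ h); first by rewrite vn gtrBl ltr01.
  by move=> y /andP[_ y0]; rewrite sincE// lt_eqF.
- apply: (der_oo (p := 0) (q := v + 1) _ _ h); first by rewrite vp ltrDl ltr01.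
  by move=> y /andP[y0 _]; rewrite sincE// gt_eqF.
Qed.

Lemma norm_sinc_le1 v : `|sinc v| <= 1.
Proof.
have [->|v0] := eqVneq v 0; first by rewrite sinc0 normr1.
have p0 : 0 < `|pi * v| by rewrite normr_gt0 mulf_neq0// gt_eqF// pi_gt0.
by rewrite sincE// normrM normfV ler_pdivrMr// mul1r norm_sin_le.
Qed.

Lemma norm_sinc_mul_le v : `|sinc v * v| <= 1.
Proof.
have [->|v0] := eqVneq v 0; first by rewrite mulr0 normr0.
have pi0 := @pi_gt0 R; have p2 := @pi_ge2 R.
rewrite sincE// (_ : _ * v = sin (pi * v) / pi); last by pi_field; rewrite v0 gt_eqF.
rewrite normrM normfV (gtr0_norm pi0) ler_pdivrMr// mul1r.
apply: le_trans (sin_max _) _; lra.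
Qed.

Lemma norm_sinc_sub1_le v : 0 < v < 1 -> `|sinc v - 1| <= pi ^+ 2 / 2 * v.
Proof.
move=> /andP[v0 v1]; have pi0 := @pi_gt0 R.
have p0 : 0 < pi * v by rewrite mulr_gt0.
rewrite sincE ?gt_eqF// distrC ger0_norm; last first.
  by rewrite subr_ge0 ler_pdivrMr// mul1r sin_le_id// ltW.
have h : (1 - (pi * v) ^+ 2 / 2) * (pi * v) <= sin (pi * v).
  apply: le_trans (mul_cos_le_sin _); last by rewrite ltW//= ger_pMr// ltW.
  by rewrite mulrC ler_pM2l// cos_ge_quadratic.
have : 1 - (pi * v) ^+ 2 / 2 <= sin (pi * v) / (pi * v) by rewrite ler_pdivlMr.
have : (pi * v) ^+ 2 / 2 <= pi ^+ 2 / 2 * v.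
  have -> : (pi * v) ^+ 2 / 2 = pi ^+ 2 / 2 * v * v by ring.
  by rewrite ger_pMr ?(ltW v1)// mulr_gt0 ?divr_gt0 ?exprn_gt0.
lra.
Qed.

Lemma cvg_sinc_right0 : sinc x @[x --> (0 : R)^'+] --> (1 : R).
Proof. exact: (cvg_right0_linear ltr01 norm_sinc_sub1_le). Qed.

Lemma sin_div_continuous t : t != 0 -> {for t, continuous (fun t => sin t / t : R)}.
Proof.
by move=> t0; apply: der_continuous; der_auto; reflexivity.
Qed.

Lemma norm_sin_div_le1 t : `|sin t / t| <= 1.
Proof.
have [->|t0] := eqVneq t 0; first by rewrite invr0 mulr0 normr0.
by rewrite normrM normfV ler_pdivrMr ?normr_gt0// mul1r norm_sin_le.
Qed.

Lemma integrable_sin_div x y : x < y -> 0 <= x \/ y <= 0 ->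
  mu.-integrable `[x, y] (EFin \o (fun t => sin t / t)).
Proof.
move=> xy xy0; apply: (@dominated_integrable _ _ id (fun=> 1) _ _ (`|x| + `|y|) xy).
- move=> z /andP[xz zy]; apply: sin_div_continuous.
  by case: xy0 => h; [rewrite gt_eqF//|rewrite lt_eqF//]; lra.
- by move=> z _; exact: der_id.
- by move=> z _; exact: norm_sin_div_le1.
- move=> z /andP[xz zy]; rewrite ler_norml.
  have := ler_norm y; have := ler_norm (- x); rewrite normrN.
  have := normr_ge0 x; have := normr_ge0 y; lra.
Qed.

Lemma sine_integral0 : sine_integral 0 = 0 :> R.
Proof. by rewrite /sine_integral lexx set_itv1 Rintegral_set1. Qed.

Lemma der_sine_integral u : 0 < u -> der (@sine_integral R) u (sin u / u).
Proof.
move=> u0.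
apply: (@der_oo _ (fun x => \int[mu]_(t in `[0, x]) (sin t / t)) _ _ _ 0 (u + 1)).
- by rewrite u0 ltrDl ltr01.
- by move=> y /andP[y0 _]; rewrite /sine_integral ltW.
- apply: (@der_Rintegral _ (fun t => sin t / t) 0 (u + 1)).
  + by apply: integrable_sin_div; [lra|left].
  + by rewrite u0 ltrDl ltr01.
  + by apply: sin_div_continuous; rewrite gt_eqF.
Qed.

Lemma norm_sine_integral_le u : 0 <= u -> `|sine_integral u| <= u.
Proof.
rewrite le_eqVlt => /predU1P[<-|u0]; first by rewrite sine_integral0 normr0.
rewrite /sine_integral (ltW u0).
apply: le_trans (le_normr_Rintegral _ _) _ => //.
  by apply: integrable_sin_div => //; left.
apply: le_trans (le_Rintegral (f2 := cst 1) _ _ _ _) _ => //.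
- have := integrable_norm (integrable_sin_div u0 (or_introl (lexx 0))); exact.
- apply: (@dominated_integrable _ (cst 1) id (fun=> 1) 0 u u u0) => z /andP[z0 zu].
  + exact: cst_continuous.
  + exact: der_id.
  + by rewrite normr1.
  + by rewrite gtr0_norm// ltW.
- by move=> x _; exact: norm_sin_div_le1.
- rewrite Rintegral_cst// mul1r; set m := fine _.
  have -> : m = fine (mu `[0, u]) by [].
  by rewrite /= lebesgue_measure_itv/= lte_fin u0 -EFinD/= subr0.
Qed.

Lemma cvg_sine_integral_right0 : sine_integral x @[x --> (0 : R)^'+] --> (0 : R).
Proof.
apply: (@cvg_right0_linear _ _ 1 1 0) => // x /andP[x0 _].
by rewrite subr0 mul1r norm_sine_integral_le// ltW.
Qed.

(** At a negative argument the definition integrates over [[u, 0]], where [- sine_integral (- t)] is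
    a primitive of [sin t / t]. *)
Lemma sine_integralN u : sine_integral (- u) = - sine_integral u :> R.
Proof.
wlog u0 : u / 0 < u => [th|].
  have [|u0|<-] := ltgtP 0 u; first exact: th.
    by have := th (- u); rewrite opprK oppr_gt0 => /(_ u0) ->; rewrite opprK.
  by rewrite oppr0 sine_integral0 oppr0.
rewrite {1}/sine_integral lerNr oppr0 leNgt u0/=; congr (- _).
have := @FTC_integrable _ (fun t => sin t / t) (fun t => - sine_integral (- t))
  (- u) 0 (- sine_integral u) 0.
rewrite sub0r opprK; apply.
- lra.
- by apply: integrable_sin_div; [lra|right].
- by move=> z /andP[_ z0]; apply: sin_div_continuous; rewrite lt_eqF.
- move=> z /andP[_ z0]; have h := der_sine_integral (_ : 0 < - z).
  have {}h := h ltac:(lra).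
  der_auto; rewrite sinN; field; by rewrite lt_eqF.
- rewrite -[X in sine_integral X](opprK u); apply: cvg_at_right_filter.
  apply: (der_continuous (f := fun t => - sine_integral (- t)) (a := sin (- u) / (- u))).
  have h := der_sine_integral (_ : 0 < - - u); have {}h := h ltac:(lra).
  by der_auto; rewrite opprK sinN; field; rewrite gt_eqF.
- apply/cvg_at_leftNP; rewrite oppr0.
  have -> : (fun x => - sine_integral (- x)) \o -%R = (fun x => - sine_integral x) :> (R -> R).
    by apply/funext => x; rewrite /= opprK.
  by rewrite -[X in _ --> X]oppr0; apply: cvgN; exact: cvg_sine_integral_right0.
Qed.

End SineIntegral.

(** * Primitives of [sinc] and of its square *)

Definition sincI {R : realType} (v : R) : R := pi^-1 * sine_integral (pi * v).

(** A primitive of [sinc ^+ 2], because [v * sinc v ^+ 2] has derivative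
    [2 * sinc (2 * v) - sinc v ^+ 2]. *)
Definition sinc2I {R : realType} (v : R) : R := sincI (2 * v) - v * sinc v ^+ 2.

Section SincPrimitives.
Context {R : realType}.
Implicit Types (t u v x y : R).

Lemma der_sincI v : 0 < v -> der sincI v (sinc v).
Proof.
move=> v0; have pi0 := @pi_gt0 R.
have h := der_sine_integral (mulr_gt0 pi0 v0).
by rewrite /sincI; der_auto; rewrite sincE ?gt_eqF//; pi_field; rewrite !gt_eqF.
Qed.

Lemma norm_sincI_le v : 0 <= v -> `|sincI v| <= v.
Proof.
move=> v0; have pi0 := @pi_gt0 R.
rewrite /sincI normrM gtr0_norm ?invr_gt0// mulrC ler_pdivrMr// mulrC.
by apply: norm_sine_integral_le; rewrite mulr_ge0// ltW.
Qed.

Lemma cvg_sincI_right0 : sincI x @[x --> (0 : R)^'+] --> (0 : R).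
Proof.
apply: (@cvg_right0_linear _ _ 1 1 0) => // x /andP[x0 _].
by rewrite subr0 mul1r norm_sincI_le// ltW.
Qed.

Lemma sinc_mul2 v : sinc (2 * v) = sinc v * cos (pi * v).
Proof.
have [->|v0] := eqVneq v 0; first by rewrite !mulr0 sinc0 cos0 mulr1.
rewrite !sincE ?mulf_neq0// (_ : pi * (2 * v) = (pi * v) *+ 2); last by rewrite mulr2n; ring.
by rewrite sin_mulr2n; have pi0 := @pi_gt0 R; pi_field; rewrite v0 gt_eqF.
Qed.

Lemma der_sinc2I v : 0 < v -> der sinc2I v (sinc v ^+ 2).
Proof.
move=> v0; have h := der_sincI (mulr_gt0 (ltr0n R 2) v0).
have h2 := der_sinc (lt0r_neq0 v0).
rewrite /sinc2I; der_auto; rewrite sinc_mul2; field; by rewrite gt_eqF.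
Qed.

Lemma norm_sinc2I_le v : 0 <= v -> `|sinc2I v| <= 3 * v.
Proof.
move=> v0; rewrite /sinc2I; apply: le_trans (ler_normB _ _) _.
have : `|sincI (2 * v)| <= 2 * v by apply: norm_sincI_le; rewrite mulr_ge0.
have : `|v * sinc v ^+ 2| <= v * 1.
  rewrite normrM ger0_norm// ler_wpM2l// normrX expr_le1//; exact: norm_sinc_le1.
lra.
Qed.

Lemma cvg_sinc2I_right0 : sinc2I x @[x --> (0 : R)^'+] --> (0 : R).
Proof.
apply: (@cvg_right0_linear _ _ 3 1 0) => // x /andP[x0 _].
by rewrite subr0 norm_sinc2I_le// ltW.
Qed.

(* Integrating by parts once: [sinc] has the bounded primitive [- cos / pi]. *)
Lemma sincI_cauchy x y : 0 < x -> x <= y -> `|sincI y - sincI x| <= x^-1.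
Proof.
move=> x0 xy; have pi0 := @pi_gt0 R; have p2 := @pi_ge2 R.
have y0 : 0 < y by exact: lt_le_trans xy.
have nz (z : R) : 0 < z -> pi ^+ 2 * z != 0.
  by move=> z0; rewrite mulf_neq0 ?expf_neq0 ?gt_eqF//.
have d1 z : x <= z <= y -> der (fun z => sincI z + cos (pi * z) / (pi ^+ 2 * z)) z
    (- cos (pi * z) / (pi ^+ 2 * z ^+ 2)).
  move=> /andP[xz zy]; have z0 : 0 < z by exact: lt_le_trans xz.
  have h := der_sincI z0; have n := nz z z0.
  by der_auto; rewrite sincE ?gt_eqF//; pi_field; rewrite !gt_eqF.
have d2 z : x <= z <= y -> der (fun z => - (pi ^+ 2 * z)^-1) z (pi ^+ 2 * z ^+ 2)^-1.
  move=> /andP[xz zy]; have z0 : 0 < z by exact: lt_le_trans xz.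
  by have n := nz z z0; der_auto; pi_field; rewrite !gt_eqF.
have d3 z : x <= z <= y ->
    `|- cos (pi * z) / (pi ^+ 2 * z ^+ 2)| <= (pi ^+ 2 * z ^+ 2)^-1.
  move=> /andP[xz zy]; have z0 : 0 < z by exact: lt_le_trans xz.
  have p : 0 < pi ^+ 2 * z ^+ 2 by rewrite mulr_gt0 ?exprn_gt0.
  by rewrite normrM normrN normfV (gtr0_norm p) ler_pdivrMr// mulVf ?gt_eqF// cos_max.
have := der_comparison xy d1 d2 d3.
have key (z : R) : 0 < z -> (pi ^+ 2 * z)^-1 <= z^-1 / 4 /\ 0 <= (pi ^+ 2 * z)^-1 /\
   `|cos (pi * z) / (pi ^+ 2 * z)| <= (pi ^+ 2 * z)^-1.
  move=> z0; have p : 0 < pi ^+ 2 * z by rewrite mulr_gt0 ?exprn_gt0.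
  split; last first.
    split; first by rewrite invr_ge0 ltW.
    by rewrite normrM normfV (gtr0_norm p) ger_pMl ?invr_gt0// cos_max.
  rewrite invfM mulrC ler_pM2l ?invr_gt0// lef_pV2 ?posrE ?exprn_gt0//.
  have : 2 ^+ 2 <= (pi : R) ^+ 2 by rewrite lerXn2r ?nnegrE; lra.
  lra.
have [a1 [a2 a3]] := key x x0; have [b1 [b2 b3]] := key y y0.
have : y^-1 <= x^-1 by rewrite lef_pV2.
have : 0 < x^-1 by rewrite invr_gt0.
set X := cos (pi * x) / _ in a3 *; set Y := cos (pi * y) / _ in b3 *.
move: a3 b3; rewrite !ler_norml => /andP[? ?] /andP[? ?] ? ? /andP[? ?].
apply/andP; split; lra.
Qed.

End SincPrimitives.

(** * Moments of the Dirichlet and Fejer kernels *)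

Section Fejer.
Context {R : realType}.
Implicit Types (t u v x y : R) (E : nat -> R -> R) (w : R -> R).

Lemma sin_odd_mulS j t : sin ((2 * j.+1%:R + 1) * t) =
  sin ((2 * j%:R + 1) * t) + 2 * cos (2 * j.+1%:R * t) * sin t.
Proof.
rewrite (_ : (2 * j.+1%:R + 1) * t = 2 * j.+1%:R * t + t); last by ring.
rewrite (_ : (2 * j%:R + 1) * t = 2 * j.+1%:R * t - t); last by rewrite -natr1; ring.
by rewrite sinD sinB; ring.
Qed.

Lemma sqr_sin_mulS N t : sin (N.+1%:R * t) ^+ 2 =
  sin (N%:R * t) ^+ 2 + sin ((2 * N%:R + 1) * t) * sin t.
Proof.
rewrite (_ : N.+1%:R * t = N%:R * t + t); last by rewrite -natr1; ring.
rewrite (_ : (2 * N%:R + 1) * t = N%:R * t + t + N%:R * t); last by ring.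
have tt := cos2sin2 t; rewrite !(sinD, cosD).
ring: tt.
Qed.

(** The Dirichlet kernel [sin ((2 * j + 1) * t) / sin t] is 1 plus twice the sum of the
    [cos (2 * k * t)] for [k] from 1 to [j], so the cosine moments [m k] of the weight [w] determine
    its moment. *)
Lemma dirichlet_moment w E (m : nat -> R) b :
  (forall k t, 0 < t < pi -> der (E k) t (w t * cos (2 * k%:R * t))) ->
  (forall k, E k x @[x --> 0^'+] --> 0) ->
  (forall k, E k b = m k) ->
  forall j, exists F, [/\
    forall t, 0 < t < pi -> der F t (w t * (sin ((2 * j%:R + 1) * t) / sin t)),
    F x @[x --> 0^'+] --> 0 & F b = m 0 + 2 * \sum_(k < j) m k.+1].
Proof.
move=> dE E0 Eb; elim=> [|j [F [dF F0 Fb]]].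
  exists (E 0); split => //; last by rewrite big_ord0 mulr0 addr0 Eb.
  move=> t /[dup] tpi /andP[t0 tp]; have := dE 0%N t tpi.
  rewrite !mulr0 mul0r cos0 add0r mul1r divff//.
  by rewrite gt_eqF// sin_gt0_pi.
exists (fun t => F t + 2 * E j.+1 t); split.
- move=> t /[dup] tpi /andP[t0 tp]; have h := dE j.+1 t tpi; have h1 := dF t tpi.
  have s0 : sin t != 0 by rewrite gt_eqF// sin_gt0_pi.
  by der_auto; rewrite sin_odd_mulS; field.
- rewrite -[X in _ --> X](addr0 0) -[X in _ --> 0 + X](mulr0 2).
  by apply: cvgD => //; apply: cvgM => //; exact: cvg_cst.
- by rewrite Fb Eb big_ord_recr/=; ring.
Qed.

(** The Fejer kernel is the sum of the first [N] Dirichlet kernels. The lemma serves for [w = 1] and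
    for [w = ln (2 * sin t)]. *)
Lemma fejer_moment w E (m : nat -> R) b :
  (forall k t, 0 < t < pi -> der (E k) t (w t * cos (2 * k%:R * t))) ->
  (forall k, E k x @[x --> 0^'+] --> 0) ->
  (forall k, E k b = m k) ->
  forall N, exists F, [/\
    forall t, 0 < t < pi -> der F t (w t * (sin (N%:R * t) / sin t) ^+ 2),
    F x @[x --> 0^'+] --> 0 &
    F b = \sum_(j < N) (m 0 + 2 * \sum_(k < j) m k.+1)].
Proof.
move=> dE E0 Eb; elim=> [|N [F [dF F0 Fb]]].
  exists (fun=> 0); split; [|exact: cvg_cst|by rewrite big_ord0].
  by move=> t _; rewrite mul0r sin0 mul0r expr0n mulr0; exact: der_cst.
have [G [dG G0 Gb]] := dirichlet_moment dE E0 Eb N.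
exists (fun t => F t + G t); split.
- move=> t /[dup] tpi /andP[t0 tp]; have h := dG t tpi; have h1 := dF t tpi.
  have s0 : sin t != 0 by rewrite gt_eqF// sin_gt0_pi.
  by der_auto; rewrite !expr_div_n sqr_sin_mulS; field.
- by rewrite -[X in _ --> X](addr0 0); exact: cvgD.
- by rewrite Fb Gb big_ord_recr.
Qed.

End Fejer.
(** * Limits equal to 0 *)

Section ZeroLimits.
Context {R : realType} {T : Type} {FT : set_system T} {FF : Filter FT}.
Implicit Types (f g : T -> R).

Lemma cvg0D f g : f x @[x --> FT] --> 0 -> g x @[x --> FT] --> 0 ->
  f x + g x @[x --> FT] --> 0.
Proof. by move=> f0 g0; rewrite -[X in _ --> X](addr0 0); exact: cvgD. Qed.

Lemma cvg0B f g : f x @[x --> FT] --> 0 -> g x @[x --> FT] --> 0 ->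
  f x - g x @[x --> FT] --> 0.
Proof. by move=> f0 g0; rewrite -[X in _ --> X](subr0 0); exact: cvgB. Qed.

Lemma cvg0Z (c : R) f : f x @[x --> FT] --> 0 -> c * f x @[x --> FT] --> 0.
Proof.
by move=> f0; rewrite -[X in _ --> X](mulr0 c); apply: cvgM => //; exact: cvg_cst.
Qed.

End ZeroLimits.

(** * Primitives with a logarithmic singularity at 0 *)

Section LogPrimitive.
Context {R : realType}.
Implicit Types (f F e : R -> R) (b v x y l C : R).
Local Notation mu := (@lebesgue_measure R).

Lemma norm_ln_le v : 0 < v -> `|ln v| <= 2 * v - ln v.
Proof.
by move=> v0; have := ln_sublinear v0; rewrite ler_norml => ?; apply/andP; split; lra.
Qed.

(** The bound [|ln v| <= 2 * v - ln v] removes the absolute value and leaves a majorant with an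
    elementary primitive, bounded near 0. *)
Lemma log_majorant C b : 0 < b -> 0 <= C -> exists H h K, [/\
  forall v, 0 < v < b -> der H v (h v),
  forall v, 0 < v < b -> C * (1 + `|ln v|) <= h v &
  forall v, 0 < v < b -> `|H v| <= K].
Proof.
move=> b0 C0; exists (fun v => C * (v + v ^+ 2 + (v - v * ln v))),
  (fun v => C * (1 + 2 * v - ln v)), (C * (2 * b + 2 * b ^+ 2 + 2)); split.
- move=> z /andP[z0 _]; der_auto; by field; rewrite gt_eqF.
- move=> z /andP[z0 _]; rewrite ler_wpM2l//.
  have := norm_ln_le z0; lra.
- move=> z /andP[z0 zb]; rewrite normrM (ger0_norm C0) ler_wpM2l//.
  have : `|z * ln z| <= b ^+ 2 + 2.
    have [z1|z1] := ltP z 1.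
      have /norm_xlnx_le : 0 < z < 1 by rewrite z0.
      have : Num.sqrt z <= 1 by rewrite -[leRHS]sqrtr1 ler_wsqrtr// ltW.
      have := sqr_ge0 b; lra.
    have := ln_ge0 z1; have := ln_sublinear z0 => h1 h2.
    rewrite ger0_norm; last by rewrite mulr_ge0// ltW.
    have : z * ln z <= b * b by rewrite ler_pM ?(ltW z0)//; lra.
    by rewrite -expr2; lra.
  have : z ^+ 2 <= b ^+ 2 by rewrite lerXn2r ?nnegrE; lra.
  rewrite ler_norml => h /andP[h1 h2]; rewrite ler_norml.
  by have := sqr_ge0 z; move=> ?; apply/andP; split; lra.
Qed.

Lemma log_bound_ge0 f C b : 0 < b ->
  (forall v, 0 < v < b -> `|f v| <= C * (1 + `|ln v|)) -> 0 <= C.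
Proof.
move=> b0 fC; have /fC : 0 < b / 2 < b by lra.
have : 0 < 1 + `|ln (b / 2)| by rewrite ltr_pwDl.
by move=> p /(le_trans (normr_ge0 _)); rewrite pmulr_lge0.
Qed.

Lemma integrable_log f C b : 0 < b ->
  (forall v, 0 < v < b -> {for v, continuous f}) ->
  (forall v, 0 < v < b -> `|f v| <= C * (1 + `|ln v|)) ->
  mu.-integrable `[0, b] (EFin \o f).
Proof.
move=> b0 cf fC.
have [H [h [K [dH hh HK]]]] := log_majorant b0 (log_bound_ge0 b0 fC).
apply: (dominated_integrable b0 cf dH _ HK) => z zb.
exact: le_trans (fC z zb) (hh z zb).
Qed.

Lemma integrable_logN f C b : 0 < b ->
  (forall v, 0 < v < b -> {for v, continuous f}) ->
  (forall v, 0 < v < b -> `|f v| <= C * (1 + `|ln v|)) ->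
  mu.-integrable `[- b, 0] (EFin \o (fun v => f (- v))).
Proof.
move=> b0 cf fC.
have [H [h [K [dH hh HK]]]] := log_majorant b0 (log_bound_ge0 b0 fC).
have Nb : - b < 0 by rewrite oppr_lt0.
have zN z : - b < z < 0 -> 0 < - z < b by move=> /andP[? ?]; apply/andP; split; lra.
apply: (@dominated_integrable _ _ (fun z => - H (- z)) (fun z => h (- z)) _ _ K Nb).
- move=> z /zN zb; apply: continuous_comp; first exact: opp_continuous.
  exact: cf.
- move=> z /zN zb; have d := dH _ zb; der_auto; ring.
- move=> z /zN zb; exact: le_trans (fC _ zb) (hh _ zb).
- by move=> z /zN zb; rewrite normrN HK.
Qed.

(** Meant for the three primitives that are only available as integrals: [sinc2logI], [cosint] and
    [sincsincI]. *)
Lemma log_primitive f :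
  (forall v, 0 < v -> {for v, continuous f}) ->
  (forall b, 0 < b -> exists C, forall v, 0 < v < b -> `|f v| <= C * (1 + `|ln v|)) ->
  (forall v, 0 < v -> der (fun x => \int[mu]_(t in `[0, x]) f t) v (f v)) /\
  \int[mu]_(t in `[0, x]) f t @[x --> 0^'+] --> 0.
Proof.
move=> cf fC.
have intf b : 0 < b -> mu.-integrable `[0, b] (EFin \o f).
  move=> b0; have [C hC] := fC b b0.
  by apply: (integrable_log b0 _ hC) => v /andP[v0 _]; exact: cf.
split.
  move=> v v0; apply: (@der_Rintegral _ f 0 (v + 1)); last exact: cf.
    by apply: intf; rewrite addr_gt0.
  by rewrite v0 ltrDl ltr01.
have /(continuous_within_itvP _ ltr01)[_ h _] :=
  parameterized_integral_continuous (@ler01 R) (intf 1 ltr01).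
by move: h; rewrite /parameterized_integral set_itv1 Rintegral_set1.
Qed.

(** The finite sums give a limit along a sequence only; the modulus [e] bounds the oscillation of
    [F] between its terms. *)
Lemma cvg_pinfty_subseq F e (u : nat -> R) l :
  (forall x y, 1 <= x -> x <= y -> `|F y - F x| <= e x) ->
  e x @[x --> +oo] --> 0 ->
  u n @[n --> \oo] --> +oo -> F (u n) @[n --> \oo] --> l ->
  F x @[x --> +oo] --> l.
Proof.
move=> Fe e0 uoo Ful; apply/cvgrPdist_le => eps eps0.
have eps2 : 0 < eps / 2 by rewrite divr_gt0.
move/cvgrPdist_le : Ful => /(_ _ eps2) Ful.
move/cvgr0Pnorm_le : e0 => /(_ _ eps2) e0.
near=> x.
have x1 : 1 <= x by near: x; exact: nbhs_pinfty_ge.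
have ex : `|e x| <= eps / 2 by near: x.
have [n [h1 h2]] : exists n, `|l - F (u n)| <= eps / 2 /\ x <= u n.
  have : \forall n \near \oo, `|l - F (u n)| <= eps / 2 /\ x <= u n.
    near=> n; split; near: n => //.
    by move/cvgryPge : uoo; exact.
  by case=> n0 _ /(_ n0 (leqnn _)) h; exists n0.
have := Fe x (u n) x1 h2; have := ler_norm (e x).
rewrite (_ : l - F x = (l - F (u n)) + (F (u n) - F x)); last by ring.
move=> ? ?; apply: le_trans (ler_normD _ _) _; lra.
Unshelve. all: by end_near. Qed.

End LogPrimitive.

(** * Cosine moments, and the limits of [sincI] and [sinc2I] at infinity *)

Section CosineMoments.
Context {R : realType}.
Implicit Types (t u v x y : R).

Definition cosI (k : nat) t : R := if k == 0%N then t else sin (2 * k%:R * t) / (2 * k%:R).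

Lemma der_cosI k t : der (cosI k) t (cos (2 * k%:R * t)).
Proof.
rewrite /cosI; case: k => [|k] /=; first by rewrite mulr0 mul0r cos0; exact: der_id.
have : k.+1%:R != 0 :> R by rewrite pnatr_eq0.
by move: (k.+1%:R : R) => a a0; der_auto; field.
Qed.

Lemma cosI0 k : cosI k 0 = 0.
Proof. by rewrite /cosI; case: ifP => // _; rewrite mulr0 sin0 mul0r. Qed.

Lemma sin_natpi k : sin (k%:R * pi) = 0 :> R.
Proof.
elim: k => [|k ih]; first by rewrite mul0r sin0.
by rewrite -natr1 mulrDl mul1r sinD ih sinpi mul0r mulr0 addr0.
Qed.

Lemma cos_natpi k : cos (k%:R * pi) = (-1) ^+ k :> R.
Proof.
elim: k => [|k ih]; first by rewrite mul0r cos0.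
by rewrite -natr1 mulrDl mul1r cosD ih sinpi cospi exprS; ring.
Qed.

Lemma cosI_pihalf k : cosI k (pi / 2) = if k == 0%N then pi / 2 else 0.
Proof.
rewrite /cosI; case: ifP => // _.
by rewrite (_ : 2 * k%:R * (pi / 2) = k%:R * pi) ?sin_natpi ?mul0r//; field.
Qed.

(* [(sin (2 (k + 1) t) - sin (2 k t)) cot t = cos (2 (k + 1) t) + cos (2 k t)] *)
Fixpoint cotI (k : nat) t : R :=
  if k is k'.+1 then cotI k' t + cosI k'.+1 t + cosI k' t else 0.

Lemma der_cotI k t : 0 < t < pi -> der (cotI k) t (sin (2 * k%:R * t) * (cos t / sin t)).
Proof.
move=> /[dup] tpi /andP[t0 tp]; have s0 : sin t != 0 by rewrite gt_eqF// sin_gt0_pi.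
elim: k => [|k ih]; first by rewrite mulr0 mul0r sin0 mul0r; exact: der_cst.
have h1 := der_cosI k t; have h2 := der_cosI k.+1 t.
rewrite /=; apply: der_eq; first exact: (derD (derD ih h2) h1).
rewrite (_ : 2 * k%:R * t = (2 * k%:R + 1) * t - t); last by ring.
rewrite (_ : 2 * k.+1%:R * t = (2 * k%:R + 1) * t + t); last by rewrite -natr1; ring.
by rewrite !(sinB, cosB) !(sinD, cosD); field.
Qed.

Lemma cvg_cosI_right0 k : cosI k x @[x --> 0^'+] --> 0.
Proof. by have := der_cvg_right (der_cosI k 0); rewrite cosI0. Qed.

Lemma cvg_cotI_right0 k : cotI k x @[x --> 0^'+] --> 0.
Proof.
elim: k => [|k ih]; first exact: cvg_cst.
by rewrite /=; apply: cvg0D; [apply: cvg0D|] => //; exact: cvg_cosI_right0.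
Qed.

Lemma cotI_pihalf k : cotI k (pi / 2) = if k == 0%N then 0 else pi / 2.
Proof.
elim: k => [//|k /= ->]; rewrite !cosI_pihalf /=.
by case: k => [|k] /=; rewrite ?addr0 ?add0r.
Qed.

Lemma sqr_sinc_scaled N t : (0 < N)%N -> 0 < t ->
  sinc (N%:R * t / pi) ^+ 2 = sin (N%:R * t) ^+ 2 / (N%:R * t) ^+ 2.
Proof.
move=> N0 t0; have pi0 := @pi_gt0 R.
have Nt : 0 < N%:R * t by rewrite mulr_gt0// ltr0n.
rewrite sincE; last by rewrite gt_eqF// divr_gt0.
by rewrite (_ : pi * (N%:R * t / pi) = N%:R * t) ?expr_div_n//; pi_field; rewrite gt_eqF.
Qed.

(** The Fejer kernel integrates to [N * pi / 2] over [(0, pi / 2)]. With [t] in place of [sin t] in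
    the denominator, its integral is [N * pi * sinc2I (N / 2)], and by [csc2_sub_invsq] the two
    differ by at most [pi / 2]. *)
Lemma sinc2I_half N : (0 < N)%N -> `|sinc2I (N%:R / 2) - 1 / 2 : R| <= (2 * N%:R)^-1.
Proof.
move=> N0; have pi0 := @pi_gt0 R; have Nr0 : 0 < N%:R :> R by rewrite ltr0n.
have [|||F [dF F0 Fb]] := @fejer_moment R (fun=> 1) cosI
    (fun k => if k == 0%N then pi / 2 else 0) (pi / 2) _ _ _ N.
- by move=> k t _; rewrite mul1r; exact: der_cosI.
- exact: cvg_cosI_right0.
- exact: cosI_pihalf.
pose G t := F t - N%:R * pi * sinc2I (N%:R * t / pi).
have dG t : 0 < t <= pi / 2 -> der G t (sin (N%:R * t) ^+ 2 * (sin t ^- 2 - t ^- 2)).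
  move=> /andP[t0 tp]; have tpi : 0 < t < pi by lra.
  have h := dF t tpi; have h2 : 0 < N%:R * t / pi by rewrite divr_gt0// mulr_gt0.
  have {}h2 := der_sinc2I h2.
  have s0 : sin t != 0 by rewrite gt_eqF// sin_gt0_pi.
  rewrite /G; der_auto; rewrite sqr_sinc_scaled//.
  by pi_field; rewrite s0 !gt_eqF.
have Gb : G (pi / 2) - 0 = - (N%:R * pi) * (sinc2I (N%:R / 2) - 1 / 2).
  rewrite /G Fb (_ : N%:R * (pi / 2) / pi = N%:R / 2); last by pi_field; rewrite gt_eqF.
  under eq_bigr do rewrite big1// mulr0 addr0.
  by rewrite sumr_const card_ord -mulr_natl; ring.
rewrite -(ler_pM2l (mulr_gt0 Nr0 pi0)) (_ : N%:R * pi * (2 * N%:R)^-1 = pi / 2 - 0); last first.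
  by field; rewrite gt_eqF.
rewrite -{1}(gtr0_norm (mulr_gt0 Nr0 pi0)) -normrM -normrN -mulNr -Gb.
apply: (@der_comparison_right R G _ id (fun=> 1) 0 (pi / 2) 0 0 _ dG).
- lra.
- by move=> z _; exact: der_id.
- move=> z /csc2_sub_invsq /andP[h1 h2].
  rewrite ger0_norm; last by apply: mulr_ge0 => //; exact: sqr_ge0.
  have : sin (N%:R * z) ^+ 2 <= 1 by rewrite -real_normK ?num_real// expr_le1// sin_max.
  by move=> h3; rewrite mulr_ile1// sqr_ge0.
- apply: cvg0B => //; apply: cvg0Z.
  rewrite (_ : (fun x => _) = (fun x => sinc2I (N%:R / pi * x))); last first.
    by apply/funext => x; rewrite mulrAC.
  by apply: cvg_right0_scale; [rewrite divr_gt0|exact: cvg_sinc2I_right0].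
- exact: (der_cvg_right (der_id 0)).
Qed.

Lemma mul_sqr_sinc_le v : 0 < v -> `|v * sinc v ^+ 2| <= v^-1.
Proof.
move=> v0; rewrite -[leRHS]mul1r ler_pdivlMr//.
rewrite -[X in _ * X](gtr0_norm v0) -normrM.
rewrite (_ : v * sinc v ^+ 2 * v = (sinc v * v) ^+ 2); last by ring.
by rewrite normrX expr_le1// norm_sinc_mul_le.
Qed.

(** By the definition of [sinc2I], [sincI N] is [sinc2I (N / 2)] up to a term of order [1 / N], and
    [sincI_cauchy] compares it with [sincI v]. *)
Lemma sincI_lim v : 0 < v -> `|sincI v - 1 / 2| <= v^-1.
Proof.
move=> v0; apply/ler_addgt0Pr => e e0.
(* The two errors that depend on [N] are at most [1 / (2 * N)] and [2 / N], hence together at most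
   [3 / N <= e]. *)
pose N := (Num.truncn (v + 3 / e)).+1.
have Nv : v + 3 / e < N%:R by exact: truncnS_gt.
have N0 : (0 < N)%N by [].
have Nr0 : 0 < N%:R :> R by rewrite ltr0n.
have e3 : 0 < 3 / e by rewrite divr_gt0.
have h1 := sinc2I_half N0.
have h2 : `|sincI N%:R - sincI v| <= v^-1 by apply: sincI_cauchy => //; lra.
have h3 : `|(N%:R / 2) * sinc (N%:R / 2) ^+ 2| <= (N%:R / 2)^-1 :> R.
  by apply: mul_sqr_sinc_le; rewrite divr_gt0.
have eN : 3 / N%:R <= e.
  rewrite ler_pdivrMr// mulrC -ler_pdivrMr//; lra.
have -> : sincI v - 1 / 2 = - (sincI N%:R - sincI v) + (sinc2I (N%:R / 2) - 1 / 2)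
   + (N%:R / 2) * sinc (N%:R / 2) ^+ 2.
  by rewrite /sinc2I (_ : 2 * (N%:R / 2) = N%:R); [ring|field].
have e1 : (2 * N%:R)^-1 = N%:R^-1 / 2 :> R by field; rewrite gt_eqF.
have e2 : (N%:R / 2)^-1 = 2 * N%:R^-1 :> R by field; rewrite gt_eqF.
have : 0 < N%:R^-1 :> R by rewrite invr_gt0.
rewrite e1 in h1; rewrite e2 in h3.
move=> ni; apply: le_trans (ler_normD _ _) _; apply: le_trans (lerD (ler_normD _ _) (lexx _)) _.
rewrite normrN; lra.
Qed.

Lemma sinc2I_lim v : 0 < v -> `|sinc2I v - 1 / 2| <= 2 * v^-1.
Proof.
move=> v0; have h1 := sincI_lim (mulr_gt0 (ltr0n R 2) v0).
have h2 := mul_sqr_sinc_le v0.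
rewrite (_ : sinc2I v - 1 / 2 = (sincI (2 * v) - 1 / 2) - v * sinc v ^+ 2); last first.
  by rewrite /sinc2I; ring.
apply: le_trans (ler_normB _ _) _.
have : (2 * v)^-1 = v^-1 / 2 by field; rewrite gt_eqF.
have : 0 < v^-1 by rewrite invr_gt0.
lra.
Qed.

End CosineMoments.
(** * The log-sine integral *)

Section LogSine.
Context {R : realType}.
Implicit Types (s t u v x y : R).

Lemma sin_pi_gt0 s : 0 < s < 1 -> 0 < sin (pi * s).
Proof.
move=> /andP[s0 s1]; apply: sin_gt0_pi; have pi0 := @pi_gt0 R.
by rewrite mulr_gt0//= gtr_pMr.
Qed.

Lemma der_log2sin s : 0 < s < 1 ->
  der (fun s => ln (2 * sin (pi * s))) s (pi * (cos (pi * s) / sin (pi * s))).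
Proof.
move=> /sin_pi_gt0 p; der_auto; first by rewrite mulr_gt0.
by field; rewrite gt_eqF.
Qed.

(** A majorant of [|ln (2 * sin (pi * s))|] on [(0, 1)] whose primitive [log_envI] is elementary and
    bounded. *)
Definition log_env s : R := ln 2 - ln s - ln (1 - s).
Definition log_envI s : R :=
  s * ln 2 + (s - s * ln s) - ((1 - s) - (1 - s) * ln (1 - s)).

Lemma der_log_envI s : 0 < s < 1 -> der log_envI s (log_env s).
Proof.
move=> /andP[s0 s1]; have t0 : 0 < 1 - s by rewrite subr_gt0.
rewrite /log_envI /log_env; der_auto; field; rewrite !gt_eqF//=.
Qed.

Lemma norm_log2sin_le s : 0 < s < 1 -> `|ln (2 * sin (pi * s))| <= log_env s.
Proof.
move=> /[dup] h /ln2sin_bounds /andP[h1 h2]; case/andP: h => s0 s1.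
have : ln s <= 0 by rewrite ln_le0// ltW.
have : ln (1 - s) <= 0 by rewrite ln_le0; lra.
have : 0 <= ln 2 :> R by rewrite ln_ge0; lra.
by rewrite ler_norml /log_env => *; apply/andP; split; lra.
Qed.

Lemma norm_log_envI_le s : 0 < s < 1 -> `|log_envI s| <= 7.
Proof.
move=> /andP[s0 s1]; have t0 : 0 < 1 - s < 1 by apply/andP; split; lra.
have h1 : `|s * ln s| <= 2 * Num.sqrt s by apply: norm_xlnx_le; rewrite s0.
have h2 := norm_xlnx_le t0.
have q1 : Num.sqrt s <= 1 by rewrite -[leRHS]sqrtr1 ler_wsqrtr// ltW.
have q2 : Num.sqrt (1 - s) <= 1 by rewrite -[leRHS]sqrtr1 ler_wsqrtr//; lra.
have l2 : ln 2 < 2 :> R by exact: ln_sublinear.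
have l0 : 0 <= ln 2 :> R by rewrite ln_ge0; lra.
have : s * ln 2 <= 1 * ln 2 by rewrite ler_wpM2r// ltW.
have := mulr_ge0 (ltW s0) l0.
by move: h1 h2; rewrite /log_envI !ler_norml => /andP[? ?] /andP[? ?] ? ?; apply/andP; split; lra.
Qed.

Lemma cvg_left1_onem (F : R -> R) (l : R) : F x @[x --> 0^'+] --> l ->
  F (1 - x) @[x --> 1^'-] --> l.
Proof.
move=> Fl; apply/cvgrPdist_le => e e0.
move/cvgrPdist_le : Fl => /(_ e e0) [d /= d0 hd].
exists d => // x /= + x1; rewrite (gtr0_norm (_ : 0 < 1 - x)); last by rewrite subr_gt0.
move=> xd; apply: hd; last by rewrite subr_gt0.
by rewrite /= sub0r normrN gtr0_norm// subr_gt0.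
Qed.

Lemma log2sin_mul2 s : 0 < s < 1 / 2 ->
  ln (2 * sin (pi * (2 * s))) = ln (2 * sin (pi * s)) + ln (2 * sin (pi * (1 / 2 - s))).
Proof.
move=> /andP[s0 s1].
have p1 : 0 < sin (pi * s) by apply: sin_pi_gt0; rewrite s0; lra.
have p2 : 0 < sin (pi * (1 / 2 - s)) by apply: sin_pi_gt0; lra.
rewrite -lnM ?posrE ?mulr_gt0//; congr ln.
rewrite (_ : pi * (2 * s) = (pi * s) *+ 2); last by rewrite mulr2n; ring.
rewrite (_ : pi * (1 / 2 - s) = pi / 2 - pi * s); last by ring.
by rewrite sin_mulr2n sinB cos_pihalf sin_pihalf mulr2n; ring.
Qed.

(** By the duplication formula, [L (2 * s) - 2 * L s + 2 * L (1 / 2 - s)] is constant on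
    [(0, 1 / 2)]. Its limit at 0 is [2 * L (1 / 2)] and its value at [1 / 4] is [L (1 / 2)], so
    [L (1 / 2) = 0]. The reflection [s -> 1 - s] then makes [L] odd and its primitive [M] even about
    [1 / 2], which gives the limits at 1. *)
Lemma log_sine_primitive : exists L M : R -> R,
  [/\ forall s, 0 < s < 1 -> der L s (ln (2 * sin (pi * s))),
      L x @[x --> 0^'+] --> 0, L (1 / 2) = 0 &
  [/\ L x @[x --> 1^'-] --> 0,
      forall s, 0 < s < 1 -> der M s (L s),
      M x @[x --> 0^'+] --> 0 & M x @[x --> 1^'-] --> 0]].
Proof.
have [L [l [dL L0 L1]]] := dominated_primitive (@ltr01 R)
  (fun z h => der_continuous (der_log2sin h)) der_log_envI norm_log2sin_le norm_log_envI_le.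
have Lhalf : L (1 / 2) = 0.
  pose G s := L (2 * s) - 2 * L s + 2 * L (1 / 2 - s).
  have dG s : 0 < s < 1 / 2 -> der G s 0.
    move=> sh; have /andP[s0 s1] := sh.
    have h1 : der L (2 * s) (ln (2 * sin (pi * (2 * s)))) by apply: dL; lra.
    have h2 : der L s (ln (2 * sin (pi * s))) by apply: dL; lra.
    have h3 : der L (1 / 2 - s) (ln (2 * sin (pi * (1 / 2 - s)))) by apply: dL; lra.
    by rewrite /G; der_auto; rewrite log2sin_mul2//; ring.
  have G0 : G x @[x --> 0^'+] --> 0 + 2 * L (1 / 2).
    apply: cvgD.
      apply: cvg0B; last exact: cvg0Z.
      by apply: cvg_right0_scale.
    apply: cvgM; first exact: cvg_cst.
    have h : der (fun s => L (1 / 2 - s)) 0 (- ln (2 * sin (pi * (1 / 2)))).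
      have h3 : der L (1 / 2 - 0) (ln (2 * sin (pi * (1 / 2 - 0)))) by apply: dL; lra.
      by der_auto; rewrite subr0; ring.
    by have := der_cvg_right h; rewrite subr0.
  have Gc : G x @[x --> 0^'+] --> G (1 / 4).
    apply: cvg_near_cst; near=> x.
    apply: (@der0_cst R G 0 (1 / 2)) => //; last lra.
    apply/andP; split; near: x; first exact: nbhs_right_gt.
    by apply: nbhs_right_lt; lra.
  have : 0 + 2 * L (1 / 2) = G (1 / 4) by exact: cvg_unique G0 Gc.
  rewrite add0r /G.
  rewrite (_ : 1 / 2 - 1 / 4 = 1 / 4); last by field.
  rewrite (_ : 2 * (1 / 4) = 1 / 2); last by field.
  lra.
have Lsym s : 0 < s < 1 -> L (1 - s) = - L s.
  move=> sh; apply/eqP; rewrite -addr_eq0; apply/eqP.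
  rewrite (@der0_cst R (fun s => L (1 - s) + L s) 0 1 s (1 / 2)) //; last lra.
    by rewrite (_ : 1 - 1 / 2 = 1 / 2) ?Lhalf ?addr0//; field.
  move=> z /andP[z0 z1].
  have h1 : der L (1 - z) (ln (2 * sin (pi * (1 - z)))) by apply: dL; lra.
  have h2 : der L z (ln (2 * sin (pi * z))) by apply: dL; lra.
  der_auto; rewrite (_ : sin (pi * (1 - z)) = sin (pi * z)); first by ring.
  by rewrite mulrBr mulr1 sinB sinpi cospi; ring.
have L1' : L x @[x --> 1^'-] --> 0.
  have h : - L (1 - x) @[x --> 1^'-] --> - 0 by apply: cvgN; exact: cvg_left1_onem.
  rewrite -[X in _ --> X]oppr0; apply: cvg_trans h; apply: near_eq_cvg; near=> x.
  have x01 : 0 < x < 1.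
    by apply/andP; split; near: x; [exact: nbhs_left_gt|exact: nbhs_left_lt].
  by rewrite Lsym// opprK.
have Lb s : 0 < s < 1 -> `|L s| <= 14.
  wlog sh : s / s <= 1 / 2 => [th s01|].
    have [/th|h] := leP s (1 / 2); first exact.
    by rewrite -normrN -Lsym//; apply: th; lra.
  move=> /[dup] s01 /andP[s0 s1].
  have zz z : s <= z <= 1 / 2 -> 0 < z < 1 by move=> /andP[? ?]; apply/andP; split; lra.
  have := der_comparison sh (fun z h => dL z (zz z h)) (fun z h => der_log_envI (zz z h))
    (fun z h => norm_log2sin_le (zz z h)).
  rewrite Lhalf sub0r normrN => /le_trans; apply.
  have := norm_log_envI_le s01; have := norm_log_envI_le (zz (1 / 2) _).
  by rewrite lexx andbT => /(_ sh); rewrite !ler_norml => /andP[? ?] /andP[? ?]; lra.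
have d14 (z : R) : 0 < z < 1 -> der (fun s => 14 * s) z 14.
  by move=> _; der_auto; rewrite mul0r add0r mulr1.
have b14 (z : R) : 0 < z < 1 -> `|14 * z| <= 14.
  by move=> /andP[z0 z1]; rewrite gtr0_norm ?mulr_gt0//; lra.
have [M [m [dM M0 M1]]] := dominated_primitive (@ltr01 R)
  (fun z h => der_continuous (dL z h)) d14 Lb b14.
exists L, M; split => //; split => //.
have Msym s : 0 < s < 1 -> M (1 - s) = M s.
  move=> sh; apply/eqP; rewrite -subr_eq0; apply/eqP.
  rewrite (@der0_cst R (fun s => M (1 - s) - M s) 0 1 s (1 / 2)) //; last lra.
    by rewrite (_ : 1 - 1 / 2 = 1 / 2) ?subrr//; field.
  move=> z zh; have /andP[z0 z1] := zh.
  have h1 : der M (1 - z) (L (1 - z)) by apply: dM; lra.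
  have h2 := dM z zh.
  by der_auto; rewrite Lsym//; ring.
have h : M (1 - x) @[x --> 1^'-] --> 0 by exact: cvg_left1_onem.
apply: cvg_trans h; apply: near_eq_cvg; near=> x.
by apply: Msym; apply/andP; split; near: x; [exact: nbhs_left_gt|exact: nbhs_left_lt].
Unshelve. all: by end_near. Qed.

End LogSine.
(** * The logarithmic moment of [sinc ^+ 2] *)

Definition harm {R : realType} (n : nat) : R := \sum_(k < n) k.+1%:R^-1.

Definition sinc2logI {R : realType} (x : R) : R :=
  \int[lebesgue_measure]_(t in `[0, x]) (sinc t ^+ 2 * ln t).

Section SincSqrLog.
Context {R : realType}.
Implicit Types (s t u v x y : R).

Lemma harmS n : harm n.+1 = harm n + n.+1%:R^-1 :> R.
Proof. by rewrite /harm big_ord_recr. Qed.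

Lemma sum_harm n : \sum_(j < n) harm j = n%:R * harm n - n%:R :> R.
Proof.
elim: n => [|n ih]; first by rewrite big_ord0 mul0r subrr.
rewrite big_ord_recr/= ih harmS mulrDr divff ?pnatr_eq0// -natr1; ring.
Qed.

Lemma norm_sqr_sinc_le1 v : `|sinc v ^+ 2| <= 1.
Proof. by rewrite normrX expr_le1// norm_sinc_le1. Qed.

Lemma sinc2log_primitive :
  (forall v, 0 < v -> der sinc2logI v (sinc v ^+ 2 * ln v)) /\
  sinc2logI x @[x --> (0 : R)^'+] --> (0 : R).
Proof.
apply: (@log_primitive R (fun t => sinc t ^+ 2 * ln t)).
  move=> v v0; apply: der_continuous.
  by have h := der_sinc (lt0r_neq0 v0); der_auto; reflexivity.
move=> b b0; exists 1 => v /andP[v0 _]; rewrite mul1r normrM.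
have := norm_sqr_sinc_le1 v => h; apply: le_trans (ler_wpM2r (normr_ge0 _) h) _.
by rewrite mul1r lerDr.
Qed.

Lemma norm_ln2sin_le t : 0 < t < 1 -> `|ln (2 * sin t)| <= 3 + `|ln t|.
Proof.
move=> /andP[t0 t1]; have p1 := @pihalf_ge1 R.
have h : 0 < t <= pi / 2 by rewrite t0; lra.
have s0 : 0 < sin t by apply: sin_gt0_pi; have := @pi_gt0 R; lra.
have /andP[a b] := ln_sinc_ge h.
have -> : ln (2 * sin t) = ln 2 + (ln t + ln (sin t / t)).
  have p : 0 < sin t / t by rewrite divr_gt0.
  rewrite -lnM ?posrE// -lnM ?posrE//; last exact: mulr_gt0.
  by congr ln; field; rewrite gt_eqF.
have l2 : ln 2 < 2 :> R by exact: ln_sublinear.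
have l0 : 0 <= ln 2 :> R by rewrite ln_ge0; lra.
have tt : t ^+ 2 <= 1 by rewrite expr_le1// ltW.
have := ler_norm (ln t); have := ler_norm (- ln t); rewrite normrN => ? ?.
by rewrite ler_norml; apply/andP; split; lra.
Qed.

Lemma cvg_sin_ln2sin c : sin (c * x) * ln (2 * sin x) @[x --> (0 : R)^'+] --> (0 : R).
Proof.
apply: (@cvg_right_squeeze _ _ (fun x => `|c| * (3 * x + `|x * ln x|)) 0 1) => //.
  move=> x /[dup] h /andP[x0 x1]; rewrite subr0 normrM.
  have h1 := norm_sin_le (c * x); have h2 := norm_ln2sin_le h.
  apply: le_trans (ler_pM (normr_ge0 _) (normr_ge0 _) h1 h2) _.
  by rewrite !normrM (gtr0_norm x0); lra.
apply: cvg0Z; apply: cvg0D; first exact/cvg0Z/(der_cvg_right (der_id 0)).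
by rewrite -[X in _ --> X](normr0 R); apply: cvg_norm; exact: cvg_xlnx.
Qed.

(** Integrating by parts, the moment of [ln (2 * sin t)] against [cos (2 * k * t)] reduces to that
    of [sin (2 * k * t) * cot t], which is [pi / 2]; hence the moments [- (pi / 4) / k]. Summing
    them twice gives [sum_harm]. *)
Lemma fejer_log_moment (L : R -> R) :
  (forall s, 0 < s < 1 -> der L s (ln (2 * sin (pi * s)))) ->
  L x @[x --> 0^'+] --> 0 -> L (1 / 2) = 0 ->
  forall N, exists F, [/\
    forall t, 0 < t < pi -> der F t (ln (2 * sin t) * (sin (N%:R * t) / sin t) ^+ 2),
    F x @[x --> 0^'+] --> 0 & F (pi / 2) = - (pi / 2) * (N%:R * harm N - N%:R)].
Proof.
move=> dL L0 Lh N; have pi0 := @pi_gt0 R.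
pose E k t := if k == 0%N then pi * L (pi^-1 * t)
  else (sin (2 * k%:R * t) * ln (2 * sin t) - cotI k t) / (2 * k%:R).
have [|||F [dF F0 Fb]] := @fejer_moment R (fun t => ln (2 * sin t)) E
    (fun k => if k == 0%N then 0 else - (pi / 4) * k%:R^-1) (pi / 2) _ _ _ N.
- move=> k t /[dup] tpi /andP[t0 tp]; rewrite /E; case: k => [|k].
    have h : der L (pi^-1 * t) (ln (2 * sin t)).
      have th : 0 < pi^-1 * t < 1 by rewrite mulr_gt0 ?invr_gt0//= mulrC ltr_pdivrMr// mul1r.
      by have := dL _ th; rewrite mulVKf// gt_eqF.
    rewrite /=; der_auto; rewrite !mulr0 mul0r cos0 mul0r add0r mulr1.
    by pi_field; rewrite gt_eqF.
  have s0 : 0 < sin t by rewrite sin_gt0_pi.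
  have h := der_cotI k.+1 tpi.
  have : k.+1%:R != 0 :> R by rewrite pnatr_eq0.
  move: (k.+1%:R : R) (cotI k.+1) h => a q h a0 /=; der_auto; first by rewrite mulr_gt0.
  by field; rewrite a0 gt_eqF.
- move=> k; rewrite /E; case: (k == 0%N).
    by apply: cvg0Z; apply: cvg_right0_scale => //; rewrite invr_gt0.
  rewrite (_ : (fun x => _) = (fun x => (2 * k%:R)^-1 * (sin (2 * k%:R * x) * ln (2 * sin x) - cotI k x))); last first.
    by apply/funext => x; rewrite mulrC.
  by apply: cvg0Z; apply: cvg0B; [exact: cvg_sin_ln2sin|exact: cvg_cotI_right0].
- move=> k; rewrite /E; case: ifP => [_|k0].
    by rewrite (_ : pi^-1 * (pi / 2) = 1 / 2) ?Lh ?mulr0//; pi_field; rewrite gt_eqF.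
  rewrite cotI_pihalf k0 (_ : 2 * k%:R * (pi / 2) = k%:R * pi) ?sin_natpi; last by field.
  have : k%:R != 0 :> R by rewrite pnatr_eq0 k0.
  by move=> kn; field.
exists F; split => //; rewrite Fb /= -sum_harm mulr_sumr.
apply: eq_bigr => j _; rewrite add0r /harm !mulr_sumr; apply: eq_bigr => i _.
have : i.+1%:R != 0 :> R by rewrite pnatr_eq0.
by move: (i.+1%:R : R) => a a0; field.
Qed.

(** The comparison of [sinc2I_half], with the weight [ln (2 * sin t)]. In the variable
    [v = N * t / pi] this weight is [ln v + ln (2 * pi / N)] up to [ln (sin t / t)], which is at
    most [t ^+ 2] in absolute value and so compensates the factor [t ^- 2]. *)
Lemma sinc2logI_half N : (0 < N)%N ->
  `|sinc2logI (N%:R / 2) + ln (2 * pi / N%:R) * sinc2I (N%:R / 2)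
    + (harm N - 1) / 2 : R| <= 3 / N%:R.
Proof.
move=> N0; have pi0 := @pi_gt0 R; have Nr0 : 0 < N%:R :> R by rewrite ltr0n.
have [L [_ [dL L0 Lh _]]] := @log_sine_primitive R.
have [F [dF F0 Fb]] := fejer_log_moment dL L0 Lh N.
have [dA A0] := sinc2log_primitive.
pose G t := F t - N%:R * pi *
  (sinc2logI (N%:R / pi * t) + ln (2 * pi / N%:R) * sinc2I (N%:R / pi * t)).
pose g t := sin (N%:R * t) ^+ 2 * (ln (2 * sin t) * (sin t ^- 2 - t ^- 2) + ln (sin t / t) / t ^+ 2).
(* [H] is a primitive of the majorant [2 * ln 2 + 1 - ln (2 * sin t)] of the error; the logarithm
   integrates to 0 over [(0, pi / 2)] because [L (1 / 2) = 0]. *)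
pose H t := (2 * ln 2 + 1) * t - pi * L (pi^-1 * t).
have pih t : 0 < t <= pi / 2 -> 0 < t < pi by lra.
have dG t : 0 < t <= pi / 2 -> der G t (g t).
  move=> /[dup] th /andP[t0 tp]; have h := dF t (pih t th).
  have s0 : 0 < sin t by rewrite sin_gt0_pi//; exact: pih.
  have v0 : 0 < N%:R / pi * t by rewrite !mulr_gt0 ?invr_gt0.
  have h2 := der_sinc2I v0; have h3 := dA _ v0.
  rewrite /G; der_auto.
  have e1 : ln (N%:R / pi * t) + ln (2 * pi / N%:R) = ln (2 * sin t) - ln (sin t / t).
    have p1 : 0 < 2 * pi / N%:R :> R by rewrite divr_gt0// mulr_gt0.
    have p2 : 0 < 2 * sin t by rewrite mulr_gt0.
    have p3 : 0 < sin t / t by rewrite divr_gt0.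
    rewrite -lnM ?posrE// -ln_div ?posrE//.
    by congr ln; pi_field; rewrite !gt_eqF.
  have e2 : sinc (N%:R / pi * t) ^+ 2 = sin (N%:R * t) ^+ 2 / (N%:R * t) ^+ 2.
    by rewrite -sqr_sinc_scaled// mulrAC.
  transitivity (ln (2 * sin t) * (sin (N%:R * t) / sin t) ^+ 2
     - N%:R ^+ 2 * sinc (N%:R / pi * t) ^+ 2 * (ln (N%:R / pi * t) + ln (2 * pi / N%:R))).
    by pi_field; rewrite !gt_eqF.
  by rewrite e1 e2 /g; field; rewrite !gt_eqF.
have dH t : 0 < t <= pi / 2 -> der H t (2 * ln 2 + 1 - ln (2 * sin t)).
  move=> /[dup] th /andP[t0 tp].
  have h : der L (pi^-1 * t) (ln (2 * sin t)).
    have tt : 0 < pi^-1 * t < 1 by rewrite mulr_gt0 ?invr_gt0//= mulrC ltr_pdivrMr// mul1r; lra.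
    by have := dL _ tt; rewrite mulVKf// gt_eqF.
  by rewrite /H; der_auto; pi_field; rewrite gt_eqF.
have gH t : 0 < t <= pi / 2 -> `|g t| <= 2 * ln 2 + 1 - ln (2 * sin t).
  move=> /[dup] th /andP[t0 tp].
  have s0 : 0 < sin t by rewrite sin_gt0_pi//; exact: pih.
  have /andP[c0 c1] := csc2_sub_invsq th; have /andP[l0 l1] := ln_sinc_ge th.
  have q1 : `|sin (N%:R * t) ^+ 2| <= 1 by rewrite normrX expr_le1// sin_max.
  rewrite /g normrM; apply: le_trans (ler_wpM2r (normr_ge0 _) q1) _; rewrite mul1r.
  apply: le_trans (ler_normD _ _) _; rewrite !normrM.
  have a1 : `|ln (sin t / t)| * `|(t ^+ 2)^-1| <= 1.
    rewrite normfV (gtr0_norm (exprn_gt0 _ t0)) ler_pdivrMr ?exprn_gt0// mul1r.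
    by rewrite ler0_norm//; lra.
  have a2 : `|ln (2 * sin t)| * `|sin t ^- 2 - t ^- 2| <= `|ln (2 * sin t)|.
    by rewrite ler_piMr// ger0_norm.
  have a3 : `|ln (2 * sin t)| <= 2 * ln 2 - ln (2 * sin t).
    have : ln (2 * sin t) <= ln 2.
      by rewrite ler_ln ?posrE ?mulr_gt0//; have := sin_le1 t; lra.
    have : 0 <= ln 2 :> R by rewrite ln_ge0; lra.
    by rewrite ler_norml => ? ?; apply/andP; split; lra.
  lra.
have G0 : G x @[x --> 0^'+] --> 0.
  apply: cvg0B => //; apply: cvg0Z; apply: cvg0D; last apply: cvg0Z.
    by apply: cvg_right0_scale => //; rewrite divr_gt0.
  by apply: cvg_right0_scale; [rewrite divr_gt0|exact: cvg_sinc2I_right0].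
have H0 : H x @[x --> 0^'+] --> 0.
  apply: cvg0B; apply: cvg0Z; first exact: der_cvg_right (der_id 0).
  by apply: cvg_right0_scale => //; rewrite invr_gt0.
have ph0 : 0 < pi / 2 :> R by rewrite divr_gt0.
have := der_comparison_right ph0 dG dH gH G0 H0.
have -> : H (pi / 2) - 0 = (2 * ln 2 + 1) * (pi / 2).
  by rewrite /H (_ : pi^-1 * (pi / 2) = 1 / 2) ?Lh; [ring|pi_field; rewrite gt_eqF].
have -> : G (pi / 2) - 0 = - (N%:R * pi * (sinc2logI (N%:R / 2) +
    ln (2 * pi / N%:R) * sinc2I (N%:R / 2) + (harm N - 1) / 2)).
  rewrite /G Fb (_ : N%:R / pi * (pi / 2) = N%:R / 2); last by pi_field; rewrite gt_eqF.
  ring.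
rewrite normrN normrM (gtr0_norm (mulr_gt0 Nr0 pi0)) => h.
rewrite -(ler_pM2l (mulr_gt0 Nr0 pi0)); apply: le_trans h _.
rewrite (_ : N%:R * pi * (3 / N%:R) = 3 * pi); last by field; rewrite gt_eqF.
have l2 : ln 2 < 2 :> R by exact: ln_sublinear.
by rewrite mulrCA mulrC ler_pM2r//; lra.
Qed.

(** Here [sinc z ^+ 2 <= z ^- 2], and [- (ln z + 1) / z] is a primitive of [ln z / z ^+ 2]. *)
Lemma sinc2logI_cauchy x y : 1 <= x -> x <= y ->
  `|sinc2logI y - sinc2logI x| <= (ln x + 1) / x.
Proof.
move=> x1 xy; have [dA _] := sinc2log_primitive.
have pos z : x <= z <= y -> 0 < z by move=> /andP[? ?]; lra.
have d1 z (h : x <= z <= y) := dA z (pos z h).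
have d2 z : x <= z <= y -> der (fun z => - ((ln z + 1) / z)) z (ln z / z ^+ 2).
  move=> /pos z0; have zn := lt0r_neq0 z0; by der_auto; field.
have d3 z : x <= z <= y -> `|sinc z ^+ 2 * ln z| <= ln z / z ^+ 2.
  move=> h; have z0 := pos z h; have l0 : 0 <= ln z by case/andP: h => ? ?; rewrite ln_ge0//; lra.
  rewrite normrM (ger0_norm l0) mulrC ler_wpM2l//.
  rewrite -[leRHS]mul1r ler_pdivlMr ?exprn_gt0//.
  rewrite -[X in _ * X](gtr0_norm (exprn_gt0 2 z0)) -normrM -exprMn normrX expr_le1//.
  exact: norm_sinc_mul_le.
have := der_comparison xy d1 d2 d3 => /le_trans; apply.
have : 0 <= (ln y + 1) / y by rewrite divr_ge0 ?addr_ge0 ?ln_ge0//; lra.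
lra.
Qed.

End SincSqrLog.
(** * Limits at infinity *)

Section LimitsAtInfinity.
Context {R : realType}.
Implicit Types (F G : R -> R) (x y l C : R).

Lemma cvg_pinfty_squeeze F G l :
  (forall x, 1 <= x -> `|F x - l| <= G x) ->
  G x @[x --> +oo] --> 0 -> F x @[x --> +oo] --> l.
Proof.
move=> FG G0; apply/cvgrPdist_le => e e0.
move/cvgr0Pnorm_le : G0 => /(_ e e0) G0; near=> x.
rewrite distrC; apply: le_trans (FG x _) _; last first.
  by apply: le_trans (ler_norm _) _; near: x.
by near: x; exact: nbhs_pinfty_ge.
Unshelve. all: by end_near. Qed.

Lemma cvg_pinfty_inv : x^-1 @[x --> +oo] --> (0 : R).
Proof. by apply/(@gtr0_cvgV0 _ _ _ _ (fun x : R => x)); [exact: nbhs_pinfty_gt|exact: cvg_id]. Qed.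

Lemma ln_le_2sqrt x : 0 < x -> ln x <= 2 * Num.sqrt x.
Proof.
move=> x0; have s0 : 0 < Num.sqrt x by rewrite sqrtr_gt0.
rewrite -{1}(sqr_sqrtr (ltW x0)) lnXn// mulr2n.
have := ln_sublinear s0; lra.
Qed.

Lemma cvg_pinfty_lndiv C : (ln x + C) / x @[x --> +oo] --> (0 : R).
Proof.
apply: (@cvg_pinfty_squeeze _ (fun x => (2 + `|C|) * (Num.sqrt x)^-1)).
  move=> x x1; have x0 : 0 < x by lra.
  have s0 : 0 < Num.sqrt x by rewrite sqrtr_gt0.
  have s1 : 1 <= Num.sqrt x by rewrite -[leLHS]sqrtr1 ler_wsqrtr.
  rewrite subr0 normrM normfV (gtr0_norm x0) ler_pdivrMr//.
  rewrite -{3}(sqr_sqrtr (ltW x0)) (_ : _ * _ * _ = (2 + `|C|) * Num.sqrt x); last first.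
    by field; rewrite gt_eqF.
  apply: le_trans (ler_normD _ _) _; rewrite (ger0_norm (ln_ge0 x1)).
  have := ln_le_2sqrt x0; have : `|C| * 1 <= `|C| * Num.sqrt x by rewrite ler_wpM2l.
  lra.
apply: cvg0Z; apply/(@gtr0_cvgV0 _ _ _ _ (@Num.sqrt R)).
  by near=> x; rewrite sqrtr_gt0; near: x; exact: nbhs_pinfty_gt.
apply/cvgryPge => A; near=> x.
have h : A ^+ 2 <= x by near: x; apply: nbhs_pinfty_ge; exact: num_real.
apply: le_trans (ler_norm _) _.
by rewrite -sqrtr_sqr ler_wsqrtr.
Unshelve. all: by end_near. Qed.

Lemma cvg_natmul_pinfty (c : R) : 0 < c -> c * n%:R @[n --> \oo] --> +oo.
Proof.
move=> c0; apply/cvgryPge => A; near=> n; rewrite mulrC -ler_pdivrMr//.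
by near: n; exact: nbhs_infty_ger.
Unshelve. all: by end_near. Qed.

Lemma cvg_nat_pinfty F (l : R) (c : R) : 0 < c -> F x @[x --> +oo] --> l ->
  F (c * n%:R) @[n --> \oo] --> l.
Proof. by move=> c0 Fl; apply: (cvg_comp _ _ _ Fl); exact: cvg_natmul_pinfty. Qed.

Lemma cvg_scale_pinfty F (l : R) (c : R) : 0 < c -> F x @[x --> +oo] --> l ->
  F (c * x) @[x --> +oo] --> l.
Proof.
move=> c0 Fl; apply: (cvg_comp _ _ _ Fl).
apply/cvgryPge => A; near=> x.
by rewrite mulrC -ler_pdivrMr.
Unshelve. all: by end_near. Qed.

End LimitsAtInfinity.

(** * Euler's constant and the logarithmic moment of [sinc ^+ 2] *)

Section EulerGamma.
Context {R : realType}.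
Implicit Types (x y l : R).

(** On [[1, +oo)] the integrand is nonnegative and [sinc2logI_cauchy] bounds the integral. Existence
    comes first, without a value, because [euler_gamma] is a [limn] and says nothing before its
    sequence is known to converge. *)
Lemma sinc2logI_is_cvg : exists l : R, sinc2logI x @[x --> +oo] --> l.
Proof.
pose u n : R := sinc2logI (1 * n.+1%:R).
have [dA _] := @sinc2log_primitive R.
have ucvg : cvgn u.
  apply: nondecreasing_is_cvgn.
    move=> n m nm; rewrite /u !mul1r -subr_ge0.
    have nm1 : n.+1%:R <= m.+1%:R :> R by rewrite ler_nat.
    have n1 : 1 <= n.+1%:R :> R by rewrite ler1n.
    have h (z : R) : n.+1%:R <= z <= m.+1%:R -> 0 < z by move=> /andP[? _]; lra.
    have := der_comparison nm1 (fun z _ => der_cst (0 : R) z) (fun z hz => dA z (h z hz)).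
    rewrite subrr normr0; apply => z /andP[z1 z2].
    by rewrite mulr_ge0 ?sqr_ge0// ln_ge0; lra.
  exists (u 0%N + 1) => _ /= [n _ <-].
  have := @sinc2logI_cauchy R 1 n.+1%:R (lexx _) _.
  rewrite ler1n ln1 add0r divr1 => /(_ isT) /(le_trans (ler_norm _)).
  by rewrite /u !mul1r; lra.
exists (limn u); apply: (@cvg_pinfty_subseq _ _ (fun x => (ln x + 1) / x) (fun n => 1 * n.+1%:R)).
- exact: sinc2logI_cauchy.
- exact: cvg_pinfty_lndiv.
- apply/cvgryPge => A; near=> n; rewrite mul1r.
  have : A <= n%:R by near: n; exact: nbhs_infty_ger.
  by move/le_trans; apply; rewrite ler_nat.
- exact: ucvg.
Unshelve. all: by end_near. Qed.

Lemma norm_log_scaled_le n : (0 < n)%N ->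
  `|ln (2 * pi / n%:R) * (sinc2I (n%:R / 2) - 1 / 2) : R|
    <= (ln n%:R + ln (2 * pi)) / n%:R.
Proof.
move=> n0; have pi0 := @pi_gt0 R; have p2 := @pi_ge2 R.
have nr0 : 0 < n%:R :> R by rewrite ltr0n.
have l0 : 0 <= ln n%:R :> R by rewrite ln_ge0// ler1n.
have l1 : 0 <= ln (2 * pi) :> R by rewrite ln_ge0; lra.
rewrite normrM; apply: ler_pM => //.
  rewrite ln_div ?posrE//; last by rewrite mulr_gt0.
  by rewrite ler_norml; apply/andP; split; lra.
apply: le_trans (sinc2I_half n0) _.
by rewrite lef_pV2 ?posrE// ?mulr_gt0//; lra.
Qed.

(** [sinc2logI_half] is solved for the harmonic sum: the convergence of [sinc2logI] yields that of
    [harm n - ln n], together with the relation between the two limits. *)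
Lemma harm_sub_ln_cvg (l : R) : sinc2logI x @[x --> +oo] --> l ->
  harm n - ln n%:R @[n --> \oo] --> 1 - 2 * l - ln (2 * pi).
Proof.
move=> Al; have pi0 := @pi_gt0 R.
have Ah : sinc2logI (2^-1 * n%:R) @[n --> \oo] --> l by exact: cvg_nat_pinfty.
have e0 : (2 * ((ln (1 * n%:R) + ln (2 * pi)) / (1 * n%:R)) + 6 * (1 * n%:R)^-1) @[n --> \oo] --> (0 : R).
  apply: cvg0D; apply: cvg0Z.
    exact: (cvg_nat_pinfty ltr01 (cvg_pinfty_lndiv (ln (2 * pi)))).
  exact: (cvg_nat_pinfty ltr01 (@cvg_pinfty_inv R)).
have d0 : (harm n - ln n%:R) - (1 - 2 * sinc2logI (2^-1 * n%:R) - ln (2 * pi)) @[n --> \oo] --> (0 : R).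
  apply/cvgr0Pnorm_le => e ep; move/cvgr0Pnorm_le : e0 => /(_ e ep) e0; near=> n.
  have n0 : (0 < n)%N by near: n; exact: nbhs_infty_gt.
  apply: le_trans _ (_ : `|2 * ((ln (1 * n%:R) + ln (2 * pi)) / (1 * n%:R)) + 6 * (1 * n%:R)^-1| <= e); last by near: n.
  apply: le_trans _ (ler_norm _); rewrite !mul1r.
  have nr0 : 0 < n%:R :> R by rewrite ltr0n.
  have h1 := norm_log_scaled_le n0; have h2 := @sinc2logI_half R n n0.
  rewrite (_ : _ - _ = 2 * (sinc2logI (n%:R / 2) + ln (2 * pi / n%:R) * sinc2I (n%:R / 2) + (harm n - 1) / 2)
     - 2 * (ln (2 * pi / n%:R) * (sinc2I (n%:R / 2) - 1 / 2))).
    apply: le_trans (ler_normB _ _) _; rewrite !normrM (ger0_norm (ler0n R 2)) -normrM; lra.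
  by rewrite (mulrC 2^-1) ln_div ?posrE ?mulr_gt0//; field.
rewrite (_ : (fun n => harm n - ln n%:R) = fun n => ((harm n - ln n%:R) - (1 - 2 * sinc2logI (2^-1 * n%:R) - ln (2 * pi)))
   + (1 - 2 * sinc2logI (2^-1 * n%:R) - ln (2 * pi))); last first.
  by apply/funext => n; rewrite subrK.
rewrite -[X in _ --> X](add0r (1 - 2 * l - ln (2 * pi))).
apply: cvgD => //; apply: cvgB; last exact: cvg_cst.
by apply: cvgB; [exact: cvg_cst|apply: cvgM => //; exact: cvg_cst].
Unshelve. all: by end_near. Qed.

Lemma sinc2logI_lim :
  sinc2logI x @[x --> +oo] --> ((1 - euler_gamma - ln (2 * pi)) / 2 : R).
Proof.
have [l Al] := sinc2logI_is_cvg; have h := harm_sub_ln_cvg Al.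
have -> : euler_gamma = 1 - 2 * l - ln (2 * pi) :> R.
  rewrite /euler_gamma; apply: (cvg_lim (@Rhausdorff R)).
  rewrite (_ : (fun n => _) = fun n => harm n - ln n%:R)//.
  by apply/funext => n; rewrite /harm big_add1 big_mkord.
by rewrite (_ : _ / 2 = l)//; field.
Qed.

Lemma harm_sub_ln_lim : harm n - ln n%:R @[n --> \oo] --> (euler_gamma : R).
Proof.
have := harm_sub_ln_cvg sinc2logI_lim.
by rewrite (_ : _ - ln (2 * pi) = euler_gamma)//; field.
Qed.

End EulerGamma.
(** * The cosine integral *)

Definition cosint {R : realType} (x : R) : R :=
  \int[lebesgue_measure]_(t in `[0, x]) ((1 - cos t) / t).

Section CosineIntegral.
Context {R : realType}.
Implicit Types (t u v x y : R).

Lemma norm_onem_cos_div_le t : 0 < t -> `|(1 - cos t) / t| <= 2.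
Proof.
move=> t0; have c1 := cos_le1 t; have c2 := cos_geN1 t; have c3 := cos_ge_quadratic t.
rewrite ger0_norm; last by rewrite divr_ge0 ?subr_ge0// ltW.
rewrite ler_pdivrMr//; have [t1|t1] := ltP t 1; last lra.
have : t ^+ 2 <= t by rewrite expr2 ger_pMl// ltW.
lra.
Qed.

Lemma cosint_primitive :
  (forall t, 0 < t -> der cosint t ((1 - cos t) / t)) /\
  cosint x @[x --> (0 : R)^'+] --> (0 : R).
Proof.
apply: (@log_primitive R (fun t => (1 - cos t) / t)).
  move=> v v0; apply: der_continuous; have vn := lt0r_neq0 v0; der_auto; reflexivity.
move=> b b0; exists 2 => v /andP[v0 _].
apply: le_trans (norm_onem_cos_div_le v0) _.
by rewrite mulrDr mulr1 lerDl mulr_ge0.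
Qed.

(** Adding [sin z / z] integrates [- cos z / z] by parts, and leaves a derivative of order
    [z ^- 2]. *)
Lemma cosint_sub_ln_cauchy x y : 0 < x -> x <= y ->
  `|(cosint y - ln y) - (cosint x - ln x)| <= 3 / x.
Proof.
move=> x0 xy; have [dC _] := @cosint_primitive.
have y0 : 0 < y by exact: lt_le_trans xy.
have pos z : x <= z <= y -> 0 < z by move=> /andP[? ?]; lra.
have d1 z : x <= z <= y -> der (fun z => cosint z - ln z + sin z / z) z (- sin z / z ^+ 2).
  move=> /pos z0; have h := dC z z0; have zn := lt0r_neq0 z0.
  by der_auto; field.
have d2 z : x <= z <= y -> der (fun z => - z^-1) z (z ^+ 2)^-1.
  by move=> /pos z0; have zn := lt0r_neq0 z0; der_auto; field.
have d3 z : x <= z <= y -> `|- sin z / z ^+ 2| <= (z ^+ 2)^-1.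
  move=> /pos z0; rewrite normrM normrN normfV (gtr0_norm (exprn_gt0 2 z0)).
  by rewrite ger_pMl ?invr_gt0 ?exprn_gt0// sin_max.
have := der_comparison xy d1 d2 d3.
have bx : `|sin x / x| <= x^-1 by rewrite normrM normfV (gtr0_norm x0) ger_pMl ?invr_gt0// sin_max.
have by_ : `|sin y / y| <= y^-1 by rewrite normrM normfV (gtr0_norm y0) ger_pMl ?invr_gt0// sin_max.
have yx : y^-1 <= x^-1 by rewrite lef_pV2.
have : 0 < y^-1 by rewrite invr_gt0.
move: bx by_; set X := sin x / x; set Y := sin y / y.
rewrite !ler_norml => /andP[? ?] /andP[? ?] ? /andP[? ?]; apply/andP; split; lra.
Qed.

(* [(1 - cos (2 j t)) / (2 j)]; the value at [j = 0] is [0 / 0 = 0], as wanted. *)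
Definition sinI (j : nat) t : R := (1 - cos (2 * j%:R * t)) / (2 * j%:R).

Lemma der_sinI j t : der (sinI j) t (sin (2 * j%:R * t)).
Proof.
rewrite /sinI; case: j => [|j].
  rewrite mulr0 mul0r sin0 (_ : (fun _ => _) = fun=> 0); first exact: der_cst.
  by apply/funext => x; rewrite mul0r cos0 subrr mul0r.
have : j.+1%:R != 0 :> R by rewrite pnatr_eq0.
by move: (j.+1%:R : R) => a a0; der_auto; field.
Qed.

Lemma cvg_sinI_right0 j : sinI j x @[x --> 0^'+] --> 0.
Proof. by have := der_cvg_right (der_sinI j 0); rewrite /sinI mulr0 cos0 subrr mul0r. Qed.

Lemma sinI_pihalf j : sinI j (pi / 2) = (1 - (-1) ^+ j) / (2 * j%:R).
Proof. by rewrite /sinI (_ : 2 * j%:R * (pi / 2) = j%:R * pi) ?cos_natpi//; field. Qed.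

(* [(cos (2 k t) - cos (2 (k + 1) t)) cot t = sin (2 (k + 1) t) + sin (2 k t)] *)
Fixpoint onem_cos_cotI (k : nat) t : R :=
  if k is k'.+1 then onem_cos_cotI k' t + sinI k'.+1 t + sinI k' t else 0.

Lemma der_onem_cos_cotI k t : 0 < t < pi ->
  der (onem_cos_cotI k) t ((1 - cos (2 * k%:R * t)) * (cos t / sin t)).
Proof.
move=> /[dup] tpi /andP[t0 tp]; have s0 : sin t != 0 by rewrite gt_eqF// sin_gt0_pi.
elim: k => [|k ih]; first by rewrite mulr0 mul0r cos0 subrr mul0r; exact: der_cst.
have h1 := der_sinI k t; have h2 := der_sinI k.+1 t.
rewrite /=; apply: der_eq; first exact: (derD (derD ih h2) h1).
rewrite (_ : 2 * k%:R * t = (2 * k%:R + 1) * t - t); last by ring.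
rewrite (_ : 2 * k.+1%:R * t = (2 * k%:R + 1) * t + t); last by rewrite -natr1; ring.
by rewrite !(sinB, cosB) !(sinD, cosD); field.
Qed.

Lemma cvg_onem_cos_cotI_right0 k : onem_cos_cotI k x @[x --> 0^'+] --> 0.
Proof.
elim: k => [|k ih]; first exact: cvg_cst.
by rewrite /=; apply: cvg0D; [apply: cvg0D|] => //; exact: cvg_sinI_right0.
Qed.

(** At [pi / 2] only the odd [j] contribute, each of them twice, which gives twice the sum of the
    inverses of the odd numbers below [2 * m]. *)
Lemma onem_cos_cotI_pihalf m :
  onem_cos_cotI m.*2 (pi / 2) = 2 * harm m.*2 - harm m.
Proof.
elim: m => [|m ih]; first by rewrite /= /harm !big_ord0; ring.
rewrite doubleS /= ih !sinI_pihalf !harmS.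
have sg : (-1) ^+ m.*2 = 1 :> R by rewrite -signr_odd odd_double expr0.
rewrite !exprS sg -(mul2n m).
have e : (2 * m).+2%:R = 2 * m.+1%:R :> R by rewrite -natrM; congr (_%:R); lia.
have e1 : (2 * m).+1%:R = 2 * m%:R + 1 :> R by rewrite -natr1 natrM.
have p1 : 2 * m%:R + 1 != 0 :> R by rewrite -e1 pnatr_eq0.
have p2 : m.+1%:R != 0 :> R by rewrite pnatr_eq0.
rewrite e e1 subrr mul0r; move: (m.+1%:R : R) (2 * m%:R + 1 : R) p1 p2 => a c p1 p2.
by field; rewrite p1 p2.
Qed.

(** Replacing [cot t] with [t^-1] costs [(1 - cos (2 * k * t)) * (cot t - t^-1)]. The first term
    integrates to [ln (sin t / t)], which is [ln (2 / pi)] at the end; the oscillating one is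
    integrated by parts and gains a factor [(2 * k)^-1]. *)
Lemma cosint_natpi k : (0 < k)%N ->
  `|onem_cos_cotI k (pi / 2) - cosint (k%:R * pi) - ln (2 / pi)| <= 2 / k%:R.
Proof.
move=> k0; have pi0 := @pi_gt0 R; have kr0 : 0 < k%:R :> R by rewrite ltr0n.
have kn := lt0r_neq0 kr0.
have [dC C0] := @cosint_primitive.
pose G t := onem_cos_cotI k t - cosint (2 * k%:R * t) - ln (sin t / t)
  + (2 * k%:R)^-1 * ((cos t / sin t - t^-1) * sin (2 * k%:R * t)).
pose g t := (2 * k%:R)^-1 * ((t ^- 2 - sin t ^- 2) * sin (2 * k%:R * t)).
have pih t : 0 < t <= pi / 2 -> 0 < t < pi by lra.
have dG t : 0 < t <= pi / 2 -> der G t (g t).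
  move=> /[dup] th /andP[t0 tp]; have h := der_onem_cos_cotI k (pih t th).
  have s0 : 0 < sin t by rewrite sin_gt0_pi//; exact: pih.
  have sn := lt0r_neq0 s0; have tn := lt0r_neq0 t0.
  have v0 : 0 < 2 * k%:R * t by rewrite !mulr_gt0.
  have h2 := dC _ v0; have p : 0 < sin t / t by rewrite divr_gt0.
  have cc := cos2sin2 t.
  rewrite /G; der_auto; rewrite /g.
  by field: cc; rewrite kn tn sn.
have dH t : 0 < t <= pi / 2 -> der (fun t => (2 * k%:R)^-1 * t) t (2 * k%:R)^-1.
  by move=> _; der_auto; ring.
have gH t : 0 < t <= pi / 2 -> `|g t| <= (2 * k%:R)^-1.
  move=> /csc2_sub_invsq /andP[c0 c1]; rewrite /g normrM gtr0_norm ?invr_gt0 ?mulr_gt0//.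
  rewrite ger_pMr ?invr_gt0 ?mulr_gt0// normrM mulr_ile1//; last exact: sin_max.
  by rewrite distrC ger0_norm.
have th1 x : 0 < x < 1 -> 0 < x <= pi / 2.
  by have := @pihalf_ge1 R => ? /andP[-> ?] /=; lra.
have G0 : G x @[x --> 0^'+] --> 0.
  apply: cvg0D; [apply: cvg0B; [apply: cvg0B|]|].
  - exact: cvg_onem_cos_cotI_right0.
  - by apply: cvg_right0_scale => //; rewrite mulr_gt0.
  - apply: (@cvg_right0_linear _ _ 1 1 0) => // x /[dup] /th1 /ln_sinc_ge /andP[a b] /andP[x0 x1].
    rewrite subr0 mul1r ler0_norm//.
    have : x ^+ 2 <= x by rewrite expr2 ger_pMl// ltW.
    lra.
  - apply: cvg0Z; apply: (@cvg_right0_linear _ _ 1 1 0) => // x /[dup] /th1 /cot_sub_inv /andP[a b] /andP[x0 x1].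
    rewrite subr0 mul1r normrM -[leRHS]mulr1; apply: ler_pM => //; last exact: sin_max.
    by rewrite ler0_norm//; lra.
have H0 : (2 * k%:R)^-1 * x @[x --> (0 : R)^'+] --> (0 : R).
  by apply: cvg0Z; exact: der_cvg_right (der_id 0).
have ph0 : 0 < pi / 2 :> R by rewrite divr_gt0.
have := der_comparison_right ph0 dG dH gH G0 H0.
rewrite !subr0 /G sin_pihalf cos_pihalf.
rewrite (_ : 2 * k%:R * (pi / 2) = k%:R * pi); last by field.
rewrite sin_natpi !mulr0 addr0 (_ : 1 / (pi / 2) = 2 / pi); last by pi_field; rewrite gt_eqF.
move=> /le_trans; apply.
have p2 := @pihalf_lt2 R.
rewrite (_ : _^-1 * _ = (pi / 4) / k%:R); last by field.
by rewrite ler_pM2r ?invr_gt0//; lra.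
Qed.

(** At [2 * pi * m] the sum [2 * harm m.*2 - harm m] appears. After subtraction of the logarithms it
    tends to [2 * euler_gamma - euler_gamma], and the terms in [ln 2] and [ln pi] cancel. *)
Lemma cosint_sub_ln_lim : cosint x - ln x @[x --> +oo] --> (euler_gamma : R).
Proof.
have pi0 := @pi_gt0 R.
apply: (@cvg_pinfty_subseq _ _ (fun x => 3 / x) (fun m => (2 * pi) * m%:R)).
- by move=> x y x1 xy; apply: cosint_sub_ln_cauchy => //; lra.
- by apply: cvg0Z; exact: cvg_pinfty_inv.
- by apply: cvg_natmul_pinfty; rewrite mulr_gt0.
pose v m : R := 2 * (harm m.*2 - ln m.*2%:R) - (harm m - ln m%:R).
have vl : v m @[m --> \oo] --> (euler_gamma : R).
  rewrite (_ : euler_gamma = 2 * euler_gamma - euler_gamma); last by ring.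
  have h := @harm_sub_ln_lim R.
  apply: cvgB => //; apply: cvgM; first exact: cvg_cst.
  have dbl : m.*2 @[m --> \oo] --> \oo.
    apply/cvgnyPge => A; near=> m; rewrite -addnn; apply: leq_trans (leq_addr _ _).
    by near: m; exact: nbhs_infty_ge.
  exact: (cvg_comp _ _ dbl h).
suff d0 : (cosint (2 * pi * m%:R) - ln (2 * pi * m%:R)) - v m @[m --> \oo] --> (0 : R).
  rewrite (_ : (fun m => cosint (2 * pi * m%:R) - ln (2 * pi * m%:R)) = fun m => (cosint (2 * pi * m%:R) - ln (2 * pi * m%:R) - v m) + v m); last first.
    by apply/funext => m; rewrite subrK.
  by rewrite -[X in _ --> X](add0r euler_gamma); exact: cvgD.
have e0 : (1 * n%:R)^-1 @[n --> \oo] --> (0 : R) := cvg_nat_pinfty ltr01 (@cvg_pinfty_inv R).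
apply/cvgr0Pnorm_le => e ep; move/cvgr0Pnorm_le : e0 => /(_ e ep) e0; near=> m.
have m0 : (0 < m)%N by near: m; exact: nbhs_infty_gt.
have mr0 : 0 < m%:R :> R by rewrite ltr0n.
have hm : `|(1 * m%:R)^-1| <= e by near: m.
apply: le_trans hm; rewrite mul1r ger0_norm ?invr_ge0//.
have m20 : (0 < m.*2)%N by rewrite double_gt0.
have := cosint_natpi m20; rewrite onem_cos_cotI_pihalf.
have em : m.*2%:R = 2 * m%:R :> R by rewrite -mul2n natrM.
rewrite em (_ : 2 * m%:R * pi = 2 * pi * m%:R); last by ring.
rewrite (_ : 2 / (2 * m%:R) = m%:R^-1); last by field; rewrite gt_eqF.
move=> /le_trans h; rewrite -normrN; apply: le_trans (h _ (lexx _)).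
rewrite le_eqVlt; apply/orP; left; apply/eqP; congr (`|_|).
by rewrite /v em ln_div ?posrE// !lnM ?posrE ?mulr_gt0//; ring.
Unshelve. all: by end_near. Qed.

End CosineIntegral.
(** * The integral of [sinc * sincI / v] *)

(** The term that remains when [dsinc * sincI * ln] is integrated by parts. *)
Definition sincsincI {R : realType} (x : R) : R :=
  \int[lebesgue_measure]_(t in `[0, x]) (sinc t * sincI t / t).

Lemma cvg0_sum {R : realType} {T : Type} {FT : set_system T} {FF : Filter FT}
    (I : Type) (r : seq I) (P : pred I) (f : I -> T -> R) :
  (forall i, P i -> f i x @[x --> FT] --> 0) ->
  \sum_(i <- r | P i) f i x @[x --> FT] --> 0.
Proof.
move=> h; elim: r => [|i r ih].
  rewrite (_ : (fun x => _) = fun=> 0); first exact: cvg_cst.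
  by apply/funext => x; rewrite big_nil.
rewrite (_ : (fun x => _) = fun x => (if P i then f i x else 0) + \sum_(i <- r | P i) f i x).
  by apply: cvg0D => //; case: (P i) (h i) => [/(_ isT)//|_]; exact: cvg_cst.
by apply/funext => x; rewrite big_cons; case: ifP; rewrite ?add0r.
Qed.

Section SincSincI.
Context {R : realType}.
Implicit Types (t u v x y : R).

Lemma norm_sincI_le2 v : 0 <= v -> `|sincI v| <= 2.
Proof.
move=> v0; have [v1|v1] := leP v 2.
  by apply: le_trans (norm_sincI_le v0) v1.
have v00 : 0 < v by lra.
have := sincI_lim v00; have : v^-1 <= 2^-1 by rewrite lef_pV2 ?posrE//; lra.
by rewrite !ler_norml => ? /andP[? ?]; apply/andP; split; lra.
Qed.

Lemma sincsincI_primitive :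
  (forall v, 0 < v -> der sincsincI v (sinc v * sincI v / v)) /\
  sincsincI x @[x --> (0 : R)^'+] --> (0 : R).
Proof.
apply: (@log_primitive R (fun t => sinc t * sincI t / t)).
  move=> v v0; apply: der_continuous; have vn := lt0r_neq0 v0.
  by have h := der_sinc vn; have h2 := der_sincI v0; der_auto; reflexivity.
move=> b b0; exists 1 => v /andP[v0 _]; rewrite mul1r.
apply: le_trans (_ : 1 <= _); last by rewrite lerDl.
rewrite normrM normfV (gtr0_norm v0) ler_pdivrMr// normrM.
apply: ler_pM => //; first exact: norm_sinc_le1.
by apply: norm_sincI_le; rewrite ltW.
Qed.

Lemma sincsincI_cauchy x y : 0 < x -> x <= y ->
  `|sincsincI y - sincsincI x| <= 2 / x.
Proof.
move=> x0 xy; have [dD _] := sincsincI_primitive.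
have y0 : 0 < y by exact: lt_le_trans xy.
have pos z : x <= z <= y -> 0 < z by move=> /andP[? ?]; lra.
have d2 z : x <= z <= y -> der (fun z => - (2 / z)) z (2 / z ^+ 2).
  by move=> /pos z0; have zn := lt0r_neq0 z0; der_auto; field.
have d3 z : x <= z <= y -> `|sinc z * sincI z / z| <= 2 / z ^+ 2.
  move=> /pos z0; rewrite ler_pdivlMr ?exprn_gt0//.
  rewrite -[X in _ * X](gtr0_norm (exprn_gt0 2 z0)) -normrM.
  rewrite (_ : sinc z * sincI z / z * z ^+ 2 = (sinc z * z) * sincI z); last by field; rewrite gt_eqF.
  rewrite normrM -[leRHS]mul1r; apply: ler_pM => //; first exact: norm_sinc_mul_le.
  by apply: norm_sincI_le2; rewrite ltW.
have := der_comparison xy (fun z h => dD z (pos z h)) d2 d3 => /le_trans; apply.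
have : 0 < 2 / y by rewrite divr_gt0.
lra.
Qed.

(* [sin (2 N t) / sin t = 2 \sum_(i < N) cos ((2 i + 1) t)] *)
Definition oddsinI N t : R := \sum_(i < N) 2 / (2 * i%:R + 1) * sin ((2 * i%:R + 1) * t).

Lemma odd_neq0 (i : nat) : 2 * i%:R + 1 != 0 :> R.
Proof. by rewrite gt_eqF// ltr_wpDl// mulr_ge0. Qed.

Lemma sum_cos_odd N t : sin t != 0 ->
  \sum_(i < N) 2 * cos ((2 * i%:R + 1) * t) = sin (2 * N%:R * t) / sin t.
Proof.
move=> s0; elim: N => [|N ih]; first by rewrite big_ord0 mulr0 mul0r sin0 mul0r.
rewrite big_ord_recr/= ih.
rewrite (_ : 2 * N%:R * t = (2 * N%:R + 1) * t - t); last by ring.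
rewrite (_ : 2 * N.+1%:R * t = (2 * N%:R + 1) * t + t); last by rewrite -natr1; ring.
by rewrite sinB sinD; field.
Qed.

Lemma der_oddsinI N t : sin t != 0 -> der (oddsinI N) t (sin (2 * N%:R * t) / sin t).
Proof.
move=> s0; rewrite -sum_cos_odd//; apply: der_sum => i _.
by have := odd_neq0 i; move: (2 * i%:R + 1) => a a0; der_auto; field.
Qed.

(** A primitive of [sin (2 * (i - j) * t) * cot t] for a difference of either sign; subtraction in
    [nat] truncates, hence the two cases. *)
Definition cotIB (i j : nat) t : R :=
  if (j <= i)%N then cotI (i - j) t else - cotI (j - i) t.

(** Expanding the product of [sin (2 * N * t) / sin t] and its primitive [oddsinI N t] by [2 * sin x
    * cos y = sin (x + y) + sin (x - y)] leaves only sines of even multiples of [t], for which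
    [cotI] gives primitives against [cot t]. *)
Definition oddsin_cotI N t : R :=
  \sum_(i < N) \sum_(j < N) 2 / (2 * i%:R + 1) * (cotI (i + j + 1) t + cotIB i j t).

Lemma der_cotIB i j t : 0 < t < pi ->
  der (cotIB i j) t (sin (2 * (i%:R - j%:R) * t) * (cos t / sin t)).
Proof.
move=> th; rewrite /cotIB; case: leqP => ij.
  by rewrite -natrB//; exact: der_cotI.
apply: der_eq; first exact/derN/(der_cotI (j - i) th).
by rewrite natrB ?(ltnW ij)// -mulNr -sinN; congr (sin _ * _); ring.
Qed.

Lemma der_oddsin_cotI N t : 0 < t < pi ->
  der (oddsin_cotI N) t (sin (2 * N%:R * t) / sin t * oddsinI N t * (cos t / sin t)).
Proof.
move=> /[dup] th /andP[t0 tp]; have s0 : sin t != 0 by rewrite gt_eqF// sin_gt0_pi.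
apply: der_eq.
  apply: der_sum => i _; apply: der_sum => j _.
  exact: (derM (der_cst (2 / (2 * i%:R + 1)) t) (derD (der_cotI (i + j + 1) th) (der_cotIB i j th))).
transitivity (oddsinI N t * (sin (2 * N%:R * t) / sin t) * (cos t / sin t)); last by ring.
rewrite -sum_cos_odd// /oddsinI 2!mulr_suml.
apply: eq_bigr => i _; rewrite mulr_sumr mulr_suml; apply: eq_bigr => j _ /=.
rewrite (_ : 2 * (i + j + 1)%:R * t = (2 * i%:R + 1) * t + (2 * j%:R + 1) * t); last first.
  by rewrite !natrD; ring.
rewrite (_ : 2 * (i%:R - j%:R) * t = (2 * i%:R + 1) * t - (2 * j%:R + 1) * t); last by ring.
by rewrite sinB sinD; move: (2 / _) (cos t / sin t) => a c; ring.
Qed.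

Lemma cotIB_pihalf i j : cotIB i j (pi / 2) =
  (pi / 2) * ((j < i)%N%:R - (i < j)%N%:R).
Proof.
rewrite /cotIB; case: (ltngtP i j) => ij /=; rewrite cotI_pihalf subn_eq0.
- by rewrite leqNgt ij/=; ring.
- by rewrite leqNgt ij/=; ring.
- by rewrite ij leqnn; ring.
Qed.

Lemma cvg_oddsin_cotI_right0 N : oddsin_cotI N x @[x --> 0^'+] --> 0.
Proof.
apply: cvg0_sum => i _; apply: cvg0_sum => j _; apply: cvg0Z; apply: cvg0D.
  exact: cvg_cotI_right0.
rewrite /cotIB; case: leqP => _; first exact: cvg_cotI_right0.
by rewrite -[X in _ --> X]oppr0; apply: cvgN; exact: cvg_cotI_right0.
Qed.

Lemma sum_lt_eq i N :
  (\sum_(j < N) ((j < i).*2 + (i == j)) = if i < N then i.*2.+1 else N.*2)%N.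
Proof.
elim: N => [|N ih]; first by rewrite big_ord0.
rewrite big_ord_recr/= ih; case: (ltngtP i N) => h /=; rewrite ltnS.
- by rewrite (ltnW h); lia.
- by rewrite leqNgt h/=; lia.
- by rewrite h leqnn; lia.
Qed.

(** In row [i], in units of [pi / 2], an index [j] contributes 2 if [j < i], 1 if [j = i] and 0
    otherwise. The row sums to [2 * i + 1], which cancels the denominator of its coefficient. *)
Lemma oddsin_cotI_pihalf N : oddsin_cotI N (pi / 2) = pi * N%:R.
Proof.
rewrite /oddsin_cotI -[RHS](_ : \sum_(i < N) pi = _); last first.
  by rewrite sumr_const card_ord mulr_natr.
apply: eq_bigr => i _; rewrite -mulr_sumr.
have -> : \sum_(j < N) (cotI (i + j + 1) (pi / 2) + cotIB i j (pi / 2)) =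
    pi / 2 * (2 * i%:R + 1).
  have iN := ltn_ord i; move: (nat_of_ord i) iN => {}i iN.
  transitivity (\sum_(j < N) (pi / 2 * (((j < i).*2 + (i == j))%N)%:R) : R).
    apply: eq_bigr => j _; rewrite cotIB_pihalf cotI_pihalf addn1/=.
    by rewrite natrD -mul2n natrM; case: (ltngtP i j) => _ /=; field.
  have e : i.*2.+1%:R = 2 * i%:R + 1 :> R by rewrite -mul2n -natr1 natrM.
  by rewrite -mulr_sumr -natr_sum sum_lt_eq iN e.
by have := odd_neq0 i; move: (2 * i%:R + 1) => a a0; field.
Qed.

(** [oddsinI N] and [sin (2 * N * t) / sin t] are the trigonometric models of [q] and of
    [sin (2 * N * t) / t]. The model of the integral equals [pi * N] exactly, the integral itself is
    [2 * N * pi * sincsincI N], and the derivative of their difference [K] is bounded uniformly in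
    [N]. *)
Lemma sincsincI_nat N : (0 < N)%N -> `|sincsincI N%:R - 1 / 2 : R| <= 4 / N%:R.
Proof.
move=> N0; have pi0 := @pi_gt0 R; have p2 := @pi_ge2 R; have pl := @pihalf_lt2 R.
have nr0 : 0 < N%:R :> R by rewrite ltr0n.
have nn := lt0r_neq0 nr0; have pn := lt0r_neq0 pi0.
have [dD D0] := sincsincI_primitive.
pose c : R := 2 * N%:R / pi; have c0 : 0 < c by rewrite divr_gt0 ?mulr_gt0.
pose q t := pi * sincI (c * t).
have pih t : 0 < t <= pi / 2 -> 0 < t < pi by lra.
have sp t : 0 < t <= pi / 2 -> 0 < sin t by move=> h; rewrite sin_gt0_pi//; exact: pih.
have ct t : 0 < t -> 0 < c * t by move=> ?; rewrite mulr_gt0.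
have ec t : pi * (c * t) = 2 * N%:R * t by rewrite /c; pi_field.
have Qq t : 0 < t <= pi / 2 -> `|oddsinI N t - q t| <= t ^+ 2 / 4.
  move=> /andP[t0 tp].
  have zh z : 0 < z <= t -> 0 < z <= pi / 2 by move=> /andP[? ?]; apply/andP; split; lra.
  have d1 z : 0 < z <= t -> der (fun z => oddsinI N z - q z) z
      (sin (2 * N%:R * z) * ((sin z)^-1 - z^-1)).
    move=> hz; have z0 : 0 < z by case/andP: hz.
    have sn := lt0r_neq0 (sp z (zh z hz)); have zn := lt0r_neq0 z0.
    have h1 := der_oddsinI N sn; have h2 := der_sincI (ct z z0).
    rewrite /q; der_auto; rewrite sincE ?gt_eqF ?ct// ec /c.
    by pi_field; rewrite sn pn nn zn.
  have d2 z : 0 < z <= t -> der (fun z => z ^+ 2 / 4) z (z / 2).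
    by move=> _; der_auto; field.
  have d2' : der (fun z => z ^+ 2 / 4) 0 (0 : R) by der_auto; field.
  have d3 z : 0 < z <= t -> `|sin (2 * N%:R * z) * ((sin z)^-1 - z^-1)| <= z / 2.
    move=> /zh /csc_sub_inv /andP[a b]; rewrite normrM (ger0_norm a).
    by apply: le_trans b; rewrite ler_piMl// sin_max.
  have := @der_comparison_right R _ _ _ _ 0 t 0 0 t0 d1 d2 d3; rewrite !subr0; apply.
    apply: cvg0B.
      have h : der (oddsinI N) 0 (\sum_(i < N) 2 / (2 * i%:R + 1) * (2 * i%:R + 1)).
        apply: der_sum => i _; have := odd_neq0 i; move: (2 * i%:R + 1) => a a0.
        by der_auto; rewrite mulr0 cos0; ring.
      have := der_cvg_right h; rewrite {2}/oddsinI big1// => i _.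
      by rewrite mulr0 sin0 mulr0.
    by apply: cvg0Z; apply: cvg_right0_scale => //; exact: cvg_sincI_right0.
  by have := der_cvg_right d2'; rewrite expr0n mul0r.
pose K t := oddsin_cotI N t - 2 * N%:R * pi * sincsincI (c * t).
pose k t := sin (2 * N%:R * t) * (cos t / sin t ^+ 2 * (oddsinI N t - q t)
   + q t * (cos t / sin t ^+ 2 - t ^- 2)).
have dK t : 0 < t <= pi / 2 -> der K t (k t).
  move=> /[dup] th /andP[t0 tp]; have sn := lt0r_neq0 (sp t th).
  have tn := lt0r_neq0 t0.
  have h1 := der_oddsin_cotI N (pih t th); have h2 := dD _ (ct t t0).
  rewrite /K; der_auto; rewrite /k sincE ?gt_eqF ?ct// ec /q /c.
  by pi_field; rewrite sn pn nn tn.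
have dH t : 0 < t <= pi / 2 -> der (fun t => 10 * t) t 10 by move=> _; der_auto; ring.
(* The product of [1 + t ^- 2] and [t ^+ 2 / 4] is at most [5 / 4], and [|q t| <= 2 * pi <= 8]. *)
have kH t : 0 < t <= pi / 2 -> `|k t| <= 10.
  move=> /[dup] th /andP[t0 tp]; have s0 := sp t th.
  have /andP[c1 c2] := csc2_sub_invsq th.
  rewrite /k normrM; apply: le_trans (ler_piMl _ (sin_max _)) _; first exact: normr_ge0.
  have cb : `|cos t / sin t ^+ 2| <= 1 + t ^- 2.
    rewrite normrM normfV (gtr0_norm (exprn_gt0 2 s0)).
    apply: le_trans (ler_piMl _ (cos_max _)) _; first by rewrite invr_ge0 sqr_ge0.
    by rewrite -exprVn in c2 *; lra.
  have qb : `|q t| <= 8.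
    rewrite /q normrM (gtr0_norm pi0).
    have := norm_sincI_le2 (ltW (ct t t0)) => h.
    by apply: le_trans (ler_wpM2l (ltW pi0) h) _; lra.
  have cd : `|cos t / sin t ^+ 2 - t ^- 2| <= 1.
    have cc : 0 <= cos t by apply: cos_ge0_pihalf; apply/andP; split; lra.
    (* As [sin t ^+ 2 = (1 - cos t) * (1 + cos t)], the quotient [(1 - cos t) / sin t ^+ 2] is
       [(1 + cos t)^-1]; both terms of the difference now lie in [[0, 1]]. *)
    have -> : cos t / sin t ^+ 2 - t ^- 2 = (sin t ^- 2 - t ^- 2) - (1 + cos t)^-1.
      have e : sin t ^+ 2 = (1 - cos t) * (1 + cos t) by rewrite sin2cos2; ring.
      have : (1 - cos t) * (1 + cos t) != 0 by rewrite -e expf_neq0// gt_eqF.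
      rewrite mulf_eq0 negb_or => /andP[c1n c2n].
      by rewrite e; field; rewrite c1n c2n gt_eqF.
    have : 0 < (1 + cos t)^-1 <= 1 by rewrite invr_gt0 invf_le1; lra.
    by move=> /andP[? ?]; rewrite ler_norml; apply/andP; split; lra.
  apply: le_trans (ler_normD _ _) _; rewrite [X in X + _]normrM [X in _ + X]normrM.
  have := ler_pM (normr_ge0 _) (normr_ge0 _) cb (Qq t th).
  rewrite (_ : (1 + t ^- 2) * (t ^+ 2 / 4) = t ^+ 2 / 4 + 1 / 4); last by field; rewrite gt_eqF.
  have := ler_pM (normr_ge0 _) (normr_ge0 _) qb cd.
  have : t ^+ 2 <= 2 ^+ 2 by rewrite lerXn2r ?nnegrE; lra.
  lra.
have K0 : K x @[x --> 0^'+] --> 0.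
  apply: cvg0B; first exact: cvg_oddsin_cotI_right0.
  by apply: cvg0Z; apply: cvg_right0_scale.
have H0 : 10 * x @[x --> (0 : R)^'+] --> (0 : R).
  by apply: cvg0Z; exact: der_cvg_right (der_id 0).
have ph0 : 0 < pi / 2 :> R by rewrite divr_gt0.
have := der_comparison_right ph0 dK dH kH K0 H0.
rewrite !subr0 /K oddsin_cotI_pihalf (_ : c * (pi / 2) = N%:R); last by rewrite /c; pi_field.
rewrite (_ : pi * N%:R - _ = - (2 * N%:R * pi * (sincsincI N%:R - 1 / 2))); last by field.
have cp : 0 < 2 * N%:R * pi :> R by rewrite !mulr_gt0.
rewrite normrN normrM (gtr0_norm cp) => h.
rewrite -(ler_pM2l cp); apply: le_trans h _.
rewrite (_ : 2 * N%:R * pi * (4 / N%:R) = 8 * pi); last by pi_field.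
lra.
Qed.

Lemma sincsincI_lim : sincsincI x @[x --> +oo] --> (1 / 2 : R).
Proof.
apply: (@cvg_pinfty_subseq _ _ (fun x => 2 / x) (fun n => 1 * n%:R)).
- by move=> x y x1 xy; apply: sincsincI_cauchy => //; lra.
- by apply: cvg0Z; exact: cvg_pinfty_inv.
- exact: cvg_natmul_pinfty.
have e0 : 4 * (1 * n%:R)^-1 @[n --> \oo] --> (0 : R).
  by apply: cvg0Z; exact: (cvg_nat_pinfty ltr01 (@cvg_pinfty_inv R)).
apply/cvgrPdist_le => e ep; move/cvgr0Pnorm_le : e0 => /(_ e ep) e0; near=> n.
have n0 : (0 < n)%N by near: n; exact: nbhs_infty_gt.
have : `|4 * (1 * n%:R)^-1| <= e by near: n.
by rewrite mul1r distrC => /(le_trans (ler_norm _)); apply: le_trans; exact: sincsincI_nat.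
Unshelve. all: by end_near. Qed.

End SincSincI.
(** * Primitives of the cluster functions *)

Section ClusterFunctions.
Context {R : realType}.
Implicit Types (b : dyson_index) (t u v x y : R).

Definition dsinc v : R := (cos (pi * v) - sinc v) / v.

(* [T2 beta4 v = clusterG (2 v)] and [T2 beta1 v = clusterG v + dsinc v / 2] for [v > 0]. *)
Definition clusterG v : R := sinc v ^+ 2 - dsinc v * sincI v.
(** Since [sinc * sincI] has derivative [dsinc * sincI + sinc ^+ 2], a second [sinc ^+ 2] is needed
    to obtain [clusterG]. *)
Definition clusterGI v : R := 2 * sinc2I v - sinc v * sincI v.
Definition clusterGlogI v : R :=
  2 * sinc2logI v + sincsincI v - sinc v * sincI v * ln v.
(** With [sinc v - 1] in place of [sinc v], the boundary term [(sinc v - 1) * ln v] vanishes at 0;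
    the other two terms have derivative [- (sinc v - 1) / v]. *)
Definition dsinclogI v : R := (sinc v - 1) * ln v + (sinc v - 1) + cosint (pi * v).

Definition T2I b v : R :=
  match b with
  | beta1 => clusterGI v + (sinc v - 1) / 2
  | beta2 => sinc2I v
  | beta4 => clusterGI (2 * v) / 2
  end.

(** For [beta4], [ln v] is split as [ln (2 * v) - ln 2] to match the argument of [clusterG]. *)
Definition T2logI b v : R :=
  match b with
  | beta1 => clusterGlogI v + dsinclogI v / 2
  | beta2 => sinc2logI v
  | beta4 => (clusterGlogI (2 * v) - ln 2 * clusterGI (2 * v)) / 2
  end.

Lemma der_sinc_pos v : 0 < v -> der sinc v (dsinc v).
Proof. by move=> v0; apply: der_sinc; rewrite gt_eqF. Qed.

Lemma derive1_sinc v : v != 0 -> derive1 sinc v = dsinc v.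
Proof. by move=> v0; exact: der_derive1 (der_sinc v0). Qed.

Lemma derive1_sinc_scaled v : v != 0 ->
  derive1 (fun u => sinc (2 * u)) v = 2 * dsinc (2 * v) :> R.
Proof.
move=> v0; apply: der_derive1.
have h : der sinc (2 * v) (dsinc (2 * v)) by apply: der_sinc; rewrite mulf_neq0.
by der_auto; ring.
Qed.

Lemma dsincN v : dsinc (- v) = - dsinc v.
Proof. by rewrite /dsinc mulrN cosN sincN invrN mulrN. Qed.

Lemma T2_pos b v : 0 < v -> T2 b v =
  match b with
  | beta1 => clusterG v + dsinc v / 2
  | beta2 => sinc v ^+ 2
  | beta4 => clusterG (2 * v)
  end.
Proof.
move=> v0; have pi0 := @pi_gt0 R; have vn := lt0r_neq0 v0; have pn := lt0r_neq0 pi0.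
case: b => //=; rewrite /clusterG /sincI.
  by rewrite derive1_sinc// gtr0_sg// mulr1; pi_field.
rewrite derive1_sinc_scaled// (_ : pi * (2 * v) = 2 * pi * v); last by ring.
by pi_field.
Qed.

Lemma T2N b v : T2 b (- v) = T2 b v.
Proof.
have [->|vn] := eqVneq v 0; first by rewrite oppr0.
have vn' : - v != 0 by rewrite oppr_eq0.
case: b; rewrite /T2 ?derive1_sinc ?derive1_sinc_scaled//.
- by rewrite sincN dsincN (mulrN pi) sine_integralN sgrN; ring.
- by rewrite sincN.
- by rewrite (mulrN (2 * pi)) (mulrN 2) sincN dsincN sine_integralN; ring.
Qed.

Lemma norm_dsinc_le v : 0 < v -> `|dsinc v| <= 16.
Proof.
move=> v0; have pi0 := @pi_gt0 R; have p4 := @pihalf_lt2 R.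
have [v1|v1] := ltP v 1; last first.
  rewrite /dsinc normrM normfV (gtr0_norm v0) ler_pdivrMr//.
  apply: le_trans (ler_normB _ _) _.
  have := cos_max (pi * v); have := norm_sinc_le1 v; lra.
rewrite /dsinc normrM normfV (gtr0_norm v0) ler_pdivrMr//.
have h1 : `|sinc v - 1| <= pi ^+ 2 / 2 * v by apply: norm_sinc_sub1_le; rewrite v0.
have h2 : `|cos (pi * v) - 1| <= pi ^+ 2 / 2 * v.
  rewrite distrC ger0_norm; last by have := cos_le1 (pi * v); lra.
  have := cos_ge_quadratic (pi * v).
  have : (pi * v) ^+ 2 / 2 <= pi ^+ 2 / 2 * v.
    rewrite (_ : (pi * v) ^+ 2 / 2 = pi ^+ 2 / 2 * v * v); last by ring.
    by rewrite ger_pMr ?(ltW v1)// mulr_gt0 ?divr_gt0 ?exprn_gt0.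
  lra.
have h3 : (pi : R) ^+ 2 <= 4 ^+ 2 by rewrite lerXn2r ?nnegrE; lra.
have h4 : pi ^+ 2 / 2 * v <= 8 * v by rewrite ler_pM2r//; lra.
rewrite (_ : _ - _ = (cos (pi * v) - 1) - (sinc v - 1)); last by ring.
apply: le_trans (ler_normB _ _) _; lra.
Qed.

Lemma norm_clusterG_le v : 0 < v -> `|clusterG v| <= 33.
Proof.
move=> v0; rewrite /clusterG; apply: le_trans (ler_normB _ _) _.
have := norm_sqr_sinc_le1 v; rewrite [X in _ + X]normrM.
have := ler_pM (normr_ge0 _) (normr_ge0 _) (norm_dsinc_le v0) (norm_sincI_le2 (ltW v0)).
lra.
Qed.

Lemma norm_T2_le b v : `|T2 b v| <= 41.
Proof.
wlog v0 : v / 0 < v => [th|].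
  have [|v0|<-] := ltgtP 0 v; first exact: th.
    by rewrite -T2N; apply: th; lra.
  (* At 0 the factor of [derive1] vanishes, which leaves [sinc 0 ^+ 2 = 1]. *)
  have h : `|1 : R| <= 41 by rewrite normr1; lra.
  case: b {th}; rewrite /T2 ?(mulr0 _) ?sine_integral0 ?sgr0 ?mulr0 ?subrr ?subr0 ?mulr0 ?subr0 ?sinc0 ?expr1n//.
rewrite T2_pos//; case: b.
- apply: le_trans (ler_normD _ _) _; rewrite normrM (ger0_norm (_ : 0 <= 2^-1)) ?invr_ge0//.
  by have := norm_clusterG_le v0; have := norm_dsinc_le v0; lra.
- by have := norm_sqr_sinc_le1 v; lra.
- by have := norm_clusterG_le (mulr_gt0 (ltr0n R 2) v0); lra.
Qed.

Lemma der_clusterGI v : 0 < v -> der clusterGI v (clusterG v).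
Proof.
move=> v0; have h1 := der_sinc2I v0; have h2 := der_sincI v0; have h3 := der_sinc_pos v0.
by rewrite /clusterGI /clusterG; der_auto; ring.
Qed.

Lemma der_T2I b v : 0 < v -> der (T2I b) v (T2 b v).
Proof.
move=> v0; rewrite T2_pos// /T2I; case: b => /=.
- have h1 := der_clusterGI v0; have h3 := der_sinc_pos v0.
  by der_auto; field.
- exact: der_sinc2I.
- have h1 := der_clusterGI (mulr_gt0 (ltr0n R 2) v0).
  by der_auto; field.
Qed.

Lemma T2_continuous b v : 0 < v -> {for v, continuous (T2 b)}.
Proof.
move=> v0.
pose f x : R := match b with
  | beta1 => clusterG x + dsinc x / 2
  | beta2 => sinc x ^+ 2
  | beta4 => clusterG (2 * x)
  end.
have [d df] : exists d, der f v d.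
  have h2 := der_sincI v0; have h3 := der_sinc_pos v0; have vn := lt0r_neq0 v0.
  have v20 : 0 < 2 * v by rewrite mulr_gt0.
  have h4 := der_sincI v20; have h5 := der_sinc_pos v20; have vn2 := lt0r_neq0 v20.
  by rewrite /f /clusterG /dsinc; case: b @f; eexists; der_auto; reflexivity.
have : der (T2 b) v d.
  apply: (@der_oo _ f _ _ _ 0 (v + 1)) => //; first by rewrite v0 ltrDl ltr01.
  by move=> y /andP[y0 _]; rewrite T2_pos.
exact: der_continuous.
Qed.

Lemma clusterGI_lim v : 0 < v -> `|clusterGI v - 1| <= 6 / v.
Proof.
move=> v0; rewrite (_ : _ - _ = 2 * (sinc2I v - 1 / 2) - sinc v * sincI v); last first.
  by rewrite /clusterGI; field.
apply: le_trans (ler_normB _ _) _; rewrite [X in X + _]normrM (ger0_norm (ler0n R 2)).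
have := sinc2I_lim v0.
have h : `|sinc v * sincI v| <= 2 / v.
  rewrite ler_pdivlMr// -[X in _ * X](gtr0_norm v0) -normrM mulrAC normrM -[leRHS]mul1r.
  by apply: ler_pM => //; [exact: norm_sinc_mul_le|exact: norm_sincI_le2 (ltW v0)].
lra.
Qed.

Lemma norm_sinc_le_inv v : 0 < v -> `|sinc v| <= v^-1.
Proof.
by move=> v0; rewrite -[leRHS]mul1r ler_pdivlMr// -[X in _ * X](gtr0_norm v0) -normrM norm_sinc_mul_le.
Qed.

(** This rate is the substitute for absolute integrability: it gives the total integral 1, the tail
    condition, and the decay of the boundary terms against logarithmic weights. *)
Lemma T2I_lim b v : 0 < v -> `|T2I b v - 1 / 2| <= 7 / v.
Proof.
move=> v0; have vi : 0 < v^-1 by rewrite invr_gt0.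
case: b => /=.
- rewrite (_ : _ - _ = (clusterGI v - 1) + sinc v / 2); last by field.
  apply: le_trans (ler_normD _ _) _; rewrite [X in _ + X]normrM (ger0_norm (_ : 0 <= 2^-1)) ?invr_ge0//.
  have := clusterGI_lim v0; have := norm_sinc_le_inv v0; lra.
- have := sinc2I_lim v0; lra.
- have v20 : 0 < 2 * v by rewrite mulr_gt0.
  rewrite (_ : _ - _ = (clusterGI (2 * v) - 1) / 2); last by field.
  rewrite normrM (ger0_norm (_ : 0 <= 2^-1)) ?invr_ge0//.
  have := clusterGI_lim v20.
  by rewrite (_ : 6 / (2 * v) = 3 * v^-1); [lra|field; rewrite gt_eqF].
Qed.

Lemma cvg_sinc_sincI_right0 : sinc x * sincI x @[x --> (0 : R)^'+] --> (0 : R).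
Proof.
apply: (@cvg_right0_linear _ _ 1 1 0) => // x /andP[x0 _]; rewrite subr0 normrM.
apply: ler_pM => //; first exact: norm_sinc_le1.
by apply: norm_sincI_le; rewrite ltW.
Qed.

Lemma cvg_clusterGI_right0 : clusterGI x @[x --> (0 : R)^'+] --> (0 : R).
Proof.
by apply: cvg0B; [apply: cvg0Z; exact: cvg_sinc2I_right0|exact: cvg_sinc_sincI_right0].
Qed.

Lemma cvg_sinc_sub1_right0 : sinc x - 1 @[x --> (0 : R)^'+] --> (0 : R).
Proof.
by rewrite -[X in _ --> X](subrr 1); apply: cvgB; [exact: cvg_sinc_right0|exact: cvg_cst].
Qed.

Lemma cvg_T2I_right0 b : T2I b x @[x --> 0^'+] --> 0.
Proof.
rewrite /T2I; case: b => /=.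
- apply: cvg0D; first exact: cvg_clusterGI_right0.
  rewrite (_ : (fun x => (sinc x - 1) / 2) = fun x => 2^-1 * (sinc x - 1)); last first.
    by apply/funext => x; rewrite mulrC.
  by apply: cvg0Z; exact: cvg_sinc_sub1_right0.
- exact: cvg_sinc2I_right0.
- rewrite (_ : (fun x => clusterGI (2 * x) / 2) = fun x => 2^-1 * clusterGI (2 * x)); last first.
    by apply/funext => x; rewrite mulrC.
  by apply: cvg0Z; apply: cvg_right0_scale => //; exact: cvg_clusterGI_right0.
Qed.

Lemma der_clusterGlogI v : 0 < v -> der clusterGlogI v (clusterG v * ln v).
Proof.
move=> v0; have [dA _] := @sinc2log_primitive R; have [dD _] := @sincsincI_primitive R.
have h1 := dA v v0; have h2 := dD v v0; have h3 := der_sincI v0; have h4 := der_sinc_pos v0.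
by rewrite /clusterGlogI /clusterG; der_auto; field; rewrite gt_eqF.
Qed.

Lemma der_dsinclogI v : 0 < v -> der dsinclogI v (dsinc v * ln v).
Proof.
move=> v0; have pi0 := @pi_gt0 R; have [dC _] := @cosint_primitive R.
have h1 := dC _ (mulr_gt0 pi0 v0); have h2 := der_sinc_pos v0.
by rewrite /dsinclogI; der_auto; rewrite /dsinc; pi_field; rewrite !gt_eqF.
Qed.

Lemma der_T2logI b v : 0 < v -> der (T2logI b) v (T2 b v * ln v).
Proof.
move=> v0; rewrite T2_pos// /T2logI; case: b => /=.
- have h1 := der_clusterGlogI v0; have h3 := der_dsinclogI v0.
  by der_auto; field.
- by have [dA _] := @sinc2log_primitive R; exact: dA.
- have v20 := mulr_gt0 (ltr0n R 2) v0.
  have h1 := der_clusterGlogI v20; have h2 := der_clusterGI v20.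
  by der_auto; rewrite lnM ?posrE//; field.
Qed.

Lemma cvg_clusterGlogI_right0 : clusterGlogI x @[x --> (0 : R)^'+] --> (0 : R).
Proof.
have [_ A0] := @sinc2log_primitive R; have [_ D0] := @sincsincI_primitive R.
apply: cvg0B; first by apply: cvg0D => //; exact: cvg0Z.
apply: (@cvg_right_squeeze _ _ (fun x => `|x * ln x|) 0 1) => //.
  move=> x /andP[x0 _]; rewrite subr0 normrM (normrM x) ler_wpM2r// normrM -[leRHS]mul1r.
  apply: ler_pM => //; first exact: norm_sinc_le1.
  by rewrite (gtr0_norm x0) norm_sincI_le// ltW.
by rewrite -[X in _ --> X](normr0 R); apply: cvg_norm; exact: cvg_xlnx.
Qed.

Lemma cvg_dsinclogI_right0 : dsinclogI x @[x --> (0 : R)^'+] --> (0 : R).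
Proof.
have [_ C0] := @cosint_primitive R.
apply: cvg0D; last by apply: cvg_right0_scale => //; exact: pi_gt0.
apply: cvg0D; last exact: cvg_sinc_sub1_right0.
apply: (@cvg_right_squeeze _ _ (fun x => pi ^+ 2 / 2 * `|x * ln x|) 0 1) => //.
  move=> x /[dup] x01 /andP[x0 _]; rewrite subr0 !normrM mulrA ler_wpM2r//.
  by rewrite (gtr0_norm x0) norm_sinc_sub1_le.
by apply: cvg0Z; rewrite -[X in _ --> X](normr0 R); apply: cvg_norm; exact: cvg_xlnx.
Qed.

Lemma cvg_T2logI_right0 b : T2logI b x @[x --> 0^'+] --> 0.
Proof.
rewrite /T2logI; case: b => /=.
- apply: cvg0D; first exact: cvg_clusterGlogI_right0.
  rewrite (_ : (fun x => dsinclogI x / 2) = fun x => 2^-1 * dsinclogI x); last first.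
    by apply/funext => x; rewrite mulrC.
  by apply: cvg0Z; exact: cvg_dsinclogI_right0.
- by have [_ A0] := @sinc2log_primitive R.
- rewrite (_ : (fun x => _) = fun x => 2^-1 * (clusterGlogI (2 * x) - ln 2 * clusterGI (2 * x))); last first.
    by apply/funext => x; rewrite mulrC.
  apply: cvg0Z; apply: cvg0B; [|apply: cvg0Z]; apply: cvg_right0_scale => //.
    exact: cvg_clusterGlogI_right0.
  exact: cvg_clusterGI_right0.
Qed.

Lemma cvg_clusterGI_pinfty : clusterGI x @[x --> +oo] --> (1 : R).
Proof.
apply: (@cvg_pinfty_squeeze _ _ (fun x => 6 / x)).
  by move=> x x1; apply: clusterGI_lim; lra.
by apply: cvg0Z; exact: cvg_pinfty_inv.
Qed.

Lemma cvg_sinc_ln_pinfty (f : R -> R) (C : R) : (forall x, 1 <= x -> `|f x| <= C) ->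
  sinc x * f x * ln x @[x --> +oo] --> (0 : R).
Proof.
move=> fC; apply: (@cvg_pinfty_squeeze _ _ (fun x => C * ((ln x + 0) / x))).
  move=> x x1; have x0 : 0 < x by lra.
  rewrite subr0 !normrM (ger0_norm (ln_ge0 x1)).
  rewrite (_ : C * ((ln x + 0) / x) = x^-1 * C * ln x); last by ring.
  rewrite ler_wpM2r ?ln_ge0//; apply: ler_pM => //; last exact: fC.
  exact: norm_sinc_le_inv.
by apply: cvg0Z; exact: cvg_pinfty_lndiv.
Qed.

Lemma cvg_clusterGlogI_pinfty : clusterGlogI x @[x --> +oo] -->
  (3 / 2 - euler_gamma - ln (2 * pi) : R).
Proof.
rewrite (_ : _ - _ - _ = 2 * ((1 - euler_gamma - ln (2 * pi)) / 2) + 1 / 2 - 0); last by field.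
apply: cvgB; last first.
  by apply: (@cvg_sinc_ln_pinfty _ 2) => x x1; apply: norm_sincI_le2; lra.
apply: cvgD; last exact: sincsincI_lim.
by apply: cvgM; [exact: cvg_cst|exact: sinc2logI_lim].
Qed.

Lemma cvg_dsinclogI_pinfty : dsinclogI x @[x --> +oo] --> (euler_gamma + ln pi - 1 : R).
Proof.
have pi0 := @pi_gt0 R.
have h1 : sinc x * 1 * ln x @[x --> +oo] --> (0 : R).
  by apply: (@cvg_sinc_ln_pinfty (fun=> 1) 1) => x _; rewrite normr1.
have h2 : sinc x @[x --> +oo] --> (0 : R).
  apply: (@cvg_pinfty_squeeze _ _ (fun x => x^-1)); last exact: cvg_pinfty_inv.
  by move=> x x1; rewrite subr0 norm_sinc_le_inv//; lra.
have h3 : cosint (pi * x) - ln (pi * x) @[x --> +oo] --> (euler_gamma : R).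
  exact: (cvg_scale_pinfty pi0 (@cosint_sub_ln_lim R)).
rewrite (_ : _ - _ = 0 + (0 - 1) + (euler_gamma + ln pi)); last by ring.
have h : sinc x * 1 * ln x + (sinc x - 1) + (cosint (pi * x) - ln (pi * x) + ln pi)
    @[x --> +oo] --> (0 + (0 - 1) + (euler_gamma + ln pi) : R).
  apply: cvgD; last by apply: cvgD => //; exact: cvg_cst.
  by apply: cvgD => //; apply: cvgB => //; exact: cvg_cst.
apply: cvg_trans h; apply: near_eq_cvg; near=> x.
have x0 : 0 < x by near: x; exact: nbhs_pinfty_gt.
by rewrite /dsinclogI /= lnM ?posrE//; ring.
Unshelve. all: by end_near. Qed.

Lemma cvg_T2logI_pinfty b :
  T2logI b x @[x --> +oo] --> (limit_mean_W b - ln (2 * pi)) / 2.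
Proof.
have pi0 := @pi_gt0 R; have l2p : ln (2 * pi) = ln 2 + ln pi :> R by rewrite lnM ?posrE.
case: b => /=.
- rewrite (_ : _ / 2 = 3 / 2 - euler_gamma - ln (2 * pi) + (euler_gamma + ln pi - 1) / 2); last first.
    by rewrite l2p; field.
  by apply: cvgD; [exact: cvg_clusterGlogI_pinfty|apply: cvgM; [exact: cvg_dsinclogI_pinfty|exact: cvg_cst]].
- exact: sinc2logI_lim.
- rewrite (_ : (_ - ln (2 * pi)) / 2 = (3 / 2 - euler_gamma - ln (2 * pi) - ln 2 * 1) / 2); last by field.
  apply: cvgM; last exact: cvg_cst.
  apply: cvgB; first by apply: cvg_scale_pinfty => //; exact: cvg_clusterGlogI_pinfty.
  apply: cvgM; first exact: cvg_cst.
  by apply: cvg_scale_pinfty => //; exact: cvg_clusterGI_pinfty.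
Unshelve. all: by end_near. Qed.

End ClusterFunctions.
(** * Even functions and improper integrals *)

Section EvenFunctions.
Context {R : realType}.
Implicit Types (f F : R -> R) (a b x y l C : R).
Local Notation mu := (@lebesgue_measure R).

Lemma integrable_itvU f a c b : a <= c -> c <= b ->
  mu.-integrable `[a, c] (EFin \o f) -> mu.-integrable `[c, b] (EFin \o f) ->
  mu.-integrable `[a, b] (EFin \o f).
Proof.
move=> ac cb /integrableP[m1 i1] /integrableP[m2 i2].
have e : `[a, b]%classic = (`[a, c] `|` `]c, b])%classic :> set R.
  apply/seteqP; split => z; rewrite /= !in_itv/=.
    by move=> /andP[az zb]; have [zc|zc] := leP z c; [left|right]; apply/andP; split.
  by case=> /andP[? ?]; apply/andP; split; lra.
have sub : (`]c, b] `<=` `[c, b])%classic by apply: subset_itvr; rewrite bnd_simp.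
have m2' : measurable_fun `]c, b] (EFin \o f) by exact: measurable_funS m2.
have mf : measurable_fun `[a, b] (EFin \o f).
  by rewrite e; apply/measurable_funU.
apply/integrableP; split => //.
rewrite e ge0_integral_setU//.
- apply: lte_add_pinfty => //; apply: le_lt_trans i2.
  by apply: ge0_subset_integral => //; exact: measurableT_comp.
- by rewrite -e; exact: measurableT_comp.
- apply/disj_setPS => z [] /=; rewrite !in_itv/= => /andP[_ zc] /andP[cz _].
  by move: (lt_le_trans cz zc); rewrite ltxx.
Qed.

Lemma FTC_log f F C x : 0 < x ->
  (forall v, 0 < v -> {for v, continuous f}) ->
  (forall v, 0 < v -> `|f v| <= C * (1 + `|ln v|)) ->
  (forall v, 0 < v -> der F v (f v)) -> F x @[x --> 0^'+] --> 0 ->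
  \int[mu]_(t in `[0, x]) f t = F x.
Proof.
move=> x0 cf fC dF F0; rewrite -[RHS]subr0.
apply: (FTC_integrable x0) => //.
- by apply: (integrable_log x0) => [v /andP[v0 _]|v /andP[v0 _]]; [exact: cf|exact: fC].
- by move=> z /andP[z0 _]; exact: cf.
- by move=> z /andP[z0 _]; exact: dF.
- exact: F0.
- exact: der_cvg_left (dF x x0).
Qed.

Lemma cvg_right_oppN F (x l : R) : F y @[y --> x^'-] --> l ->
  F (- y) @[y --> (- x)^'+] --> l.
Proof.
move=> h; apply/cvg_at_rightNP; rewrite opprK (_ : (fun y => F (- y)) \o -%R = F)//.
by apply/funext => y; rewrite /= opprK.
Qed.

Lemma FTC_log_even f F C x : 0 < x -> (forall v, f (- v) = f v) ->
  (forall v, 0 < v -> {for v, continuous f}) ->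
  (forall v, 0 < v -> `|f v| <= C * (1 + `|ln v|)) ->
  (forall v, 0 < v -> der F v (f v)) -> F x @[x --> 0^'+] --> 0 ->
  mu.-integrable `[- x, 0] (EFin \o f) /\ \int[mu]_(t in `[- x, 0]) f t = F x.
Proof.
move=> x0 fN cf fC dF F0.
have int0 : mu.-integrable `[- x, 0] (EFin \o f).
  have -> : f = fun v => f (- v) by apply/funext => v; rewrite fN.
  by apply: (integrable_logN x0) => [v /andP[v0 _]|v /andP[v0 _]]; [exact: cf|exact: fC].
split => //; rewrite -[RHS](_ : 0 - (- F x) = F x); last by ring.
have xN : - x < 0 by rewrite oppr_lt0.
apply: (@FTC_integrable _ f (fun v => - F (- v)) _ _ _ _ xN int0).
- move=> z /andP[_ z0]; have -> : f = fun v => f (- v) by apply/funext => v; rewrite fN.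
  by apply: continuous_comp; [exact: opp_continuous|apply: cf; lra].
- move=> z /andP[_ z0]; have d : der F (- z) (f (- z)) by apply: dF; lra.
  by der_auto; rewrite fN; ring.
- by apply: cvgN; apply: cvg_right_oppN; exact: der_cvg_left (dF x x0).
- rewrite -[X in _ --> X]oppr0; apply: cvgN; apply/cvg_at_leftNP; rewrite oppr0.
  by rewrite (_ : (fun y => F (- y)) \o -%R = F)//; apply/funext => y; rewrite /= opprK.
Qed.

Section EvenPrimitive.
Variables (f F : R -> R) (C : R).
Hypothesis fN : forall v, f (- v) = f v.
Hypothesis cf : forall v, 0 < v -> {for v, continuous f}.
Hypothesis fC : forall v, 0 < v -> `|f v| <= C * (1 + `|ln v|).
Hypothesis dF : forall v, 0 < v -> der F v (f v).
Hypothesis F0 : F x @[x --> 0^'+] --> 0.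

Lemma even_integrable a b : mu.-integrable `[a, b] (EFin \o f).
Proof.
pose c := `|a| + `|b| + 1.
have c0 : 0 < c by rewrite /c ltr_wpDl// addr_ge0.
have i1 := (FTC_log_even c0 fN cf fC dF F0).1.
have i2 : mu.-integrable `[0, c] (EFin \o f).
  by apply: (integrable_log c0) => [v /andP[v0 _]|v /andP[v0 _]]; [exact: cf|exact: fC].
have i3 : mu.-integrable `[- c, c] (EFin \o f).
  by apply: (integrable_itvU _ _ i1 i2); lra.
apply: integrableS i3 => //; apply: subset_itv; rewrite bnd_simp /c.
  by have := ler_norm (- a); rewrite normrN; have := normr_ge0 b; lra.
by have := ler_norm b; have := normr_ge0 a; lra.
Qed.

Lemma even_Rintegral y x : 0 < y -> 0 < x ->
  \int[mu]_(t in `[- y, x]) f t = F y + F x.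
Proof.
move=> y0 x0.
have := @Rintegral_itvB R f (BLeft (- y)) (BRight x) 0 (even_integrable (- y) x).
rewrite !bnd_simp => /(_ _ _) h; have {}h := h ltac:(lra) ltac:(lra).
have e1 : \int[mu]_(t in `[- y, 0]) f t = F y by exact: (FTC_log_even y0 fN cf fC dF F0).2.
have e2 : \int[mu]_(t in `]0, x]) f t = F x.
  rewrite Rintegral_itv_obnd_cbnd; first exact: (FTC_log x0 cf fC dF F0).
  by apply: integrableS (even_integrable 0 x) => //; apply: subset_itvr; rewrite bnd_simp.
by rewrite e1 e2 in h; rewrite -h; ring.
Qed.

(** For [a < 0 < b] the integral over [[a, b]] is [F (- a) + F b], and the two terms converge
    independently. *)
Lemma even_improper_integral l : F x @[x --> +oo] --> l ->
  improper_integral f (2 * l).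
Proof.
move=> Fl; split; first exact: even_integrable.
have h : F (- p.1) + F p.2 @[p --> filter_prod (ninfty_nbhs R) (pinfty_nbhs R)] --> 2 * l.
  rewrite (_ : 2 * l = l + l); last by ring.
  apply: cvgD.
    apply: (cvg_comp (fun p : R * R => - p.1) F) Fl.
    apply: (cvg_comp (fun p : R * R => p.1) -%R); first exact: cvg_fst.
    apply/cvgryPge => A; near=> x; rewrite lerNr.
    by near: x; apply: nbhs_ninfty_le; exact: num_real.
  by apply: (cvg_comp (fun p : R * R => p.2) F) Fl; exact: cvg_snd.
apply: cvg_trans h; apply: near_eq_cvg; near=> p.
have p1 : p.1 < 0.
  near: p; exists (`]-oo, 0[%classic, setT) => /=; last by move=> q /= [+ _]; rewrite in_itv.
  by split; [exists 0; split => // x; rewrite in_itv|exact: filterT].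
have p2 : 0 < p.2.
  near: p; exists (setT, `]0, +oo[%classic) => /=; last by move=> q /= [_]; rewrite in_itv/= andbT.
  by split; [exact: filterT|exists 0; split => // x x0; rewrite /= in_itv/= x0].
have p10 : 0 < - p.1 by lra.
by rewrite -{2}(opprK p.1) even_Rintegral.
Unshelve. all: by end_near. Qed.

End EvenPrimitive.

End EvenFunctions.

(** * Integrals of the cluster functions over the line *)

Section ClusterIntegrals.
Context {R : realType}.
Implicit Types (b : dyson_index) (v x : R).

Lemma norm_T2_log_bound b v : `|T2 b v| <= 41 * (1 + `|ln v|).
Proof. by apply: le_trans (norm_T2_le b v) _; rewrite ler_peMr// lerDl. Qed.

Lemma T2_ln_log_bound b v : `|T2 b v * ln (`|v|)| <= 41 * (1 + `|ln (`|v|)|).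
Proof.
rewrite normrM; apply: ler_pM => //; first exact: norm_T2_le.
by rewrite lerDr.
Qed.

Lemma cvg_T2I_pinfty b : T2I b x @[x --> +oo] --> (1 / 2 : R).
Proof.
apply: (@cvg_pinfty_squeeze _ _ (fun x => 7 / x)).
  by move=> x x1; apply: T2I_lim; lra.
by apply: cvg0Z; exact: cvg_pinfty_inv.
Qed.

Lemma T2_improper_integral b : improper_integral (@T2 R b) 1.
Proof.
rewrite (_ : 1 = 2 * (1 / 2)); last by field.
apply: (@even_improper_integral R (T2 b) (T2I b) 41).
- exact: T2N.
- exact: T2_continuous.
- by move=> v _; exact: norm_T2_log_bound.
- exact: der_T2I.
- exact: cvg_T2I_right0.
- exact: cvg_T2I_pinfty.
Qed.

Lemma T2_symmetric_integral b x : 0 < x ->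
  \int[lebesgue_measure]_(v in `[- x, x]) T2 b v = 2 * T2I b x.
Proof.
move=> x0; rewrite mulr_natl mulr2n; apply: (@even_Rintegral R (T2 b) (T2I b) 41) => //.
- exact: T2N.
- exact: T2_continuous.
- by move=> v _; exact: norm_T2_log_bound.
- exact: der_T2I.
- exact: cvg_T2I_right0.
Qed.

Lemma T2_ln_improper_integral b :
  improper_integral (fun v : R => T2 b v * ln `|v|) (limit_mean_W b - ln (2 * pi)).
Proof.
rewrite (_ : _ - _ = 2 * ((limit_mean_W b - ln (2 * pi)) / 2)); last by field.
apply: (@even_improper_integral R _ (T2logI b) 41).
- by move=> v; rewrite T2N normrN.
- move=> v v0; apply: continuousM; first exact: T2_continuous.
  apply: continuous_comp; first exact: norm_continuous.
  by apply: continuous_ln; rewrite normr_gt0 gt_eqF.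
- by move=> v v0; have := T2_ln_log_bound b v; rewrite (gtr0_norm v0).
- by move=> v v0; rewrite (gtr0_norm v0); exact: der_T2logI.
- exact: cvg_T2logI_right0.
- exact: cvg_T2logI_pinfty.
Qed.

End ClusterIntegrals.
(** * Logarithmic averages of the cluster functions over [0, n] *)

Section LogAverages.
Context {R : realType}.
Implicit Types (b : dyson_index) (n s t u v x y A alpha : R).
Local Notation mu := (@lebesgue_measure R).

Definition log2sin n v : R := ln (2 * sin (pi * (v / n))).

Lemma unit_scaled n v : 0 < v < n -> 0 < v / n < 1.
Proof.
move=> /andP[v0 vn]; have n0 : 0 < n by exact: lt_trans vn.
by rewrite divr_gt0//= ltr_pdivrMr// mul1r.
Qed.

Lemma der_log2sin_scaled n v : 0 < v < n ->
  der (log2sin n) v (pi / n * (cos (pi * (v / n)) / sin (pi * (v / n)))).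
Proof.
move=> h; have /der_log2sin d := unit_scaled h; rewrite /log2sin.
have n0 : 0 < n by case/andP: h => v0; exact: lt_trans.
have e : der (fun v => v / n) v n^-1 by der_auto; ring.
by apply: der_eq; [exact: (der_comp e d)|ring].
Qed.

Lemma der_log_envI_scaled n v : 0 < v < n ->
  der (fun v => n * log_envI (v / n)) v (log_env (v / n)).
Proof.
move=> h; have /der_log_envI d := unit_scaled h.
have n0 : 0 < n by case/andP: h => v0; exact: lt_trans.
have e : der (fun v => v / n) v n^-1 by der_auto; ring.
apply: der_eq; first exact: (derM (der_cst n v) (der_comp e d)).
by cbv beta; field; rewrite gt_eqF.
Qed.

Lemma norm_log2sin_scaled_le n v : 0 < v < n -> `|log2sin n v| <= log_env (v / n).
Proof. by move=> /unit_scaled; exact: norm_log2sin_le. Qed.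

Lemma integrable_log2sin_mul (g : R -> R) n C : 0 < n -> 0 <= C ->
  (forall v, 0 < v < n -> {for v, continuous g}) ->
  (forall v, 0 < v < n -> `|g v| <= C) ->
  mu.-integrable `[0, n] (EFin \o (fun v => g v * log2sin n v)).
Proof.
move=> n0 C0 cg gC.
apply: (@dominated_integrable _ _ (fun v => C * (n * log_envI (v / n)))
  (fun v => C * log_env (v / n)) 0 n (C * (n * 7)) n0).
- move=> z h; apply: continuousM; first exact: cg.
  exact: der_continuous (der_log2sin_scaled h).
- move=> z h; have d := der_log_envI_scaled h.
  by apply: der_eq; [exact: (derM (der_cst C z) d)|cbv beta; rewrite mul0r add0r].
- move=> z h; rewrite normrM; apply: ler_pM => //; first exact: gC.
  exact: norm_log2sin_scaled_le.
- move=> z h; rewrite normrM (ger0_norm C0) ler_wpM2l// normrM (gtr0_norm n0) ler_pM2l//.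
  exact/norm_log_envI_le/unit_scaled.
Qed.

Lemma cot_bounds t : 0 < t < pi -> - (pi - t)^-1 <= cos t / sin t <= t^-1.
Proof.
move=> h; rewrite cot_le// andbT.
have h' : 0 < pi - t < pi by case/andP: h => ? ?; apply/andP; split; lra.
have e1 : cos (pi - t) = - cos t by rewrite cosB cospi sinpi; ring.
have e2 : sin (pi - t) = sin t by rewrite sinB cospi sinpi; ring.
by have := cot_le h'; rewrite e1 e2 mulNr; lra.
Qed.

Lemma norm_dlog2sin_le n v : 0 < v < n ->
  `|pi / n * (cos (pi * (v / n)) / sin (pi * (v / n)))| <= v^-1 + (n - v)^-1.
Proof.
move=> h; have /andP[s0 s1] := unit_scaled h; have pi0 := @pi_gt0 R.
have /andP[v0 vn] := h; have n0 : 0 < n by exact: lt_trans vn.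
have th : 0 < pi * (v / n) < pi by rewrite mulr_gt0//= gtr_pMr.
have /andP[c1 c2] := cot_bounds th.
have pn : 0 < pi / n by rewrite divr_gt0.
have a1 : pi / n * (pi * (v / n))^-1 = v^-1 by pi_field; rewrite !gt_eqF.
have a2 : pi / n * (pi - pi * (v / n))^-1 = (n - v)^-1.
  rewrite (_ : pi - pi * (v / n) = (pi / n) * (n - v)); last by pi_field; rewrite gt_eqF.
  by rewrite invfM mulVKf// gt_eqF.
have := ler_wpM2l (ltW pn) c1; have := ler_wpM2l (ltW pn) c2.
rewrite mulrN a1 a2 => ? ?.
have : 0 < v^-1 by rewrite invr_gt0.
have : 0 < (n - v)^-1 by rewrite invr_gt0 subr_gt0.
by rewrite ler_norml => ? ?; apply/andP; split; lra.
Qed.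

(** Integration by parts with the primitive [T2I b - 1 / 2], normalized to vanish at infinity. Each
    of the two boundary terms is at most [7 / alpha * (2 + 2 * ln n)]. In the remaining integral the
    derivative of the weight is at most [2 / alpha], which leaves [14 / alpha] times an increment of
    [ln]. *)
Lemma T2_log2sin_window b n alpha A : 1 <= alpha -> alpha < A -> A <= n - alpha ->
  `|\int[mu]_(v in `[alpha, A]) (T2 b v * log2sin n v)| <= 42 * (ln n + 1) / alpha.
Proof.
move=> al1 alA An; have n1 : 1 <= n by lra.
have n0 : 0 < n by lra.
have ai : 0 < alpha^-1 by rewrite invr_gt0; lra.
have zn z : alpha <= z <= A -> 0 < z < n by move=> /andP[? ?]; apply/andP; split; lra.
have z0 z : alpha <= z <= A -> 0 < z by move=> /andP[? ?]; lra.
have cT z : 0 < z < n -> {for z, continuous (T2 b)}.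
  by move=> /andP[? _]; exact: T2_continuous.
have inti := integrable_log2sin_mul n0 (ler0n _ 41) cT (fun v _ => norm_T2_le b v).
have cTl z : 0 < z < n -> {for z, continuous (fun v => T2 b v * log2sin n v)}.
  move=> h; apply: continuousM; first exact: cT.
  exact: der_continuous (der_log2sin_scaled h).
have [Q [dQ _ _]] := integrable_primitive n0 inti cTl.
have lb : alpha <= alpha <= A by lra.
have ub : alpha <= A <= A by lra.
have -> : \int[mu]_(v in `[alpha, A]) (T2 b v * log2sin n v) = Q A - Q alpha.
  apply: FTC_integrable alA _ _ _ (der_cvg_right (dQ _ (zn _ lb))) (der_cvg_left (dQ _ (zn _ ub))).
  - by apply: integrableS inti => //; apply: subset_itv; rewrite bnd_simp; lra.
  - by move=> z /andP[? ?]; apply: cTl; apply: zn; rewrite !ltW.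
  - by move=> z /andP[? ?]; apply: dQ; apply: zn; rewrite !ltW.
have d1 z : alpha <= z <= A ->
    der (fun v => Q v - (T2I b v - 1 / 2) * log2sin n v) z
      (- ((T2I b z - 1 / 2) * (pi / n * (cos (pi * (z / n)) / sin (pi * (z / n)))))).
  move=> h; have hQ := dQ z (zn z h); have hl := der_log2sin_scaled (zn z h).
  have hT := der_T2I b (z0 z h).
  by apply: der_eq; [exact: (derB hQ (derM (derB hT (der_cst (1 / 2) z)) hl))|cbv beta; ring].
have d2 z : alpha <= z <= A -> der (fun v => 14 / alpha * ln v) z (14 / alpha / z).
  by move=> /z0 zp; der_auto; ring.
have d3 z : alpha <= z <= A ->
    `|- ((T2I b z - 1 / 2) * (pi / n * (cos (pi * (z / n)) / sin (pi * (z / n)))))|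
      <= 14 / alpha / z.
  move=> h; rewrite normrN normrM.
  have := ler_pM (normr_ge0 _) (normr_ge0 _) (T2I_lim b (z0 z h)) (norm_dlog2sin_le (zn z h)).
  move=> /le_trans; apply.
  have zp := z0 z h; case/andP: h => za zA.
  have i1 : z^-1 <= alpha^-1 by rewrite lef_pV2 ?posrE//; lra.
  have i2 : (n - z)^-1 <= alpha^-1 by rewrite lef_pV2 ?posrE//; lra.
  rewrite (_ : 14 / alpha / z = 7 / z * (2 * alpha^-1)); last by ring.
  by rewrite ler_pM2l ?divr_gt0//; lra.
have cmp := der_comparison (ltW alA) d1 d2 d3.
have lnA : ln A - ln alpha <= ln n.
  have : 0 <= ln alpha by rewrite ln_ge0.
  have : ln A <= ln n by rewrite ler_ln ?posrE//; lra.
  lra.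
have lbd z : alpha <= z <= A -> `|(T2I b z - 1 / 2) * log2sin n z| <= 7 / alpha * (2 + 2 * ln n).
  move=> h; rewrite normrM; apply: ler_pM => //.
    apply: le_trans (T2I_lim b (z0 z h)) _; rewrite ler_pM2l// lef_pV2 ?posrE//; first by case/andP: h.
    - exact: z0.
    - lra.
  apply: le_trans (norm_log2sin_scaled_le (zn z h)) _; rewrite /log_env.
  have zp := z0 z h; case/andP: h => za zA.
  have e1 : ln (z / n) = ln z - ln n by rewrite ln_div.
  have e2 : ln (1 - z / n) = ln (n - z) - ln n.
    by rewrite (_ : 1 - z / n = (n - z) / n) ?ln_div ?posrE//; [lra|field; rewrite gt_eqF].
  have : 0 <= ln z by rewrite ln_ge0; lra.
  have : 0 <= ln (n - z) by rewrite ln_ge0; lra.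
  have : ln 2 < 2 :> R by exact: ln_sublinear.
  rewrite e1 e2; lra.
have := lbd _ lb; have := lbd _ ub; move: cmp.
rewrite -mulrBr.
have : 14 / alpha * (ln A - ln alpha) <= 14 / alpha * ln n.
  by rewrite ler_wpM2l// divr_ge0//; lra.
have -> : 42 * (ln n + 1) / alpha = 14 / alpha * ln n + 7 / alpha * (2 + 2 * ln n) + 7 / alpha * (2 + 2 * ln n) + 14 / alpha.
  by field; rewrite gt_eqF//; lra.
have : 0 < 14 / alpha by rewrite divr_gt0//; lra.
set X := (T2I b A - 1 / 2) * _; set Y := (T2I b alpha - 1 / 2) * _.
rewrite !ler_norml => ? ? /andP[? ?] /andP[? ?] /andP[? ?]; apply/andP; split; lra.
Qed.

End LogAverages.

(** * The choice of the scale [alpha] *)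

Section WindowScale.
Context {R : realType}.

Lemma powR8 (x : R) : 1 <= x -> (x `^ 8^-1) ^+ 8 = x.
Proof.
move=> x1; rewrite -powR_mulrn ?powR_ge0// -powRrM mulVf// powRr1//; lra.
Qed.

Lemma cvg_powR8 : (n%:R : R) `^ 8^-1 @[n --> \oo] --> +oo.
Proof.
apply/cvgryPge => A; near=> n.
have n1 : 1 <= n%:R :> R by rewrite ler1n; near: n; exact: nbhs_infty_gt.
have nA : `|A| ^+ 8 <= n%:R by near: n; exact: nbhs_infty_ger.
apply: le_trans (ler_norm A) _.
by rewrite -(@ler_pXn2r _ 8)// ?nnegrE ?powR_ge0// powR8.
Unshelve. all: by end_near. Qed.

Lemma ln_le_powR8 (x : R) : 1 <= x -> ln x <= 8 * x `^ 8^-1.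
Proof.
move=> x1; have x0 : 0 < x by lra.
have p0 : 0 < x `^ 8^-1 by rewrite powR_gt0.
have := ln_sublinear p0; rewrite ln_powR; lra.
Qed.

Lemma powR4E (x : R) : 1 <= x -> x `^ 4^-1 = (x `^ 8^-1) ^+ 2.
Proof.
by move=> x1; rewrite -powR_mulrn ?powR_ge0// -powRrM; congr (_ `^ _); field.
Qed.

Lemma powR38E (x : R) : 1 <= x -> x `^ (2^-1 - 8^-1) = (x `^ 8^-1) ^+ 3.
Proof.
by move=> x1; rewrite -powR_mulrn ?powR_ge0// -powRrM; congr (_ `^ _); field.
Qed.

Lemma eventually_powR8_ge (e : R) : 0 < e ->
  \forall n \near \oo, 1 <= n%:R :> R /\ e^-1 <= (n%:R : R) `^ 8^-1.
Proof.
move=> e0; near=> n; split.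
  by rewrite ler1n; near: n; exact: nbhs_infty_gt.
by near: n; move/cvgryPge : cvg_powR8; apply.
Unshelve. all: by end_near. Qed.

Lemma window_scale b : exists (eps : R) (alpha : nat -> R),
  [/\ 0 < eps,
      (fun N : nat => ln N%:R : R^o) =o_\oo (alpha : nat -> R^o),
      (alpha : nat -> R^o) =o_\oo (fun N : nat => N%:R `^ (2^-1 - eps) : R^o),
      forall eta : R, 0 < eta ->
        \forall N \near \oo,
          forall A : R, alpha N <= A <= N%:R - alpha N ->
            (`| \int[lebesgue_measure]_(v in `[alpha N, A])
                  (T2 b v * ln `|2 * sin (pi * v / N%:R)|)%:E |
             <= eta%:E)%E
    & (fun N : nat =>
         1 - \int[lebesgue_measure]_(v in `[- alpha N, alpha N]) T2 b v : R^o)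
      =o_\oo (fun N : nat => (ln N%:R)^-1 : R^o)].
Proof.
(* With [q] the eighth root of [N], the scale is [q ^+ 2], the power that has to dominate it is
   [q ^+ 3], and [ln N <= 8 * q]: all the conditions compare powers of [q]. *)
exists 8^-1, (fun N => N%:R `^ 4^-1).
split; first by rewrite invr_gt0.
- apply/eqoP => e e0; have e8 : 0 < e / 8 by rewrite divr_gt0.
  have := eventually_powR8_ge e8; apply: filterS => n [n1 pe].
  have p0 : 0 < (n%:R : R) `^ 8^-1 by rewrite powR_gt0; lra.
  rewrite powR4E// (ger0_norm (ln_ge0 n1)) ger0_norm ?sqr_ge0//.
  apply: le_trans (ln_le_powR8 n1) _; rewrite expr2 mulrA ler_pM2r//.
  move: pe; rewrite invf_div ler_pdivrMr// mulrC //.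
- apply/eqoP => e e0.
  have := eventually_powR8_ge e0; apply: filterS => n [n1 pe].
  have p0 : 0 < (n%:R : R) `^ 8^-1 by rewrite powR_gt0; lra.
  rewrite powR4E// powR38E// !ger0_norm ?exprn_ge0 ?(ltW p0)//.
  rewrite (_ : e * _ ^+ 3 = (n%:R `^ 8^-1) ^+ 2 * (e * n%:R `^ 8^-1)); last by ring.
  by rewrite ler_peMr ?exprn_ge0 ?(ltW p0)// -ler_pdivrMl// mulr1.
(* As [42 * (8 * q + 1) <= 400 * q] for [q >= 1], it suffices that [400 <= eta * q]. *)
- move=> eta eta0; have e1 : 0 < eta / 400 by rewrite divr_gt0 ?ltr0n.
  have := eventually_powR8_ge e1; apply: filterS => n [n1 pe] A /andP[aA An].
  have n0 : 0 < n%:R :> R by lra.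
  have p0 : 0 < (n%:R : R) `^ 8^-1 by rewrite powR_gt0.
  have p1 : 1 <= (n%:R : R) `^ 8^-1 by rewrite -[X in X <= _](powRr0 n%:R) ler_powR// invr_ge0.
  have a1 : 1 <= (n%:R : R) `^ 4^-1 by rewrite -[X in X <= _](powRr0 n%:R) ler_powR// invr_ge0.
  move: aA; rewrite le_eqVlt => /predU1P[<-|aA].
    by rewrite set_itv1 integral_set1 abse0 lee_fin ltW.
  have eqf v : v \in `[n%:R `^ 4^-1, A] -> T2 b v * ln `|2 * sin (pi * v / n%:R)| = T2 b v * log2sin n%:R v.
    rewrite in_itv/= => /andP[v1 v2]; rewrite /log2sin -mulrA gtr0_norm// mulr_gt0// sin_pi_gt0//.
    by apply: unit_scaled; apply/andP; split; lra.
  have -> : (\int[lebesgue_measure]_(v in `[(n%:R `^ 4^-1)%R, A]) (T2 b v * ln `|2 * sin (pi * v / n%:R)|)%:E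
     = \int[lebesgue_measure]_(v in `[(n%:R `^ 4^-1)%R, A]) (T2 b v * log2sin n%:R v)%:E)%E.
    by apply: eq_integral => v; rewrite inE => /= hv; rewrite eqf.
  have cT z : 0 < z < n%:R -> {for z, continuous (@T2 R b)}.
    by move=> /andP[? _]; exact: T2_continuous.
  have inti := integrable_log2sin_mul n0 (ler0n _ 41) cT (fun v _ => norm_T2_le b v).
  have intS : (@lebesgue_measure R).-integrable `[n%:R `^ 4^-1, A] (EFin \o (fun v => T2 b v * log2sin n%:R v)).
    by apply: integrableS inti => //; apply: subset_itv; rewrite bnd_simp; lra.
  have := T2_log2sin_window b a1 aA An.
  rewrite -lee_fin EFin_normr_Rintegral//= => /le_trans; apply.
  rewrite lee_fin ler_pdivrMr//; last by rewrite powR_gt0.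
  rewrite powR4E//; have := ln_le_powR8 n1.
  have : 400 * (n%:R `^ 8^-1) <= eta * (n%:R `^ 8^-1) ^+ 2.
    rewrite expr2 mulrA ler_pM2r//.
    by move: pe; rewrite invf_div ler_pdivrMr// mulrC.
  lra.
(* The product of [14 / q ^+ 2] and [8 * q] is [112 / q], which is below [e] once [200 <= e * q]. *)
- apply/eqoP => e e0; have e1 : 0 < e / 200 by rewrite divr_gt0 ?ltr0n.
  have := eventually_powR8_ge e1; have := nbhs_infty_gt 1.
  apply: filterS2 => n n2 [n1 pe].
  have n0 : 0 < n%:R :> R by lra.
  have a0 : 0 < (n%:R : R) `^ 4^-1 by rewrite powR_gt0.
  have p0 : 0 < (n%:R : R) `^ 8^-1 by rewrite powR_gt0.
  have l0 : 0 < ln n%:R :> R by rewrite ln_gt0// ltr1n.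
  rewrite T2_symmetric_integral// normfV (gtr0_norm l0) ler_pdivlMr//.
  rewrite (_ : 1 - 2 * _ = - (2 * (T2I b (n%:R `^ 4^-1) - 1 / 2))); last by field.
  rewrite normrN normrM (ger0_norm (ler0n R 2)).
  have h1 : 2 * `|T2I b ((n%:R : R) `^ 4^-1) - 1 / 2| <= 14 / n%:R `^ 4^-1.
    have := T2I_lim b a0; rewrite !ler_pdivlMr//; lra.
  apply: le_trans (ler_pM _ (ltW l0) h1 (ln_le_powR8 n1)) _; first by rewrite mulr_ge0.
  rewrite powR4E//; move: ((n%:R : R) `^ 8^-1) p0 pe => q q0.
  rewrite invf_div ler_pdivrMr// => pe.
  rewrite (_ : 14 / q ^+ 2 * (8 * q) = 112 / q); last by field; rewrite gt_eqF.
  rewrite ler_pdivrMr// (mulrC e); move: pe; move: (q * (e : R)) => ?; lra.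
Qed.

End WindowScale.

(** * The limit of the logarithmic average of [T2] with the weight [1 - v / n] *)

Section ClusterLogLimit.
Context {R : realType}.
Implicit Types (b : dyson_index) (n s t u v x y : R).
Local Notation mu := (@lebesgue_measure R).

(** The error made when the weight [(1 - s) * ln (2 * sin (pi * s))] is replaced with
    [ln (2 * pi * s)]. It tends to 0 at 0 and to [- ln (2 * pi)] at 1. *)
Let phi s : R := (1 - s) * ln (2 * sin (pi * s)) - ln (2 * pi * s).
Let dphi s : R := - ln (2 * sin (pi * s)) + ((1 - s) * (pi * (cos (pi * s) / sin (pi * s))) - s^-1).
Let henv s : R := log_env s + 9.
Let Henv s : R := log_envI s + 9 * s.

Let der_phi s : 0 < s < 1 -> der phi s (dphi s).
Proof.
move=> h; have s0 : 0 < s by case/andP: h.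
have pi0 := @pi_gt0 R.
have d1 := der_log2sin h.
have d2 : der (fun s => ln (2 * pi * s)) s s^-1.
  by der_auto; [rewrite !mulr_gt0|pi_field; rewrite !gt_eqF].
apply: der_eq; first exact: (derB (derM (derB (der_cst 1 s) (der_id s)) d1) d2).
by cbv beta; rewrite /dphi; ring.
Qed.

(** At 0 the cotangent and [s^-1] cancel; at 1 the factor [1 - s] tames the cotangent. As [pi <= 4],
    for [s <= 1 / 2] the second summand of [dphi] is at least [- 1 - 16 * s >= - 9], hence the
    constant in [henv]. *)
Let norm_dphi_le s : 0 < s < 1 -> `|dphi s| <= henv s.
Proof.
move=> h; rewrite /dphi /henv; apply: le_trans (ler_normD _ _) _; rewrite normrN.
apply: lerD; first exact: norm_log2sin_le.
have pi0 := @pi_gt0 R; have pi4 : pi <= 4 :> R by have := @pihalf_lt2 R; lra.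
have half (r : R) : 0 < r <= 1 / 2 -> 1 - 16 * r * r <= r * (pi * (cos (pi * r) / sin (pi * r))) <= 1.
  move=> /andP[r0 r1].
  have th : 0 < pi * r <= pi / 2 by rewrite mulr_gt0//= ler_pM2l//; lra.
  have /andP[c1 c2] := cot_sub_inv th.
  have e : r * pi * (pi * r)^-1 = 1 by pi_field; rewrite !gt_eqF.
  have rp : 0 < r * pi by rewrite mulr_gt0.
  have := ler_wpM2l (ltW rp) c1; have := ler_wpM2l (ltW rp) c2.
  rewrite mulrBr e mulr0 => ? h2.
  have : r * pi * (pi * r) <= 16 * r * r.
    rewrite (_ : r * pi * (pi * r) = (pi * pi) * (r * r)); last by ring.
    rewrite -[leRHS]mulrA ler_wpM2r ?mulr_ge0 ?(ltW r0)//.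
    rewrite (_ : 16 = 4 * 4); last by ring.
    by rewrite ler_pM// ltW.
  rewrite mulrA; move: h2; rewrite mulrN => ? ?; apply/andP; split; lra.
have /andP[s0 s1] := h.
have [s2|s2] := leP s (1 / 2).
  have /half /andP[c1 c2] : 0 < s <= 1 / 2 by rewrite s0.
  set c := pi * _ in c1 c2 *.
  have si : 0 < s^-1 by rewrite invr_gt0.
  have e1 : s^-1 * s = 1 by rewrite mulVf// gt_eqF.
  have b1 : s^-1 - 16 * s <= c.
    have := ler_wpM2l (ltW si) c1; rewrite mulrA e1 mul1r; apply: le_trans.
    by rewrite (_ : s^-1 * (1 - 16 * s * s) = s^-1 - 16 * s)//; field; rewrite gt_eqF.
  have b2 : c <= s^-1 by have := ler_wpM2l (ltW si) c2; rewrite mulrA e1 mul1r mulr1.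
  have s1' : 0 <= 1 - s by lra.
  have := ler_wpM2l s1' b1; have := ler_wpM2l s1' b2.
  rewrite (_ : (1 - s) / s = s^-1 - 1); last by field; rewrite gt_eqF.
  rewrite (_ : (1 - s) * (s^-1 - 16 * s) = s^-1 - 1 - 16 * s + 16 * (s * s)); last by field; rewrite gt_eqF.
  have : 0 <= s * s by rewrite mulr_ge0// ltW.
  rewrite ler_norml => ? ? ?; apply/andP; split; lra.
have /half /andP[c1 c2] : 0 < 1 - s <= 1 / 2 by apply/andP; split; lra.
have e1 : cos (pi * (1 - s)) = - cos (pi * s).
  by rewrite mulrBr mulr1 cosB cospi sinpi; ring.
have e2 : sin (pi * (1 - s)) = sin (pi * s).
  by rewrite mulrBr mulr1 sinB cospi sinpi; ring.
move: c1 c2; rewrite e1 e2 mulNr !mulrN.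
set c := (1 - s) * _ => c1 c2.
have : (1 - s) * (1 - s) <= 1 / 2 * (1 / 2) by rewrite ler_pM//; lra.
have i1 : s^-1 <= 2 by rewrite -[leRHS]invrK lef_pV2 ?posrE//; lra.
have i0 : 0 < s^-1 by rewrite invr_gt0.
rewrite ler_norml => ?; apply/andP; split; lra.
Qed.

Let cvg_norm_xlnx : `|x * ln x| @[x --> (0 : R)^'+] --> (0 : R).
Proof. by rewrite -[X in _ --> X](normr0 R); apply: cvg_norm; exact: cvg_xlnx. Qed.

Let cvg_phi_right0 : phi x @[x --> 0^'+] --> (0 : R).
Proof.
have pi0 := @pi_gt0 R; have pi4 : pi <= 4 :> R by have := @pihalf_lt2 R; lra.
apply: (@cvg_right_squeeze _ phi (fun s => `|s * ln s| + (`|ln (2 * pi)| + 16) * s) 0 2^-1 0).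
- by rewrite invr_gt0.
- move=> s /andP[s0 s1]; rewrite subr0.
  have h : 0 < s < 1 by rewrite s0; lra.
  have p := sin_pi_gt0 h.
  have th : 0 < pi * s <= pi / 2 by rewrite mulr_gt0//= ler_pM2l// ltW.
  have /andP[l1 l2] := ln_sinc_ge th.
  have e1 : ln (2 * sin (pi * s)) = ln (2 * pi) + ln s + ln (sin (pi * s) / (pi * s)).
    rewrite -[X in X + _]lnM ?posrE ?mulr_gt0// -lnM ?posrE ?mulr_gt0 ?invr_gt0 ?mulr_gt0//.
    by congr ln; pi_field; rewrite !gt_eqF.
  have e2 : ln (2 * pi * s) = ln (2 * pi) + ln s by rewrite lnM ?posrE ?mulr_gt0.
  set q := ln (sin (pi * s) / (pi * s)) in l1 l2 e1.
  rewrite /phi e1 e2.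
  rewrite (_ : _ - _ = - (s * ln s) - s * ln (2 * pi) + (1 - s) * q); last by ring.
  apply: le_trans (ler_normD _ _) _.
  rewrite [X in _ + X]normrM.
  have q1 : `|q| <= (pi * s) ^+ 2 by rewrite ler0_norm//; lra.
  have q2 : (pi * s) ^+ 2 <= 16 * s.
    rewrite (_ : (pi * s) ^+ 2 = (pi * pi) * s * s); last by ring.
    apply: le_trans (_ : (4 * 4) * s * s <= _).
      by rewrite !ler_wpM2r ?ler_pM// ltW.
    have : s * s <= s * 1 by rewrite ler_wpM2l//; lra.
    lra.
  have q3 : `|1 - s| * `|q| <= 1 * (16 * s).
    rewrite ler_pM//; last by exact: le_trans q1 q2.
    by rewrite ger0_norm; lra.
  have := ler_normB (- (s * ln s)) (s * ln (2 * pi)).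
  rewrite normrN (normrM s (ln (2 * pi))) (gtr0_norm s0); lra.
- by apply: cvg0D; [exact: cvg_norm_xlnx|apply: cvg0Z; exact: cvg_at_right_filter cvg_id].
Qed.

Let cvg_phi_left1 : phi x @[x --> 1^'-] --> - ln (2 * pi : R).
Proof.
have pi0 := @pi_gt0 R.
rewrite (_ : phi = fun x => phi (1 - (1 - x))); last by apply/funext => x; rewrite opprB addrC subrK.
apply: (@cvg_left1_onem R (fun r => phi (1 - r))).
rewrite (_ : (fun r => phi (1 - r)) = fun r => r * ln (2 * sin (pi * r)) - ln (2 * pi * (1 - r))); last first.
  apply/funext => r; rewrite /phi (_ : 1 - (1 - r) = r); last by ring.
  congr (_ * ln (2 * _) - _).
  by rewrite mulrBr mulr1 sinB cospi sinpi; ring.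
rewrite -[X in _ --> X]add0r; apply: cvgB.
  apply: (@cvg_right_squeeze _ _ (fun s => `|s * ln s| + 4 * s) 0 2^-1 0).
  - by rewrite invr_gt0.
  - move=> s /andP[s0 s1]; rewrite subr0 normrM (gtr0_norm s0).
    have h : 0 < s < 1 by rewrite s0; lra.
    have := norm_log2sin_le h; rewrite -(ler_pM2l s0) /log_env => /le_trans; apply.
    have l2 : ln 2 < 2 :> R by exact: ln_sublinear.
    have l3 : ln (2^-1) <= ln (1 - s) by rewrite ler_ln ?posrE ?invr_gt0//; lra.
    have : s * (- ln (1 - s)) <= s * 2 by rewrite ler_pM2l//; move: l3; rewrite lnV ?posrE//; lra.
    have : s * ln 2 <= s * 2 by rewrite ler_pM2l// ltW.
    have := ler_norm (- (s * ln s)); rewrite normrN; lra.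
  - by apply: cvg0D; [exact: cvg_norm_xlnx|apply: cvg0Z; exact: cvg_at_right_filter cvg_id].
have d : der (fun r : R => ln (2 * pi * (1 - r))) 0 (- 1).
  by der_auto; rewrite subr0 ?mulr1; [rewrite mulr_gt0|pi_field; rewrite gt_eqF].
by have := der_cvg_right d; rewrite subr0 mulr1.
Qed.

Let der_Henv s : 0 < s < 1 -> der Henv s (henv s).
Proof.
move=> /der_log_envI d; apply: der_eq; first exact: (derD d (derM (der_cst 9 s) (der_id s))).
by cbv beta; rewrite /henv; ring.
Qed.

Let cvg_Henv_right0 : Henv x @[x --> 0^'+] --> (- 1 : R).
Proof.
rewrite (_ : Henv = fun s => (s * ln 2 + s + 9 * s) - s * ln s - ((1 - s) - (1 - s) * ln (1 - s))); last first.
  by apply/funext => s; rewrite /Henv /log_envI; ring.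
rewrite (_ : - 1 = 0 - 0 - 1 :> R); last by ring.
apply: cvgB; first apply: cvgB; last 2 first.
- exact: cvg_xlnx.
- have d : der (fun s : R => (1 - s) - (1 - s) * ln (1 - s)) 0 0.
    by der_auto; [lra|rewrite subr0 ln1; field].
  by have := der_cvg_right d; rewrite subr0 ln1 mulr0 subr0.
have d : der (fun s : R => s * ln 2 + s + 9 * s) 0 (ln 2 + 10) by der_auto; ring.
by have := der_cvg_right d; rewrite !(mul0r, mulr0, addr0).
Qed.

Let cvg_Henv_left1 : Henv x @[x --> 1^'-] --> (ln 2 + 10 : R).
Proof.
rewrite (_ : Henv = fun s => (s * ln 2 + (s - s * ln s) - (1 - s) + 9 * s) + (1 - s) * ln (1 - s)); last first.
  by apply/funext => s; rewrite /Henv /log_envI; ring.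
rewrite -[X in _ --> X]addr0; apply: cvgD; last first.
  exact: (@cvg_left1_onem R (fun r => r * ln r) 0 cvg_xlnx).
have d : der (fun s : R => s * ln 2 + (s - s * ln s) - (1 - s) + 9 * s) 1 (ln 2 + 10).
  by der_auto => //; rewrite ln1; field.
have := der_cvg_left d; rewrite ln1; congr (_ --> _); ring.
Qed.

Let norm_T2I_sub_le b v : 0 < v -> `|T2I b v - 1 / 2| <= 42.
Proof.
move=> v0; have [v1|v1] := leP v 1; last first.
  apply: le_trans (T2I_lim b v0) _; rewrite ler_pdivrMr//; lra.
have d1 z : 0 < z <= v -> der (T2I b) z (T2 b z) by move=> /andP[? _]; exact: der_T2I.
have d2 z : 0 < z <= v -> der (fun z => 41 * z) z 41 by move=> _; der_auto; ring.
have := der_comparison_right v0 d1 d2 (fun z _ => norm_T2_le b z) (cvg_T2I_right0 b).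
have h : 41 * x @[x --> (0 : R)^'+] --> (0 : R) by apply: cvg0Z; exact: cvg_at_right_filter cvg_id.
move=> /(_ _ h); rewrite !subr0 ler_norml => /andP[? ?].
by rewrite ler_norml; apply/andP; split; lra.
Qed.

(** Its derivative is [T2] with the true weight, plus an error in which [T2] enters only through
    [T2I - 1 / 2]. *)
Let V b n v := T2I b v * ln (2 * pi / n) + T2logI b v + phi (v / n) * (T2I b v - 1 / 2).

Let der_V b n v : 0 < v < n ->
  der (V b n) v (T2 b v * ((1 - v / n) * log2sin n v) + dphi (v / n) / n * (T2I b v - 1 / 2)).
Proof.
move=> h; have /andP[v0 vn] := h; have n0 : 0 < n by exact: lt_trans vn.
have s01 := unit_scaled h; have pi0 := @pi_gt0 R.
have e : der (fun v => v / n) v n^-1 by der_auto; ring.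
have d1 := der_comp e (der_phi s01); have d2 := der_T2I b v0; have d3 := der_T2logI b v0.
apply: der_eq.
  exact: (derD (derD (derM d2 (der_cst (ln (2 * pi / n)) v)) d3)
    (derM d1 (derB d2 (der_cst (1 / 2) v)))).
have l1 : ln (2 * pi * (v / n)) = ln (2 * pi / n) + ln v.
  rewrite -lnM ?posrE ?mulr_gt0 ?invr_gt0//; congr ln; ring.
cbv beta; rewrite {1}/phi l1 /log2sin; ring.
Qed.

Lemma cvg_comp_div_right0 F (l n : R) : 0 < n -> F x @[x --> 0^'+] --> l ->
  F (x / n) @[x --> 0^'+] --> l.
Proof.
move=> n0 Fl; rewrite (_ : (fun x => F (x / n)) = fun x => F (n^-1 * x)).
  by apply: cvg_right0_scale; rewrite ?invr_gt0.
by apply/funext => x; rewrite mulrC.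
Qed.

Lemma cvg_comp_div_left F (l n : R) : 0 < n -> F x @[x --> 1^'-] --> l ->
  F (x / n) @[x --> n^'-] --> l.
Proof.
move=> n0 Fl; apply/cvgrPdist_le => e e0.
move/cvgrPdist_le : Fl => /(_ e e0) [d /= d0 hd].
exists (d * n) => /=; first by rewrite mulr_gt0.
move=> x /= xd xn; apply: hd; last by rewrite /= ltr_pdivrMr// mul1r.
rewrite /= (_ : 1 - x / n = (n - x) / n); last by field; rewrite gt_eqF.
by rewrite normrM (gtr0_norm (_ : 0 < n^-1)) ?invr_gt0// ltr_pdivrMr.
Qed.

(** The interval is cut at [m = Num.sqrt n]. Below [m], [|T2I - 1 / 2| <= 42] and the integral of
    [henv] over [[0, m^-1]], that is [Henv m^-1 + 1], is small. Above [m], [|T2I - 1 / 2| <= 7 / m]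
    and the integral of [henv] is at most 32. *)
Lemma cluster_log_error b n : 1 < n ->
  `|\int[mu]_(v in `[0, n]) ((1 - v / n) * T2 b v * log2sin n v)
    - (T2I b n * ln (2 * pi / n) + T2logI b n - ln (2 * pi) * (T2I b n - 1 / 2))|
  <= 42 * (Henv (Num.sqrt n)^-1 + 1) + 7 * 32 * (Num.sqrt n)^-1.
Proof.
move=> n1; have n0 : 0 < n by lra.
pose g v := (1 - v / n) * T2 b v.
have cg v : 0 < v < n -> {for v, continuous g}.
  move=> /andP[v0 _]; apply: continuousM; last exact: T2_continuous.
  have e : der (fun v => 1 - v / n) v (- n^-1) by der_auto; ring.
  exact: der_continuous e.
have g41 v : 0 < v < n -> `|g v| <= 41.
  move=> /unit_scaled /andP[s0 s1]; rewrite normrM -[leRHS]mul1r ler_pM ?norm_T2_le//.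
  by rewrite ger0_norm; lra.
have ing := integrable_log2sin_mul n0 (ler0n _ 41) cg g41.
have cgl z : 0 < z < n -> {for z, continuous (fun v => g v * log2sin n v)}.
  move=> h; apply: continuousM; first exact: cg.
  exact: der_continuous (der_log2sin_scaled h).
have [U [dU U0 Un]] := integrable_primitive n0 ing cgl.
have V0 : V b n x @[x --> 0^'+] --> 0.
  rewrite [X in _ --> X](_ : 0 = 0 * ln (2 * pi / n) + 0 + 0 * (0 - 1 / 2) :> R); last by ring.
  apply: cvgD; first apply: cvgD.
  - by apply: cvgM; [exact: cvg_T2I_right0|exact: cvg_cst].
  - exact: cvg_T2logI_right0.
  apply: cvgM; first exact: cvg_comp_div_right0 cvg_phi_right0.
  by apply: cvgB; [exact: cvg_T2I_right0|exact: cvg_cst].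
have Vn : V b n x @[x --> n^'-] -->
    T2I b n * ln (2 * pi / n) + T2logI b n - ln (2 * pi) * (T2I b n - 1 / 2).
  rewrite -mulNr; apply: cvgD; first apply: cvgD.
  - by apply: cvgM; [exact: der_cvg_left (der_T2I b n0)|exact: cvg_cst].
  - exact: der_cvg_left (der_T2logI b n0).
  apply: cvgM; first exact: cvg_comp_div_left cvg_phi_left1.
  by apply: cvgB; [exact: der_cvg_left (der_T2I b n0)|exact: cvg_cst].
have dD z : 0 < z < n ->
    der (fun v => U v - V b n v) z (- (dphi (z / n) / n * (T2I b z - 1 / 2))).
  move=> h; apply: der_eq; first exact: (derB (dU z h) (der_V b h)).
  by rewrite /g; ring.
have dH z : 0 < z < n -> der (fun v => Henv (v / n)) z (henv (z / n) / n).
  move=> h; have e : der (fun v => v / n) z n^-1 by der_auto; ring.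
  by apply: der_eq; [exact: (der_comp e (der_Henv (unit_scaled h)))|].
have bD C z : 0 < z < n -> `|T2I b z - 1 / 2| <= C ->
    `|- (dphi (z / n) / n * (T2I b z - 1 / 2))| <= C * (henv (z / n) / n).
  move=> h hC; rewrite normrN normrM mulrC ler_pM// normrM.
  rewrite (gtr0_norm (_ : 0 < n^-1)) ?invr_gt0// ler_pM2r ?invr_gt0//.
  exact/norm_dphi_le/unit_scaled.
pose m := Num.sqrt n; have m0 : 0 < m by rewrite sqrtr_gt0.
have mm : m * m = n by rewrite -expr2 sqr_sqrtr// ltW.
have m1 : 1 < m by rewrite -[X in X < _]sqrtr1 ltr_sqrt.
have mn : m < n by rewrite -mm ltr_pMr.
have mdn : m / n = m^-1 by rewrite -mm invfM mulVKf// gt_eqF.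
have dCH C z : 0 < z < n -> der (fun v => C * Henv (v / n)) z (C * (henv (z / n) / n)).
  move=> h; apply: der_eq; first exact: (derM (der_cst C z) (dH z h)).
  by cbv beta; ring.
have hm : 0 < m < n by rewrite m0.
have c1 : `|(U m - V b n m) - (0 - 0)| <= 42 * Henv (m / n) - 42 * (- 1).
  apply: (@der_comparison_right R (fun v => U v - V b n v)
    (fun z => - (dphi (z / n) / n * (T2I b z - 1 / 2)))
    (fun v => 42 * Henv (v / n)) (fun z => 42 * (henv (z / n) / n)) 0 m _ _ m0).
  - by move=> z /andP[z0 zm]; apply: dD; rewrite z0 (le_lt_trans zm).
  - by move=> z /andP[z0 zm]; apply: dCH; rewrite z0 (le_lt_trans zm).
  - move=> z /andP[z0 zm]; apply: bD; first by rewrite z0 (le_lt_trans zm).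
    exact: norm_T2I_sub_le.
  - exact: cvgB.
  - by apply: cvgM; [exact: cvg_cst|exact: cvg_comp_div_right0 cvg_Henv_right0].
have c2 : `|((\int[mu]_(v in `[0, n]) ((1 - v / n) * T2 b v * log2sin n v)) - (T2I b n * ln (2 * pi / n) + T2logI b n - ln (2 * pi) * (T2I b n - 1 / 2)))
    - (U m - V b n m)| <= 7 / m * (ln 2 + 10) - 7 / m * Henv (m / n).
  apply: (@der_comparison_oo R (fun v => U v - V b n v)
    (fun z => - (dphi (z / n) / n * (T2I b z - 1 / 2)))
    (fun v => 7 / m * Henv (v / n)) (fun z => 7 / m * (henv (z / n) / n)) m n _ _ _ _ mn).
  - by move=> z /andP[z0 zm]; apply: dD; rewrite zm (lt_trans m0).
  - by move=> z /andP[z0 zm]; apply: dCH; rewrite zm (lt_trans m0).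
  - move=> z /andP[mz zn]; have z0 : 0 < z by exact: lt_trans mz.
    apply: bD; first by rewrite z0.
    apply: le_trans (T2I_lim b z0) _.
    by rewrite ler_pM2l// lef_pV2 ?posrE// ltW.
  - exact: der_cvg_right (dD m hm).
  - exact: der_cvg_right (dCH (7 / m) m hm).
  - exact: cvgB.
  - by apply: cvgM; [exact: cvg_cst|exact: cvg_comp_div_left cvg_Henv_left1].
rewrite -/m; move: c1 c2; rewrite mdn.
have s01 : 0 < m^-1 < 1 by rewrite -mdn unit_scaled.
have h1 : `|Henv m^-1| <= 16.
  apply: le_trans (ler_normD _ _) _; have /andP[s0 s1] := s01.
  have := norm_log_envI_le s01; rewrite (gtr0_norm (_ : 0 < 9 * m^-1)) ?mulr_gt0//; lra.
have l2 : ln 2 < 2 :> R by exact: ln_sublinear.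
have : 7 * m^-1 * (ln 2 + 10 - Henv m^-1) <= 7 * m^-1 * 32.
  rewrite ler_pM2l ?mulr_gt0 ?invr_gt0//; move: h1; rewrite ler_norml; lra.
move: (Henv m^-1) h1 => H _.
set X := U m - _; set Y := _ - (_ + _ - _).
rewrite subrr subr0 mulrBr !ler_norml => h3 /andP[? ?] /andP[? ?].
apply/andP; split; lra.
Qed.

Let cvg_sqrt_pinfty : Num.sqrt x @[x --> (+oo : set_system R)] --> +oo.
Proof.
apply/cvgryPge => A; near=> x.
apply: le_trans (ler_norm A) _.
by rewrite -sqrtr_sqr ler_wsqrtr.
Unshelve. all: by end_near. Qed.

(** With the main terms of [cluster_log_error], the expression is [ln n * (1 - 2 * T2I b n) + 2 *
    T2logI b n + ln (2 * pi)] up to [2 * err n]. The first term tends to 0 by [T2I_lim], and the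
    limit of [T2logI] gives the constant. *)
Lemma cluster_log_lim b :
  ln n%:R + 2 * \int[mu]_(v in `[0, n%:R]) ((1 - v / n%:R) * T2 b v * log2sin n%:R v)
    @[n --> \oo] --> limit_mean_W b.
Proof.
have pi0 := @pi_gt0 R.
pose q (x : R) := ln x * (1 - 2 * T2I b x) + 2 * T2logI b x + ln (2 * pi).
have q1 : q x @[x --> +oo] --> limit_mean_W b.
  rewrite (_ : limit_mean_W b = 0 + 2 * ((limit_mean_W b - ln (2 * pi)) / 2) + ln (2 * pi)); last by field.
  apply: cvgD; last exact: cvg_cst.
  apply: cvgD; last by apply: cvgM; [exact: cvg_cst|exact: cvg_T2logI_pinfty].
  apply: (@cvg_pinfty_squeeze _ _ (fun x => 14 * ((ln x + 0) / x))).
    move=> x x1; have x0 : 0 < x by lra.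
    have lx : 0 <= ln x by rewrite ln_ge0.
    rewrite subr0 normrM (ger0_norm lx) addr0.
    rewrite (_ : 1 - 2 * T2I b x = - (2 * (T2I b x - 1 / 2))); last by field.
    rewrite normrN normrM (ger0_norm (ler0n R 2)).
    have := ler_wpM2l lx (T2I_lim b x0).
    rewrite (_ : 14 * (ln x / x) = 2 * (ln x * (7 / x))); last by ring.
    rewrite (mulrCA (ln x) 2); lra.
  by apply: cvg0Z; exact: cvg_pinfty_lndiv.
pose err (x : R) := 42 * (Henv (Num.sqrt x)^-1 + 1) + 7 * 32 * (Num.sqrt x)^-1.
have sq0 : (Num.sqrt x)^-1 @[x --> +oo] --> (0 : R).
  exact: (cvg_comp _ _ cvg_sqrt_pinfty (@cvg_pinfty_inv R)).
have Hl : Henv (Num.sqrt x)^-1 @[x --> +oo] --> (- 1 : R).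
  apply/cvgrPdist_le => e e0.
  move/cvgrPdist_le : cvg_Henv_right0 => /(_ e e0) [d /= d0 hd].
  move/cvgrPdist_lt : sq0 => /(_ d d0); have := nbhs_pinfty_gt (real0 R).
  apply: filterS2 => x x0 xd; apply: hd => //=.
  by rewrite invr_gt0 sqrtr_gt0.
have err0 : err x @[x --> +oo] --> 0.
  apply: cvg0D; last by apply: cvg0Z.
  apply: cvg0Z; rewrite -(addNr (1 : R)); apply: cvgD Hl _; exact: cvg_cst.
have cn (F : R -> R) (l : R) : F x @[x --> +oo] --> l -> F n%:R @[n --> \oo] --> l.
  by move=> h; apply: (cvg_comp _ _ _ h); exact: cvgr_idn.
rewrite -[X in _ --> X]addr0.
have -> : (fun n : nat => ln n%:R + 2 * \int[mu]_(v in `[0, n%:R]) ((1 - v / n%:R) * T2 b v * log2sin n%:R v))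
   = fun n : nat => q n%:R + (ln n%:R + 2 * \int[mu]_(v in `[0, n%:R]) ((1 - v / n%:R) * T2 b v * log2sin n%:R v) - q n%:R).
  by apply/funext => n; rewrite [RHS]addrCA subrr addr0.
apply: cvgD.
  exact: cn q1.
have e2 : 2 * err n%:R @[n --> \oo] --> (0 : R).
  exact: (cn (fun x => 2 * err x)) (cvg0Z 2 err0).
apply/cvgrPdist_le => e e0; move/cvgrPdist_le : e2 => /(_ e e0).
have := nbhs_infty_gt 1; apply: filterS2 => n n2 he; rewrite sub0r normrN.
have n1 : 1 < n%:R :> R by rewrite ltr1n.
have n0 : 0 < n%:R :> R by lra.
move: he; rewrite sub0r normrN => /(le_trans (ler_norm _)); apply: le_trans.
have := cluster_log_error b n1; rewrite -/(err _).
set I := \int[mu]_(v in _) _.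
have -> : ln (2 * pi / n%:R) = ln (2 * pi) - ln n%:R :> R by rewrite ln_div ?posrE ?mulr_gt0.
rewrite /q; rewrite !ler_norml => /andP[? ?]; apply/andP; split; lra.
Qed.

End ClusterLogLimit.

(** * Integrals of functions of a difference over a square *)

Section SquareDifference.
Context {R : realType}.
Implicit Types (F f g e E : R -> R) (a c l n t u v x y : R).
Local Notation mu := (@lebesgue_measure R).

Lemma cvg_reflect_right F a c l : F z @[z --> (c - a)^'-] --> l ->
  F (c - y) @[y --> a^'+] --> l.
Proof.
move=> Fl; apply/cvgrPdist_le => eps eps0.
move/cvgrPdist_le : Fl => /(_ eps eps0) [d /= d0 hd].
exists d => // y /= yd ya; apply: hd => /=; last lra.
by rewrite (_ : c - a - (c - y) = - (a - y)) ?normrN//; ring.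
Qed.

Lemma cvg_reflect_left F a c l : F z @[z --> (c - a)^'+] --> l ->
  F (c - y) @[y --> a^'-] --> l.
Proof.
move=> Fl; apply/cvgrPdist_le => eps eps0.
move/cvgrPdist_le : Fl => /(_ eps eps0) [d /= d0 hd].
exists d => // y /= yd ya; apply: hd => /=; last lra.
by rewrite (_ : c - a - (c - y) = - (a - y)) ?normrN//; ring.
Qed.

Lemma cvg_translate_right F a c l : F z @[z --> (a - c)^'+] --> l ->
  F (y - c) @[y --> a^'+] --> l.
Proof.
move=> Fl; apply/cvgrPdist_le => eps eps0.
move/cvgrPdist_le : Fl => /(_ eps eps0) [d /= d0 hd].
exists d => // y /= yd ya; apply: hd => /=; last lra.
by rewrite (_ : a - c - (y - c) = a - y)//; ring.
Qed.

Lemma cvg_translate_left F a c l : F z @[z --> (a - c)^'-] --> l ->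
  F (y - c) @[y --> a^'-] --> l.
Proof.
move=> Fl; apply/cvgrPdist_le => eps eps0.
move/cvgrPdist_le : Fl => /(_ eps eps0) [d /= d0 hd].
exists d => // y /= yd ya; apply: hd => /=; last lra.
by rewrite (_ : a - c - (y - c) = a - y)//; ring.
Qed.

Lemma der_reflect F c x d : der F (c - x) d -> der (fun y => F (c - y)) x (- d).
Proof.
move=> dF; have e : der (fun y => c - y) x (- 1) by der_auto; ring.
by apply: der_eq; [exact: (der_comp e dF)|ring].
Qed.

Lemma der_translate F c x d : der F (x - c) d -> der (fun y => F (y - c)) x d.
Proof.
move=> dF; have e : der (fun y => y - c) x 1 by der_auto; ring.
by apply: der_eq; [exact: (der_comp e dF)|ring].
Qed.

Section Difference.
Variables (g e E : R -> R) (K n : R).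
Hypotheses (n0 : 0 < n) (gN : forall v, g (- v) = g v)
  (gc : forall v, 0 < v < n -> {for v, continuous g})
  (dE : forall v, 0 < v < n -> der E v (e v))
  (ge : forall v, 0 < v < n -> `|g v| <= e v)
  (EK : forall v, 0 < v < n -> `|E v| <= K).

Let J x := \int[mu]_(v in `[0, x]) g v.

Let ig : mu.-integrable `[0, n] (EFin \o g).
Proof. exact: dominated_integrable n0 gc dE ge EK. Qed.

Let igx x : 0 <= x <= n -> mu.-integrable `[0, x] (EFin \o g).
Proof.
move=> /andP[x0 xn]; apply: integrableS ig => //.
by apply: subset_itv; rewrite bnd_simp.
Qed.

Let dJ x : 0 < x < n -> der J x (g x).
Proof. by move=> h; apply: (der_Rintegral ig) => //; exact: gc. Qed.

Let J_ends : J x @[x --> 0^'+] --> 0 /\ J x @[x --> n^'-] --> J n.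
Proof.
have [F [dF F0 Fn]] := integrable_primitive n0 ig gc.
have JF x : 0 < x < n -> F x = J x.
  move=> /[dup] h /andP[x0 xn]; rewrite -[LHS]subr0; apply/esym.
  apply: FTC_integrable F0 (der_cvg_left (dF _ h)) => //.
  - by apply: igx; rewrite !ltW.
  - by move=> z /andP[z0 zx]; apply: gc; rewrite z0 (lt_trans zx).
  - by move=> z /andP[z0 zx]; apply: dF; rewrite z0 (lt_trans zx).
split; [apply: cvg_trans F0|apply: cvg_trans Fn]; apply: near_eq_cvg; near=> x;
  by apply: JF; apply/andP; split.
Unshelve. all: by end_near. Qed.

Let Jx x : 0 < x <= n -> J y @[y --> x^'-] --> J x.
Proof.
move=> /andP[x0]; rewrite le_eqVlt => /predU1P[->|xn]; first exact: J_ends.2.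
by apply: der_cvg_left (dJ _); rewrite x0.
Qed.

Let row_left x : 0 <= x <= n ->
  mu.-integrable `[0, x] (EFin \o (fun y => g (x - y))) /\
  \int[mu]_(y in `[0, x]) g (x - y) = J x.
Proof.
move=> /andP[]; rewrite le_eqVlt => /predU1P[<- _|x0 xn].
  rewrite /J set_itv1 !Rintegral_set1; split => //.
  apply/integrableP; split; last by rewrite integral_set1.
  exact: measurable_fun_set1.
rewrite (_ : J x = - 0 - - J x); last by ring.
apply: (@dominated_FTC R _ (fun y => - J (x - y)) (fun y => - E (x - y)) (fun y => e (x - y)) 0 x _ _ K x0).
- move=> z /andP[z0 zx]; apply: (@continuous_comp _ _ _ (fun y => x - y)); last by apply: gc; lra.
  by apply: (der_continuous (a := - 1)); der_auto; ring.
- by move=> z /andP[z0 zx]; have d := der_reflect (dE (_ : 0 < x - z < n)); apply: der_eq; [apply: derN; apply: d; lra|ring].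
- by move=> z /andP[z0 zx]; apply: ge; lra.
- by move=> z /andP[z0 zx]; rewrite normrN; apply: EK; lra.
- by move=> z /andP[z0 zx]; have d := der_reflect (dJ (_ : 0 < x - z < n)); apply: der_eq; [apply: derN; apply: d; lra|ring].
- by apply: cvgN; apply: cvg_reflect_right; rewrite subr0; apply: Jx; rewrite x0.
- by apply: cvgN; apply: cvg_reflect_left; rewrite subrr; exact: J_ends.1.
Qed.

Let row_right x : 0 <= x <= n ->
  mu.-integrable `[x, n] (EFin \o (fun y => g (x - y))) /\
  \int[mu]_(y in `[x, n]) g (x - y) = J (n - x).
Proof.
move=> /andP[x0]; rewrite le_eqVlt => /predU1P[->|xn].
  rewrite /J subrr !set_itv1 !Rintegral_set1; split => //.
  apply/integrableP; split; last by rewrite integral_set1.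
  exact: measurable_fun_set1.
have -> : (fun y => g (x - y)) = (fun y => g (y - x)).
  by apply/funext => y; rewrite -gN opprB.
rewrite (_ : J (n - x) = J (n - x) - 0); last by ring.
apply: (@dominated_FTC R _ (fun y => J (y - x)) (fun y => E (y - x)) (fun y => e (y - x)) x n _ _ K xn).
- move=> z /andP[z0 zx]; apply: (@continuous_comp _ _ _ (fun y => y - x)); last by apply: gc; lra.
  by apply: (der_continuous (a := 1)); der_auto; ring.
- by move=> z /andP[z0 zx]; apply: der_translate; apply: dE; lra.
- by move=> z /andP[z0 zx]; apply: ge; lra.
- by move=> z /andP[z0 zx]; apply: EK; lra.
- by move=> z /andP[z0 zx]; apply: der_translate; apply: dJ; lra.
- by apply: cvg_translate_right; rewrite subrr; exact: J_ends.1.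
- by apply: cvg_translate_left; apply: Jx; lra.
Qed.

Let row x : 0 <= x <= n ->
  (\int[mu]_(y in `[0%R, n]) (g (x - y))%:E = (J x + J (n - x))%:E)%E.
Proof.
move=> h; have [i1 e1] := row_left h; have [i2 e2] := row_right h.
have /andP[x0 xn] := h.
have i12 := integrable_itvU x0 xn i1 i2.
rewrite -[LHS]fineK; last exact: integrable_fin_num.
rewrite -[fine _]/(\int[mu]_(y in `[0, n]) g (x - y)); congr EFin.
rewrite -e1 -e2.
have := @Rintegral_itvB R (fun y => g (x - y)) (BLeft 0) (BRight n) x i12.
rewrite !bnd_simp => /(_ x0 xn) /eqP; rewrite subr_eq => /eqP ->; rewrite addrC; congr (_ + _).
apply: Rintegral_itv_obnd_cbnd.
by apply: integrableS i2 => //; apply: subset_itvr; rewrite bnd_simp.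
Qed.

(** Near 0 the limit of [J] gives the bound 1; from there on, [J] varies by at most an increment of
    [E]. *)
Let norm_J_le x : 0 < x < n -> `|J x| <= 1 + 2 * K.
Proof.
move=> /andP[x0 xn].
have [J0 _] := J_ends; move/cvgrPdist_le : J0 => /(_ 1 ltr01) [d /= d0 hd].
pose y := Num.min (x / 2) (d / 2).
have y0 : 0 < y by rewrite lt_min !divr_gt0.
have yx : y < x by rewrite gt_min; apply/orP; left; lra.
have yd : y < d by rewrite gt_min; apply/orP; right; lra.
have Jy : `|J y| <= 1.
  by have := hd y; rewrite /= !sub0r !normrN gtr0_norm//; apply.
have hyx z : y <= z <= x -> 0 < z < n by move=> /andP[? ?]; apply/andP; split; lra.
have := der_comparison (ltW yx) (fun z h => dJ (hyx z h)) (fun z h => dE (hyx z h)) (fun z h => ge (hyx z h)).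
have := EK (hyx y _); have := EK (hyx x _).
rewrite !lexx (ltW yx) => /(_ isT) + /(_ isT).
move: Jy; rewrite !ler_norml => /andP[? ?] /andP[? ?] /andP[? ?] /andP[? ?].
by apply/andP; split; lra.
Qed.

(** By evenness, the row at [x] integrates to [J x + J (n - x)]. Both sides then equal twice the
    integral [c] of [J]: on the left by reflection, on the right by parts, as [(n - v) * J v + F v]
    is a primitive of [(n - v) * g v]. *)
Lemma integral_square_difference :
  (\int[mu]_x \int[mu]_y ((\1_(`[0%R, n] : set R) x * \1_(`[0%R, n] : set R) y * g (x - y))%R%:E)
   = (2 * \int[mu]_(v in `[0%R, n]) ((n - v) * g v)%R)%:E)%E.
Proof.
have cJ z : 0 < z < n -> {for z, continuous J} by move=> /dJ; exact: der_continuous.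
pose B := 1 + 2 * K.
have B0 : 0 <= B.
  have h : 0 < n / 2 < n by have := n0; rewrite divr_gt0//= ltr_pdivrMr//; lra.
  exact: le_trans (normr_ge0 _) (norm_J_le h).
have dB z : 0 < z < n -> der (fun v => B * v) z B by move=> _; der_auto; ring.
have nB z : 0 < z < n -> `|B * z| <= B * n.
  by move=> /andP[z0 zn]; rewrite normrM (ger0_norm B0) (gtr0_norm z0) ler_wpM2l// ltW.
have [F [c [dF F0 Fn]]] := dominated_primitive n0 cJ dB norm_J_le nB.
have refl z : 0 < z < n -> 0 < n - z < n by move=> /andP[? ?]; apply/andP; split; lra.
have [isum esum] : mu.-integrable `[0, n] (EFin \o (fun x => J x + J (n - x))) /\
    \int[mu]_(x in `[0, n]) (J x + J (n - x)) = (c - 0) - (0 - c).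
  apply: (@dominated_FTC R _ (fun x => F x - F (n - x)) (fun x => 2 * (B * x)) (fun=> 2 * B) 0 n _ _ (2 * (B * n)) n0).
  - move=> z h; apply: continuousD; first exact: cJ.
    exact: der_continuous (der_reflect (dJ (refl z h))).
  - by move=> z h; der_auto; ring.
  - move=> z h; apply: le_trans (ler_normD _ _) _.
    by have := norm_J_le h; have := norm_J_le (refl z h); rewrite -/B; lra.
  - by move=> z h; rewrite normrM (ger0_norm (ler0n _ 2)) ler_pM2l// nB.
  - move=> z h; apply: der_eq; first exact: (derB (dF z h) (der_reflect (dF _ (refl z h)))).
    by ring.
  - by apply: cvgB => //; apply: cvg_reflect_right; rewrite subr0.
  - by apply: cvgB => //; apply: cvg_reflect_left; rewrite subrr.
have e2 : \int[mu]_(v in `[0, n]) ((n - v) * g v) = (0 * J n + c) - ((n - 0) * 0 + 0).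
  have dl z : der (fun v => n - v) z (- 1) by der_auto; ring.
  apply: (@FTC_integrable R _ (fun v => (n - v) * J v + F v) 0 n _ _ n0).
  - apply: (@dominated_integrable R _ (fun v => n * E v) (fun v => n * e v) 0 n (n * K) n0).
    + by move=> z h; apply: continuousM; [exact: der_continuous (dl z)|exact: gc].
    + by move=> z h; apply: der_eq; [exact: (derM (der_cst n z) (dE h))|cbv beta; ring].
    + move=> z h; rewrite normrM ler_pM// ?ge//.
      by case/andP: h => ? ?; rewrite gtr0_norm; lra.
    + by move=> z h; rewrite normrM (gtr0_norm n0) ler_pM2l// EK.
  - by move=> z h; apply: continuousM; [exact: der_continuous (dl z)|exact: gc].
  - move=> z h; apply: der_eq; first exact: (derD (derM (dl z) (dJ h)) (dF z h)).
    by cbv beta; ring.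
  - apply: cvgD => //; apply: cvgM; last exact: J_ends.1.
    by have := der_cvg_right (dl 0); rewrite subr0.
  - apply: cvgD => //; apply: cvgM; last exact: J_ends.2.
    by have := der_cvg_left (dl n); rewrite subrr.
rewrite e2 (_ : 2 * _ = c - 0 - (0 - c)); last by ring.
rewrite -esum.
transitivity (\int[mu]_(x in `[0%R, n]) (J x + J (n - x))%:E)%E; last first.
  rewrite -[LHS]fineK//; exact: integrable_fin_num.
rewrite [RHS]integral_mkcond; apply: eq_integral => x _.
rewrite patchE; case: ifPn => xn.
  have h : 0 <= x <= n by move: xn; rewrite inE/= in_itv.
  rewrite -row// [RHS]integral_mkcond; apply: eq_integral => y _.
  rewrite patchE !indicE xn mul1r; case: ifPn => yn; last by rewrite mul0r.
  by rewrite mul1r.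
apply: integral0_eq => y _.
by rewrite !indicE (negbTE xn) !mul0r.
Qed.

End Difference.
End SquareDifference.

(** * Sums over pairs of points of a point process *)

Section KernelIntegrals.
Context {R : realType} {d d' : measure_display}
  {X : measurableType d} {Y : measurableType d'}.
Local Open Scope ereal_scope.
Import HBNNSimple.

(** The masses [k x setT] are finite for each [x] but not uniformly bounded, like the number of
    points in an interval over the outcomes. A bound depending on [x] is enough for the masses of
    sections to be measurable in [x], and simple functions do the rest. *)
Lemma measurable_integral_pointwise_finite (k : X -> {measure set Y -> \bar R})
    (f : X * Y -> \bar R) :
  (forall U, measurable U -> measurable_fun setT (k ^~ U)) ->
  (forall x, k x setT < +oo) ->
  measurable_fun setT f -> (forall z, 0 <= f z) ->
  measurable_fun setT (fun x => \int[k x]_y f (x, y)).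
Proof.
move=> mk kfin mf f0.
pose K : R.-ker X ~> Y := Kernel.Pack (Kernel.Class (@isKernel.Build _ _ X Y R k mk)).
pose f_ := nnsfun_approx measurableT mf.
apply: (@measurable_fun_xsection_integral _ _ _ _ _ _ k f_).
- by move=> a b ab; exact/nd_nnsfun_approx.
- by move=> z; apply: cvg_nnsfun_approx.
- move=> n r; pose A := f_ n @^-1` [set r].
  have mA : measurable A by rewrite -[A]setTI; exact: (measurable_funPT (f_ n) measurableT _ (measurable_set1 r)).
  have kb x : exists M, forall U, measurable U -> mrestr (K x) (@measurableT _ Y) U < M%:E.
    exists (fine (k x setT) + 1)%R => U mU.
    rewrite /mrestr setIT EFinD fineK; last by rewrite ge0_fin_numE// kfin.
    apply: le_lt_trans (le_measure _ _ _ (@subsetT _ U)) _; rewrite ?inE//.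
    by rewrite lteDl// ge0_fin_numE// kfin.
  have [_] := @measurable_prod_subset_xsection_kernel _ _ X Y R K setT measurableT kb A mA.
  by rewrite (_ : (fun x => mrestr _ _ _) = fun x => k x (xsection A x))//; apply/funext => x; rewrite /mrestr setIT.
Qed.

End KernelIntegrals.

(** The inner integral is measurable in the pair [(x, y)], with [k] regarded as a kernel on the
    product through its first component. *)
Lemma measurable_double_integral {R : realType} {d d' : measure_display}
    {X : measurableType d} {Y : measurableType d'}
    (k : X -> {measure set Y -> \bar R}) (f : Y * Y -> \bar R) :
  (forall U, measurable U -> measurable_fun setT (k ^~ U)) ->
  (forall x, k x setT < +oo)%E ->
  measurable_fun setT f -> (forall z, 0 <= f z)%E ->
  measurable_fun setT (fun x => \int[k x]_y \int[k x]_z f (y, z))%E.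
Proof.
move=> mk kfin mf f0.
pose g (p : X * Y) := (\int[k p.1]_z f (p.2, z))%E.
apply: (@measurable_integral_pointwise_finite _ _ _ X Y k g) => //.
- apply: (@measurable_integral_pointwise_finite _ _ _ _ _ (fun p : X * Y => k p.1)
    (fun q : (X * Y) * Y => f (q.1.2, q.2))) => //.
  + by move=> U mU; apply: (measurableT_comp (mk U mU)); exact: measurable_fst.
  + apply: (measurableT_comp mf); apply: measurable_fun_pair; last exact: measurable_snd.
    by apply: measurableT_comp; [exact: measurable_snd|exact: measurable_fst].
- by move=> z; apply: integral_ge0.
Qed.

Section PairSums.
Context {R : realType} {d : measure_display} {Omega : measurableType d}.
Variables (L : Omega -> set R) (D : set (measurableTypeR R)).
Hypotheses (Lfin : forall w, finite_set (L w `&` D)) (mD : measurable D)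
  (mL : forall B : set (measurableTypeR R), measurable B ->
     measurable_fun setT ((fun w => counting (L w `&` B)) : Omega -> \bar R)).

Definition points w : seq R := finmap.enum_fset (fset_set (L w `&` D)).

Lemma mem_points w x : (x \in points w) = (x \in L w `&` D).
Proof. by apply: in_fset_set; exact: Lfin. Qed.

Lemma points_uniq w : uniq (points w).
Proof. exact: finmap.fset_uniq. Qed.

(** As a finite sum of Dirac masses, it turns integrals into sums over [points w]; its values are
    those of [counting], whose measurability in [w] is given. *)
Definition point_measure w : {measure set (measurableTypeR R) -> \bar R} :=
  msum (fun i => \d_(nth 0 (points w) i : measurableTypeR R)) (size (points w)).

Lemma point_measureE w (B : set (measurableTypeR R)) :
  point_measure w B = counting (L w `&` (D `&` B)).
Proof.
rewrite /point_measure /= /msum.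
have finB : finite_set (L w `&` (D `&` B)) by rewrite setIA; exact: finite_setIl.
rewrite /counting; case: asboolP => // _.
have -> : size (finmap.enum_fset (fset_set (L w `&` (D `&` B))))
    = count (fun x => x \in B) (points w).
  rewrite -size_filter; apply/perm_size/uniq_perm.
  - exact: finmap.fset_uniq.
  - by rewrite filter_uniq// points_uniq.
  - move=> x; rewrite mem_filter mem_points.
    rewrite [LHS](in_fset_set finB) setIA in_setI andbC; congr andb.
rewrite -sum1_count natr_sum -sumEFin [RHS]big_mkcond [RHS](big_nth 0) [RHS]big_mkord.
by apply: eq_bigr => i _; rewrite /= diracE; case: (_ \in B).
Qed.

Lemma measurable_point_measure B : measurable B ->
  measurable_fun setT (point_measure ^~ B).
Proof.
move=> mB; rewrite (_ : point_measure ^~ B = fun w => counting (L w `&` (D `&` B))).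
  by apply: mL; exact: measurableI.
by apply/funext => w; exact: point_measureE.
Qed.

Lemma point_measure_fin w : (point_measure w setT < +oo)%E.
Proof.
rewrite point_measureE setIT /counting; case: asboolP => [_|]; first exact: ltry.
by case; exact: Lfin.
Qed.

Lemma integral_point_measure w (f : measurableTypeR R -> \bar R) :
  measurable_fun setT f -> (forall x, 0 <= f x)%E ->
  (\int[point_measure w]_x f x = \sum_(x <- points w) f x)%E.
Proof.
move=> mf f0; rewrite ge0_integral_measure_sum// (big_nth 0) big_mkord.
by apply: eq_bigr => i _; rewrite integral_dirac// diracT mul1e.
Qed.

Lemma measurable_pair_sum (f : measurableTypeR R * measurableTypeR R -> \bar R) :
  measurable_fun setT f -> (forall z, 0 <= f z)%E ->
  measurable_fun setT
    (fun w => \sum_(x <- points w) \sum_(y <- points w) f (x, y))%E.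
Proof.
move=> mf f0.
rewrite (_ : (fun w => _) = fun w => (\int[point_measure w]_x \int[point_measure w]_y f (x, y))%E).
  apply: measurable_double_integral => //.
  - exact: measurable_point_measure.
  - exact: point_measure_fin.
apply/funext => w; rewrite integral_point_measure//.
- by apply: eq_bigr => x _; rewrite integral_point_measure//; exact: measurable_fun_pair2.
- apply: (@measurable_integral_pointwise_finite _ _ _ _ _ (fun=> point_measure w)) => // _.
  exact: point_measure_fin.
- by move=> x; exact: integral_ge0.
Qed.

Lemma fsbig_pairs w (f : R * R -> R) :
  \sum_(p \in [set p : R * R | [/\ p.1 != p.2, (L w `&` D) p.1 & (L w `&` D) p.2]]) f p
  = \sum_(x <- points w) \sum_(y <- points w | x != y) f (x, y).
Proof.
pose r := [seq p <- [seq (x, y) | x <- points w, y <- points w] | p.1 != p.2].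
have ur : uniq r by rewrite filter_uniq// allpairs_uniq ?points_uniq// => -[? ?] [? ?].
have -> : [set p : R * R | [/\ p.1 != p.2, (L w `&` D) p.1 & (L w `&` D) p.2]] = [set` r].
  apply/seteqP; split => [[x y]/= [xy Lx Ly]|[x y]/=]; rewrite mem_filter/=.
    by rewrite xy; apply/allpairsP; exists (x, y); split => //; rewrite mem_points inE.
  move=> /andP[xy /allpairsP[[a b]/= [pa pb [ea eb]]]].
  by move: pa pb; rewrite -ea -eb !mem_points !inE; split.
rewrite -fsbig_seq// big_filter big_mkcond big_allpairs/=.
by apply: eq_bigr => x _; rewrite -big_mkcond.
Qed.

(** As [F] vanishes off [D x D], the sum over the possibly infinite configuration reduces to the
    finite list [points w]. *)
Lemma esum_pairs w (F : 2.-tuple (measurableTypeR R) -> \bar R) :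
  (forall t, 0 <= F t)%E ->
  (forall t, ~ (D (tnth t ord0) /\ D (tnth t ord_max)) -> F t = 0%E) ->
  (\esum_(t in [set t : 2.-tuple (measurableTypeR R) |
                   uniq t /\ forall i, L w (tnth t i)]) F t
  = \sum_(x <- points w) \sum_(y <- points w | x != y) F [tuple x; y])%E.
Proof.
move=> F0 FD.
pose r : seq (2.-tuple (measurableTypeR R)) :=
  [seq [tuple p.1; p.2] | p <- [seq p <- [seq (x, y) | x <- points w, y <- points w] | p.1 != p.2]].
have ur : uniq r.
  rewrite map_inj_uniq; last by move=> [a b] [a' b']/= [-> ->].
  by rewrite filter_uniq// allpairs_uniq ?points_uniq// => -[? ?] [? ?].
rewrite (_ : (\esum_(t in _) F t = \esum_(t in [set` r]) F t)%E); last first.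
  rewrite esum_mkcond [RHS]esum_mkcond; apply: eq_esum => t _.
  case/tupleP: t => x t; case/tupleP: t => y t; rewrite (tuple0 t) {t}.
  have [DD|nD] := pselect (D x /\ D y); last first.
    by rewrite FD//; case: ifP; case: ifP.
  congr (if _ then _ else _); apply/idP/idP; rewrite !inE/=.
    move=> [/andP[xy _] Lxy]; apply/mapP; exists (x, y) => //=.
    rewrite mem_filter/=; apply/andP; split; first by move: xy; rewrite inE.
    apply/allpairsP; exists (x, y); split => //; rewrite mem_points inE; split; try by case: DD.
    - by have := Lxy ord0.
    - by have := Lxy ord_max.
  move=> /mapP[[a b]]; rewrite mem_filter => /andP[/= ab /allpairsP[[a' b']/= [pa pb [ea eb]]]] e.
  have [-> ->] : x = a /\ y = b by case: e.
  rewrite inE ab; split => // i; move: pa pb; rewrite -ea -eb !mem_points !inE => -[La _] [Lb _].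
  by case: i => -[|[|//]] /= ?.
rewrite esum_fset; last 2 first.
- exact: finite_seq.
- by move=> t _; exact: F0.
rewrite -fsbig_seq// big_map big_filter big_mkcond big_allpairs/=.
by apply: eq_bigr => x _; rewrite -big_mkcond.
Qed.

End PairSums.

(** * The mean of the pair energy *)

Section MeanLogSine.
Context {R : realType}.
Implicit Types (n v : R).
Local Notation mu := (@lebesgue_measure R).

(** Two integrations by parts: the primitives [L] and [M] of [log_sine_primitive] tend to 0 at both
    ends. Hence the constant term of [rho_2] contributes nothing to the mean energy. *)
Lemma integral_log2sin_triangle n : 0 < n ->
  \int[mu]_(v in `[0, n]) ((n - v) * log2sin n v) = 0.
Proof.
move=> n0; have [L [M [dL L0 _ [L1 dM M0 M1]]]] := @log_sine_primitive R.
have dl z : der (fun v => n - v) z (- 1) by der_auto; ring.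
have ds z : der (fun v => v / n) z n^-1 by der_auto; ring.
have cg v : 0 < v < n -> {for v, continuous (fun v => n - v)}.
  by move=> _; exact: der_continuous (dl v).
have gn v : 0 < v < n -> `|n - v| <= n.
  by move=> /andP[? ?]; rewrite gtr0_norm; lra.
rewrite [RHS](_ : 0 = n * (0 * 0) + n ^+ 2 * 0 - (n * ((n - 0) * 0) + n ^+ 2 * 0)); last by ring.
apply: (@FTC_integrable R _ (fun v => n * ((n - v) * L (v / n)) + n ^+ 2 * M (v / n)) 0 n _ _ n0).
- exact: integrable_log2sin_mul n0 (ltW n0) cg gn.
- move=> z h; apply: continuousM; first exact: cg.
  exact: der_continuous (der_log2sin_scaled h).
- move=> z h; have hL := der_comp (ds z) (dL _ (unit_scaled h)).
  have hM := der_comp (ds z) (dM _ (unit_scaled h)).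
  apply: der_eq.
    exact: (derD (derM (der_cst n z) (derM (dl z) hL)) (derM (der_cst (n ^+ 2) z) hM)).
  by cbv beta; rewrite /log2sin; field; rewrite gt_eqF.
- apply: cvgD; (apply: cvgM; first exact: cvg_cst); last exact: cvg_comp_div_right0 M0.
  apply: cvgM; last exact: cvg_comp_div_right0 L0.
  exact: der_cvg_right (dl 0).
- apply: cvgD; (apply: cvgM; first exact: cvg_cst); last exact: cvg_comp_div_left M1.
  apply: cvgM; last exact: cvg_comp_div_left L1.
  by have := der_cvg_left (dl n); rewrite subrr.
Qed.

End MeanLogSine.

Section ExpectedPairSum.
Context {R : realType} {d : measure_display} {Omega : measurableType d}.
Variables (P : probability Omega R) (L : Omega -> set R) (b : dyson_index).
Hypotheses (Ls : simple_point_process L)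
  (rho2 : @correlation_function R d Omega P L 2
    (fun x => 1 - T2 b (tnth x ord0 - tnth x ord_max))).
Variable n : R.
Hypothesis n0 : 0 < n.
Local Notation D := (`[0, n]%classic : set (measurableTypeR R)).
Local Notation mu := (@lebesgue_measure R).

Let Lfin w : finite_set (L w `&` D). Proof. by have [h _] := Ls; exact: h. Qed.
Let mD : measurable D. Proof. exact: measurable_itv. Qed.

Definition pair_sum (f : R -> R) w : R :=
  \sum_(x <- points L D w) \sum_(y <- points L D w | x != y) f (x - y).

Section PairSum.
Variables (f e E : R -> R) (K : R).
Hypotheses (mf : measurable_fun setT (f : measurableTypeR R -> measurableTypeR R))
  (f0 : forall v, 0 <= f v) (fN : forall v, f (- v) = f v)
  (fc : forall v, 0 < v < n -> {for v, continuous f})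
  (dE : forall v, 0 < v < n -> der E v (e v))
  (fe : forall v, 0 < v < n -> `|f v| <= e v)
  (EK : forall v, 0 < v < n -> `|E v| <= K).

Let F (t : 2.-tuple (measurableTypeR R)) : \bar R :=
  (\1_D (tnth t ord0) * \1_D (tnth t ord_max) * f (tnth t ord0 - tnth t ord_max))%:E.

Let mF : measurable_fun setT F.
Proof.
apply/measurable_EFinP; apply: measurable_funM; first apply: measurable_funM.
- by apply: measurableT_comp; [exact: measurable_indic|exact: measurable_tnth].
- by apply: measurableT_comp; [exact: measurable_indic|exact: measurable_tnth].
apply: (measurableT_comp mf).
by apply: measurable_funB; exact: measurable_tnth.
Qed.

Let esumF w : (\esum_(t in [set t : 2.-tuple (measurableTypeR R) |
      uniq t /\ forall i, L w (tnth t i)]) F t = (pair_sum f w)%:E)%E.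
Proof.
rewrite (esum_pairs Lfin).
- rewrite /pair_sum -sumEFin big_seq [RHS]big_seq; apply: eq_bigr => x xp.
  rewrite -sumEFin big_seq_cond [RHS]big_seq_cond; apply: eq_bigr => y /andP[yp _].
  move: xp yp; rewrite !mem_points// !inE => -[_ Dx] [_ Dy].
  by rewrite /F !indicE /= !mem_set// !mul1r.
- by move=> t; rewrite lee_fin mulr_ge0// mulr_ge0// indicE.
- move=> t nD; rewrite /F !indicE.
  case: (asboolP (D (tnth t ord0))) => [D0|D0]; last by rewrite memNset// !mul0r.
  have D1 : ~ D (tnth t ord_max) by move=> ?; apply: nD.
  by rewrite (memNset D1) mulr0 mul0r.
Qed.

Lemma expected_pair_sum :
  (\int[P]_w (pair_sum f w)%:E
   = (2 * \int[mu]_(v in `[0, n]) ((n - v) * (f v * (1 - T2 b v)))%R)%:E)%E.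
Proof.
have F0 t : (0 <= F t)%E by rewrite lee_fin mulr_ge0// mulr_ge0// indicE.
have := rho2 mF F0; under eq_integral do rewrite esumF; move=> -> /=.
(* The constant 42 bounds [|1 - T2|], as [|T2| <= 41]. *)
rewrite -(@integral_square_difference R (fun v => f v * (1 - T2 b v)) (fun v => 42 * e v)
  (fun v => 42 * E v) (42 * K) n n0).
- apply: eq_integral => x _; apply: eq_integral => y _.
  by rewrite /F -EFinM !(tnth_nth 0)/= mulrA.
- by move=> v; rewrite fN T2N.
- move=> v h; apply: continuousM; first exact: fc.
  apply: continuousB; first exact: cvg_cst.
  by case/andP: h => v0 _; exact: T2_continuous.
- by move=> v h; apply: der_eq; [exact: (derM (der_cst 42 v) (dE h))|cbv beta; ring].
- move=> v h; rewrite mulrC normrM ler_pM ?fe//.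
  apply: le_trans (ler_normB _ _) _; rewrite normr1; have := norm_T2_le b v; lra.
- by move=> v h; rewrite normrM (ger0_norm (ler0n _ 42)) ler_pM2l// EK.
Qed.

Lemma integrable_pair_sum : P.-integrable setT (EFin \o pair_sum f).
Proof.
(* The value 0 on the diagonal turns the sum over distinct points into a sum over all pairs. *)
have mD2 : measurable_fun setT (fun p : measurableTypeR R * measurableTypeR R =>
    if p.1 == p.2 then 0%E else (f (p.1 - p.2))%:E : \bar R).
  apply: measurable_fun_ifT.
  - by apply: measurable_fun_eqr; [exact: measurable_fst|exact: measurable_snd].
  - exact: measurable_cst.
  - apply/measurable_EFinP; apply: (measurableT_comp mf).
    by apply: measurable_funB; [exact: measurable_fst|exact: measurable_snd].
apply/integrableP; split.
  have mL : forall B : set (measurableTypeR R), measurable B ->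
      measurable_fun setT ((fun w => counting (L w `&` B)) : Omega -> \bar R).
    by have [_ h] := Ls.
  have := measurable_pair_sum Lfin mD mL mD2.
  rewrite (_ : (fun w => _) = EFin \o pair_sum f); last first.
    apply/funext => w; rewrite /= /pair_sum -sumEFin; apply: eq_bigr => x _.
    by rewrite -sumEFin [RHS]big_mkcond; apply: eq_bigr => y _; case: eqVneq.
  by apply => -[x y] /=; case: ifP => // _; rewrite lee_fin.
have p0 w : 0 <= pair_sum f w by apply: sumr_ge0 => x _; apply: sumr_ge0 => y _.
under eq_integral do rewrite /= ger0_norm//.
by rewrite expected_pair_sum ltry.
Qed.

End PairSum.
(** The absolute value makes it even on the whole line; it agrees with [ln 2 - log2sin n v] on
    [[0, n]]. At the zeros of the sine, [ln 0 = 0] gives the value [ln 2], so that it is nonnegative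
    everywhere, as [correlation_function] requires. *)
Definition neglog2sin v : R := ln 2 - ln `|2 * sin (pi * v / n)|.

Let neglog2sin_ge0 v : 0 <= neglog2sin v.
Proof.
rewrite subr_ge0; have [->|s0] := eqVneq (2 * sin (pi * v / n)) 0.
  by rewrite normr0 ln0 ?ln_ge0//; lra.
rewrite ler_ln ?posrE ?normr_gt0// normrM ger0_norm// -[leRHS]mulr1 ler_pM2l//.
by rewrite ler_norml sin_geN1 sin_le1.
Qed.

Let neglog2sinN v : neglog2sin (- v) = neglog2sin v.
Proof. by rewrite /neglog2sin mulrN mulNr sinN mulrN normrN. Qed.

Let neglog2sinE v : 0 <= v <= n -> neglog2sin v = ln 2 - log2sin n v.
Proof.
move=> /andP[v0 vn]; rewrite /neglog2sin /log2sin -mulrA ger0_norm//.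
rewrite mulr_ge0// sin_ge0_pi//; have pi0 := @pi_gt0 R.
rewrite mulr_ge0 ?divr_ge0 ?(ltW pi0) ?(ltW n0)//=.
by rewrite ger_pMr// ler_pdivrMr// mul1r.
Qed.

Let measurable_neglog2sin :
  measurable_fun setT (neglog2sin : measurableTypeR R -> measurableTypeR R).
Proof.
apply: measurable_funB; first exact: measurable_cst.
apply: (measurableT_comp (@measurable_ln R)).
apply: (measurableT_comp (@normr_measurable R setT)).
apply: measurable_funM; first exact: measurable_cst.
apply: continuous_measurable_fun => v.
have e : der (fun v => pi * v / n) v (pi / n) by der_auto; ring.
exact: der_continuous (der_comp e (is_derive_sin _)).
Qed.

Let neglog2sin_continuous v : 0 < v < n -> {for v, continuous neglog2sin}.
Proof.
move=> h; have dh := derB (der_cst (ln 2) v) (der_log2sin_scaled h).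
apply: der_continuous; apply: (der_oo h _ dh) => y /andP[y0 yn].
by rewrite neglog2sinE// !ltW.
Qed.

Let e v : R := ln 2 + log_env (v / n).
Let E v : R := ln 2 * v + n * log_envI (v / n).

Let dE v : 0 < v < n -> der E v (e v).
Proof.
move=> h; have d1 : der (fun v => ln 2 * v) v (ln 2) by der_auto; ring.
exact: derD d1 (der_log_envI_scaled h).
Qed.

Let neglog2sin_le v : 0 < v < n -> `|neglog2sin v| <= e v.
Proof.
move=> /[dup] h /andP[v0 vn]; rewrite neglog2sinE ?(ltW v0) ?(ltW vn)//.
apply: le_trans (ler_normB _ _) _; rewrite ger0_norm ?ln_ge0//; last lra.
by rewrite lerD2l norm_log2sin_scaled_le.
Qed.

Let E_le v : 0 < v < n -> `|E v| <= ln 2 * n + n * 7.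
Proof.
move=> /[dup] h /andP[v0 vn]; apply: le_trans (ler_normD _ _) _.
have l2 : 0 <= ln 2 :> R by rewrite ln_ge0; lra.
rewrite !normrM (ger0_norm l2) (gtr0_norm v0) (gtr0_norm n0) lerD//.
  by rewrite ler_wpM2l// ltW.
by rewrite ler_wpM2l ?(ltW n0)// norm_log_envI_le// unit_scaled.
Qed.

Let iB : P.-integrable setT (EFin \o pair_sum neglog2sin).
Proof. exact: (@integrable_pair_sum _ e E (ln 2 * n + n * 7)). Qed.

Let eB := @expected_pair_sum _ e E _ measurable_neglog2sin neglog2sin_ge0 neglog2sinN
  neglog2sin_continuous dE neglog2sin_le E_le.

Let d1 v : 0 < v < n -> der (id : R -> R) v ((fun=> 1) v).
Proof. by move=> _; exact: der_id. Qed.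

Let c1 v : 0 < v < n -> {for v, continuous (fun _ : R => 1 : R)}.
Proof. by move=> _; exact: cvg_cst. Qed.

Let b1 v : 0 < v < n -> `|(1 : R)| <= (fun=> 1) v.
Proof. by rewrite normr1. Qed.

Let K1 v : 0 < v < n -> `|v| <= n.
Proof. by move=> /andP[v0 vn]; rewrite gtr0_norm// ltW. Qed.

Let iA : P.-integrable setT (EFin \o pair_sum (fun=> 1)).
Proof.
by apply: (@integrable_pair_sum _ (fun=> 1) id n) => //; exact: measurable_cst.
Qed.

Let eA := @expected_pair_sum (fun=> 1) (fun=> 1) id n (measurable_cst _)
  (fun=> ler01) (fun=> erefl) c1 d1 b1 K1.

(** The two contributions of [ln 2] cancel, and [integral_log2sin_triangle] removes the logarithm
    against the constant part of [1 - T2]. *)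
Let pair_log_integral :
  n^-1 * (2 * \int[mu]_(v in `[0, n]) ((n - v) * (neglog2sin v * (1 - T2 b v)))
   - ln 2 * (2 * \int[mu]_(v in `[0, n]) ((n - v) * (1 * (1 - T2 b v)))))
  = 2 * \int[mu]_(v in `[0, n]) ((1 - v / n) * T2 b v * log2sin n v).
Proof.
have cl v : 0 < v < n -> {for v, continuous (fun v => n - v)}.
  move=> _; apply: continuousB; [exact: cvg_cst|exact: cvg_id].
have cT v : 0 < v < n -> {for v, continuous (T2 b)}.
  by move=> /andP[v0 _]; exact: T2_continuous.
have bl v : 0 < v < n -> `|n - v| <= n.
  by move=> /andP[? ?]; rewrite gtr0_norm; lra.
have bT v : 0 < v < n -> `|(n - v) * T2 b v| <= n * 41.
  by move=> h; rewrite normrM ler_pM ?norm_T2_le ?bl.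
have i1 := integrable_log2sin_mul n0 (ltW n0) cl bl.
have n41 : 0 <= n * 41 by rewrite mulr_ge0// ltW.
have i2 := integrable_log2sin_mul n0 n41 (fun v h => continuousM (cl v h) (cT v h)) bT.
have i3 : mu.-integrable `[0, n] (EFin \o (fun v => (n - v) * (1 * (1 - T2 b v)))).
  apply: (@dominated_integrable R _ (fun v => n * 42 * v) (fun=> n * 42) 0 n (n * 42 * n) n0).
  - move=> v h; apply: continuousM; first exact: cl.
    apply: continuousM; first exact: cvg_cst.
    by apply: continuousB; [exact: cvg_cst|exact: cT].
  - by move=> v _; der_auto; ring.
  - move=> v h; rewrite normrM ler_pM ?bl// mul1r.
    by apply: le_trans (ler_normB _ _) _; rewrite normr1; have := norm_T2_le b v; lra.
  - by move=> v h; rewrite normrM ger0_norm ?ler_wpM2l ?K1 ?mulr_ge0 ?(ltW n0).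
have -> : \int[mu]_(v in `[0, n]) ((n - v) * (neglog2sin v * (1 - T2 b v)))
   = \int[mu]_(v in `[0, n]) (ln 2 * ((n - v) * (1 * (1 - T2 b v)))
      + ((n - v) * T2 b v * log2sin n v - (n - v) * log2sin n v)).
  apply: eq_Rintegral => v; rewrite inE/= in_itv/= => h.
  by rewrite neglog2sinE//; ring.
rewrite RintegralD//; last 2 first.
- exact: (integrableZl _ (ln 2) i3).
- exact: (integrableB _ i2 i1).
rewrite RintegralB// RintegralZl// integral_log2sin_triangle//.
rewrite (_ : \int[mu]_(v in `[0, n]) ((1 - v / n) * T2 b v * log2sin n v)
   = n^-1 * \int[mu]_(v in `[0, n]) ((n - v) * T2 b v * log2sin n v)); first ring.
rewrite -RintegralZl//; apply: eq_Rintegral => v _; field; rewrite gt_eqF//.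
Qed.

Lemma mean_log_energy :
  let W w := ln n - n^-1 * \sum_(p \in [set p : R * R | [/\ p.1 != p.2,
     (L w `&` `[0, n]) p.1 & (L w `&` `[0, n]) p.2]])
       ln `|2 * sin (pi * (p.1 - p.2) / n)| in
  P.-integrable setT (EFin \o W) /\
  (\int[P]_w (W w)%:E
   = (ln n + 2 * \int[mu]_(v in `[0, n]) ((1 - v / n) * T2 b v * log2sin n v))%:E)%E.
Proof.
move=> W.
have WE : W = fun w => ln n + n^-1 * (pair_sum neglog2sin w - ln 2 * pair_sum (fun=> 1) w).
  apply/funext => w; rewrite /W -mulrN; congr (_ + _ * _).
  rewrite (fsbig_pairs Lfin) /pair_sum mulr_sumr -sumrB -sumrN; apply: eq_bigr => x _.
  rewrite mulr_sumr -sumrB -sumrN; apply: eq_bigr => y _.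
  by rewrite /neglog2sin mulr1 /=; ring.
have iA2 : P.-integrable setT (EFin \o (fun w => ln 2 * pair_sum (fun=> 1) w)).
  exact: (integrableZl _ (ln 2) iA).
have iAB : P.-integrable setT (EFin \o (fun w => pair_sum neglog2sin w - ln 2 * pair_sum (fun=> 1) w)).
  exact: (integrableB _ iB iA2).
have iABn : P.-integrable setT (EFin \o (fun w => n^-1 * (pair_sum neglog2sin w - ln 2 * pair_sum (fun=> 1) w))).
  exact: (integrableZl _ (n^-1) iAB).
have ic : P.-integrable setT (EFin \o (fun=> ln n : R)).
  exact: finite_measure_integrable_cst.
have iW : P.-integrable setT (EFin \o W).
  by rewrite WE; exact: (integrableD _ ic iABn).
split => //.
have iWfin := integrable_fin_num measurableT iW.
transitivity ((\int[P]_w W w)%:E); first by rewrite fineK.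
have eAR : \int[P]_w pair_sum (fun=> 1) w = 2 * \int[mu]_(v in `[0, n]) ((n - v) * (1 * (1 - T2 b v))).
  by rewrite /Rintegral eA.
have eBR : \int[P]_w pair_sum neglog2sin w = 2 * \int[mu]_(v in `[0, n]) ((n - v) * (neglog2sin v * (1 - T2 b v))).
  by rewrite /Rintegral eB.
rewrite WE RintegralD// RintegralZl// RintegralB// RintegralZl// Rintegral_cst//.
rewrite eAR eBR pair_log_integral [X in ln n * X](_ : _ = 1) ?mulr1//.
by rewrite -[RHS]/(fine 1%E); congr fine; exact: probability_setT.
Qed.

End ExpectedPairSum.

(** * The correlation functions of one and two points *)

Section SmallCorrelations.
Context {R : realType}.
Implicit Types (b : dyson_index) (x y v : R) (K : R -> R -> 'M[R]_2).

Lemma mxtrace_mx2 (a b c d : R) : \tr (mx2 a b c d) = a + d.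
Proof. by rewrite /mxtrace !big_ord_recl big_ord0 !mxE/= addr0. Qed.

Lemma mxtrace_mul_mx2 (a b c d a' b' c' d' : R) :
  \tr (mx2 a b c d *m mx2 a' b' c' d') = a * a' + b * c' + (c * b' + d * d').
Proof.
rewrite /mxtrace !big_ord_recl big_ord0 !mxE !big_ord_recl !big_ord0 !mxE/=.
by rewrite !addr0.
Qed.

Lemma orbit_fixed (T : finType) (f : T -> T) i : f i = i -> fingraph.orbit f i = [:: i].
Proof.
move=> fi; rewrite /fingraph.orbit (@order_cycle _ _ [:: i])//=; rewrite ?inE//.
by rewrite fi eqxx.
Qed.

Lemma froots_id (T : finType) (i : T) : froots (1%g : {perm T}) i.
Proof.
apply/eqP.
have := connect_root (frel (1%g : {perm T})) i.
move: (fingraph.root _ _) => j; move/connectP => [p]; elim: p i => [|k p ih] i /=.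
  by move=> _ ->.
by rewrite perm1 => /andP[/eqP <-]; exact: ih.
Qed.

Lemma qdet1 K x : qdet K (tnth [tuple x]) = 2^-1 * \tr (K x x).
Proof.
rewrite /qdet (big_pred1 (1%g : 'S_1)); last first.
  by move=> s; apply/esym/eqP/permP => i; rewrite !ord1.
rewrite odd_perm1 expr0 mul1r big_mkcond big_ord1.
by rewrite froots_id orbit_fixed ?perm1// big_seq1 perm1 (tnth_nth 0).
Qed.

Lemma perm_ord2 (s : 'S_2) : s = 1%g \/ s = tperm ord0 ord_max.
Proof.
have ord2 (i : 'I_2) : i = ord0 \/ i = ord_max.
  by case: i => -[|[|//]] h; [left|right]; exact: val_inj.
have [s0|s0] := ord2 (s ord0); have [s1|s1] := ord2 (s ord_max).
- by have := perm_inj (etrans s0 (esym s1)).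
- by left; apply/permP => i; rewrite perm1; have [->|->] := ord2 i.
- right; apply/permP => i; have [->|->] := ord2 i; first by rewrite tpermL.
  by rewrite tpermR.
- by have := perm_inj (etrans s0 (esym s1)).
Qed.

Lemma qdet2 K x y : qdet K (tnth [tuple x; y]) =
  2^-1 * \tr (K x x) * (2^-1 * \tr (K y y)) - 2^-1 * \tr (K x y *m K y x).
Proof.
set t := tperm (ord0 : 'I_2) ord_max.
have t0 : t ord0 = ord_max by rewrite tpermL.
have t1 : t ord_max = ord0 by rewrite tpermR.
have x0 : tnth [tuple x; y] ord0 = x by [].
have x1 : tnth [tuple x; y] ord_max = y by [].
rewrite /qdet (bigD1 (1%g : 'S_2))//= (big_pred1 t); last first.
  move=> s; have [->|->] := perm_ord2 s.
    by rewrite /= eqxx; apply/esym/eqP => /permP /(_ ord0); rewrite t0 perm1.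
  by rewrite /= -/t eqxx; apply/eqP => /permP /(_ ord0); rewrite t0 perm1.
rewrite odd_perm1 expr0 mul1r odd_tperm/= expr1 mulN1r.
have l1 : lift ord0 ord0 = ord_max :> 'I_2 by exact: val_inj.
congr (_ - _).
  rewrite big_mkcond !big_ord_recl big_ord0 !froots_id /= mulr1.
  by rewrite !orbit_fixed ?perm1// !big_seq1 !perm1 l1 x0 x1.
have cyc : fcycle t [:: ord0; ord_max] by rewrite /= t0 t1 !eqxx.
have o0 : fingraph.orbit t ord0 = [:: ord0; ord_max].
  by rewrite /fingraph.orbit (order_cycle cyc)//= t0.
have o1 : fingraph.orbit t ord_max = [:: ord_max; ord0].
  by rewrite /fingraph.orbit (order_cycle cyc)//= t1.
have r01 : froot t ord0 = froot t ord_max.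
  apply/(fingraph.rootP (fconnect_sym (@perm_inj _ t))).
  by rewrite -t0; exact: fconnect1.
rewrite big_mkcond !big_ord_recl big_ord0 /= mulr1 l1 o0 o1.
rewrite !big_cons !big_nil !t0 !t1 x0 x1 !mulr1.
rewrite /fingraph.roots/= -r01.
(* The representative of the 2-cycle is whichever point [froot] picks: exactly one of the two
   factors is present, and both have the same value by cyclicity of the trace. *)
have -> : (froot t ord0 == ord_max) = ~~ (froot t ord0 == ord0).
  by case: (froot t ord0) => -[|[|//]].
by case: (_ == ord0); rewrite /= ?mulr1 ?mul1r// mxtrace_mulC.
Qed.

Let K1xx x : \tr (K1 x x) = 2.
Proof. by rewrite /K1 mxtrace_mx2 subrr sinc0; ring. Qed.

Let K4xx x : \tr (K4 x x) = 2.
Proof. by rewrite /K4 mxtrace_mx2 subrr mulr0 sinc0; ring. Qed.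

Lemma sine_rho1 b x : sine_rho b [tuple x] = 1.
Proof.
case: b => /=.
- by rewrite qdet1 K1xx mulVf.
- by rewrite det_mx11 mxE /K2 subrr sinc0.
- by rewrite qdet1 K4xx mulVf.
Qed.

Let derive1_sinc_sub x y : x != y ->
  derive1 (fun z : R => sinc (z - y)) x = dsinc (x - y).
Proof.
move=> xy; apply: der_derive1; apply: der_translate; apply: der_sinc.
by rewrite subr_eq0.
Qed.

Let derive1_sinc_scaled_sub x y : x != y ->
  derive1 (fun z : R => sinc (2 * (z - y))) x = 2 * dsinc (2 * (x - y)).
Proof.
move=> xy; apply: der_derive1; apply: (@der_translate R (fun v => sinc (2 * v))).
have h : der sinc (2 * (x - y)) (dsinc (2 * (x - y))).
  by apply: der_sinc; rewrite mulf_neq0// subr_eq0.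
by der_auto; ring.
Qed.

Lemma sine_rho2 b x y : sine_rho b [tuple x; y] = 1 - T2 b (x - y).
Proof.
have pi0 := @pi_gt0 R; case: b => /=.
- rewrite qdet2 !K1xx mulVf// mulr1 /K1 mxtrace_mul_mx2.
  (* On the diagonal the lower left entry of the kernel is 0 and annihilates the derivative entry,
     just as in [T2] at 0. *)
  have [->|xy] := eqVneq x y.
    by rewrite subrr mulr0 sine_integral0 sgr0 sinc0; pi_field; rewrite gt_eqF.
  have yx : y != x by rewrite eq_sym.
  have v0 : x - y != 0 by rewrite subr_eq0.
  rewrite !derive1_sinc_sub// derive1_sinc// -(opprB x y) sincN dsincN.
  by rewrite (mulrN pi) sine_integralN sgrN; pi_field; rewrite gt_eqF.
- rewrite (expand_det_row _ ord0) !big_ord_recl big_ord0 /cofactor !det_mx11 !mxE/=.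
  rewrite !(tnth_nth 0)/= /K2 !subrr sinc0 -(opprB x y) sincN.
  by rewrite /bump/=; ring.
- rewrite qdet2 !K4xx mulVf// mulr1 /K4 mxtrace_mul_mx2.
  have [->|xy] := eqVneq x y.
    by rewrite subrr !mulr0 sine_integral0 sinc0; pi_field; rewrite gt_eqF.
  have yx : y != x by rewrite eq_sym.
  have v0 : x - y != 0 by rewrite subr_eq0.
  rewrite !derive1_sinc_scaled_sub// derive1_sinc_scaled// -(opprB x y) !(mulrN 2) sincN dsincN.
  by rewrite (mulrN (2 * pi)) sine_integralN; pi_field; rewrite gt_eqF.
Qed.

End SmallCorrelations.

(** * Convergence of the mean of [W], from the two-point correlation function *)

Lemma mean_W {R : realType} (b : dyson_index) (d : measure_display)
    (Omega : measurableType d) (P : probability Omega R) (L : Omega -> set R) :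
  simple_point_process L ->
  @correlation_function R d Omega P L 2
    (fun x => 1 - T2 b (tnth x ord0 - tnth x ord_max)) ->
  (forall N : nat, (0 < N)%N -> P.-integrable setT (EFin \o W L N)) /\
  'E_P[W L N]%E @[N --> \oo] --> (limit_mean_W b)%:E.
Proof.
move=> Ls rho2.
have WE N : W L N = fun w => ln N%:R - N%:R^-1 * \sum_(p \in [set p : R * R | [/\ p.1 != p.2,
     (L w `&` `[0, N%:R]) p.1 & (L w `&` `[0, N%:R]) p.2]])
       ln `|2 * sin (pi * (p.1 - p.2) / N%:R)|.
  by apply/funext => w; rewrite /W mulNr addrC.
have N0 N : (0 < N)%N -> 0 < N%:R :> R by rewrite ltr0n.
split=> [N /N0 n0|]; first by rewrite WE; have [] := mean_log_energy Ls rho2 n0.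
have EW N : (0 < N)%N -> ('E_P[W L N] = (ln N%:R + 2 *
    \int[lebesgue_measure]_(v in `[0, N%:R]) ((1 - v / N%:R) * T2 b v * log2sin N%:R v))%:E)%E.
  by move=> /N0 n0; rewrite unlock WE; have [_ ->] := mean_log_energy Ls rho2 n0.
apply: cvg_EFin; first by have := nbhs_infty_gt 0; apply: filterS => N /EW ->.
apply: cvg_trans (@cluster_log_lim R b); apply: near_eq_cvg.
by have := nbhs_infty_gt 0; apply: filterS => N /EW /= ->.
Qed.

Theorem proposition3p2 (R : realType) (b : dyson_index) :
  [/\ forall x : R, sine_rho b [tuple x] = 1,
      forall x y : R, sine_rho b [tuple x; y] = 1 - T2 b (x - y),
      (ereal_sup (range (fun v : R => `|T2 b v|%:E)) < +oo)%E,
      exists (eps : R) (alpha : nat -> R),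
        [/\ 0 < eps,
            (fun N : nat => ln N%:R : R^o) =o_\oo (alpha : nat -> R^o),
            (alpha : nat -> R^o) =o_\oo (fun N : nat => N%:R `^ (2^-1 - eps) : R^o),
            forall eta : R, 0 < eta ->
              \forall N \near \oo,
                forall A : R, alpha N <= A <= N%:R - alpha N ->
                  (`| \int[lebesgue_measure]_(v in `[alpha N, A])
                        (T2 b v * ln `|2 * sin (pi * v / N%:R)|)%:E |
                   <= eta%:E)%E
          & (fun N : nat =>
               1 - \int[lebesgue_measure]_(v in `[- alpha N, alpha N]) T2 b v : R^o)
            =o_\oo (fun N : nat => (ln N%:R)^-1 : R^o)]
    & improper_integral (@T2 R b) 1 /\
      (exists l : R, improper_integral (fun v : R => T2 b v * ln `|v|) l)] /\
  (forall (d : measure_display) (Omega : measurableType d)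
          (P : probability Omega R) (L : Omega -> set R),
     sine_process P L b ->
     [/\ @correlation_function R d Omega P L 1 (fun=> 1),
         @correlation_function R d Omega P L 2
           (fun x => 1 - T2 b (tnth x ord0 - tnth x ord_max)),
         forall N : nat, (0 < N)%N -> P.-integrable setT (EFin \o W L N)
       & 'E_P[W L N]%E @[N --> \oo] --> (limit_mean_W b)%:E]).
Proof.
have rhoE2 : (fun x : 2.-tuple R => 1 - T2 b (tnth x ord0 - tnth x ord_max)) = @sine_rho R b 2.
  apply/funext => t; case/tupleP: t => x t; case/tupleP: t => y t; rewrite (tuple0 t).
  by rewrite -sine_rho2; congr sine_rho; exact: val_inj.
have rhoE1 : (fun=> 1) = @sine_rho R b 1.
  apply/funext => t; case/tupleP: t => x t; rewrite (tuple0 t) -(sine_rho1 b x).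
  by congr sine_rho; exact: val_inj.
split; first split.
- exact: sine_rho1.
- exact: sine_rho2.
- apply: le_lt_trans (ltry 41); apply: ge_ereal_sup => _ [v _ <-].
  by rewrite lee_fin norm_T2_le.
- exact: window_scale.
- split; first exact: T2_improper_integral.
  by exists (limit_mean_W b - ln (2 * pi)); exact: T2_ln_improper_integral.
move=> d Omega P L [Ls _ rho].
have rho2 : @correlation_function R d Omega P L 2
    (fun x => 1 - T2 b (tnth x ord0 - tnth x ord_max)) by rewrite rhoE2; exact: rho.
have [iW lW] := mean_W Ls rho2.
by split => //; rewrite rhoE1; exact: rho.
Qed.
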